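(* Let $(\Omega,\mathcal A,\mathrm P)$ be a probability space, $E$ be a separable Banach space, and $X:\Omega\to E$ and $Y:\Omega\to\mathbb R^n$ be jointly Gaussian random variables. Define $$\mu_{X|Y}(y) := \mathbb E X + \operatorname{cov}(X,Y)(\operatorname{cov}Y)^\dagger (y-\mathbb E Y),\qquad y\in\mathbb R^n,$$ $$C_{X|Y} := \operatorname{cov}(X) - \operatorname{cov}(X,Y)(\operatorname{cov}Y)^\dagger\operatorname{cov}(Y,X).$$ Then for every version $\mathrm P_{X|Y}(\cdot|\cdot):\mathfrak B(E)\times\mathbb R^n\to[0,1]$ of the regular conditional probability of $X$ given $Y$ there exists a Borel set $N\subset\mathbb R^n$ with $\mathrm P_Y(N)=0$ such that $$\mathrm P_{X|Y}(\cdot|y)=\mathcal N\bigl(\mu_{X|Y}(y),C_{X|Y}\bigr)$$ for all $y\in\mathbb R^n\setminus N$. In addition, the random variable $Z:\Omega\to E$ defined by $$Z:=\mu_{X|Y}\circ Y=\mathbb E X+\operatorname{cov}(X,Y)(\operatorname{cov}Y)^\dagger(Y-\mathbb E Y)$$ is both a version of $\mathbb E(X|Y)$ and a Gaussian random variable with $\mathbb E Z=\mathbb E X$, $\operatorname{cov}(Z)=\operatorname{cov}(X)-C_{X|Y}$, and $\mathcal G(Z)\subset\mathcal G(Y)$.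
   Context: All Banach spaces are real; $E'$ is the dual of $E$ and $\langle x',x\rangle_{E',E}:=x'(x)$. $\mathfrak B(E)$ is the Borel $\sigma$-algebra of $E$. A random variable with values in a separable Banach space is a Borel measurable map. Real Gaussian random variables may be degenerate (variance $0$ allowed). A random variable $X:\Omega\to E$ is Gaussian if $\langle x',X\rangle_{E',E}$ is a real Gaussian random variable for all $x'\in E'$; a probability measure on $\mathfrak B(E)$ is Gaussian if its image under every $x'\in E'$ is a real Gaussian measure. $X:\Omega\to E$ and $Y:\Omega\to F$ are jointly Gaussian if $(X,Y):\Omega\to E\times F$ is Gaussian. Gaussian random variables have finite moments of all orders, and $\mathbb E X$ denotes the Bochner integral. For square Bochner integrable $X:\Omega\to E$, $Y:\Omega\to F$, the cross covariance is the bounded linear operator $\operatorname{cov}(X,Y):F'\to E$, $\operatorname{cov}(X,Y)(y')=\int_\Omega\langle y',Y-\mathbb E Y\rangle_{F',F}\,(X-\mathbb E X)\,d\mathrm P$, and $\operatorname{cov}(X):=\operatorname{cov}(X,X):E'\to E$. A Gaussian measure $\mathrm Q$ on $\mathfrak B(E)$ has mean $\mu=\int_E x\,d\mathrm Q(x)$ and covariance $K:E'\to E$, $Kx'=\int_E\langle x',x-\mu\rangle_{E',E}(x-\mu)\,d\mathrm Q(x)$; it is uniquely determined by $(\mu,K)$ and is denoted $\mathcal N(\mu,K)$. $A^\dagger$ denotes the Moore–Penrose pseudo-inverse; $(\operatorname{cov}Y)^\dagger:\mathbb R^n\to(\mathbb R^n)'$ is that of $\operatorname{cov}(Y):(\mathbb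 R^n)'\to\mathbb R^n$ (with the canonical Euclidean structures). A version of the regular conditional probability of $X:\Omega\to E$ given $Y:\Omega\to F$ is a map $\mathrm P_{X|Y}(\cdot|\cdot):\mathfrak B(E)\times F\to[0,1]$ such that $\mathrm P_{X|Y}(\cdot|y)$ is a probability measure for all $y\in F$, $\mathrm P_{X|Y}(B|\cdot)$ is measurable for all $B\in\mathfrak B(E)$, and $\mathrm P(X\in B,Y\in A)=\int_A\mathrm P_{X|Y}(B|y)\,d\mathrm P_Y(y)$ for all $B\in\mathfrak B(E)$, $A\in\mathfrak B(F)$, where $\mathrm P_Y$ is the distribution of $Y$. $\mathbb E(X|Y)$ is the Banach space valued conditional expectation given $\sigma(Y)$: a $\sigma(Y)$-measurable Bochner integrable $Z$ with $\int_C Z\,d\mathrm P=\int_C X\,d\mathrm P$ for all $C\in\sigma(Y)$. For a Gaussian random variable $X$, $\mathcal G(X)$ is the closure in $L_2(\mathrm P)$ of $\{\langle x',X-\mathbb E X\rangle_{E',E}:x'\in E'\}$. *)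

(* Defs.v *)
From HB Require Import structures.
From mathcomp Require Import all_boot all_order all_algebra.
From mathcomp Require Import all_classical all_reals all_analysis.

Set Implicit Arguments.
Unset Strict Implicit.
Unset Printing Implicit Defensive.

Import Order.TTheory GRing.Theory Num.Theory.
Import numFieldNormedType.Exports.

Local Open Scope classical_set_scope.
Local Open Scope ring_scope.

Definition separable_space (T : topologicalType) : Prop :=
  exists2 D : set T, countable D & dense D.

(* [borel E] is convertible to [E]; it only carries the Borel sigma-algebra. *)
Notation borel E := (g_sigma_algebraType (@open E)).

Definition borel_fun d (T : measurableType d) (R : realType)
    (E : normedModType R) (D : set T) (f : T -> E) : Prop :=
  measurable_fun D (f : T -> borel E).

Section dual.
Context (R : realType) (E : normedModType R).

Record dual := Dual {
  dual_fun :> {linear E -> R^o} ;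
  dual_continuous : continuous dual_fun }.

HB.instance Definition _ := gen_eqMixin dual.
HB.instance Definition _ := gen_choiceMixin dual.

Definition dual0 : dual := @Dual \0 (@cst_continuous E R^o 0).

Lemma dual_ext (f g : dual) : f =1 g -> f = g.
Proof.
case: f g => -[f [[hf1] [hf2]]] cf [[g [[hg1] [hg2]]] cg] /= /funext fg.
subst g; rewrite (Prop_irrelevance hg1 hf1) (Prop_irrelevance hg2 hf2) in cg *.
by congr Dual; exact: Prop_irrelevance.
Qed.

End dual.

(* In the absence of a Bochner integral in the library: limits of integrals of
   simple functions [s k] such that [\int[mu]_D `|f - s k|] tends to 0. *)
Section bochner.
Context d (T : measurableType d) (R : realType) (E : normedModType R).
Variables (mu : {measure set T -> \bar R}) (D : set T).

Definition bochner_simple (s : T -> E) : Prop :=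
  [/\ borel_fun setT s, finite_set (range s) &
      forall x, x != 0 -> (mu (D `&` s @^-1` [set x]) < +oo)%E].

Definition bochner_simple_integral (s : T -> E) : E :=
  \sum_(x \in range s) fine (mu (D `&` s @^-1` [set x])) *: x.

Definition bochner_approx (f : T -> E) (s : nat -> T -> E) : Prop :=
  (forall k, bochner_simple (s k)) /\
  (\int[mu]_(t in D) (`|f t - s k t|)%:E)%E @[k --> \oo] --> 0%E.

(* Borel measurability is the right notion of measurability here because it
   is only used for separable [E], where it agrees with strong measurability. *)
Definition bochner_integrable (f : T -> E) : Prop :=
  borel_fun D f /\ exists s, bochner_approx f s.

Definition has_bochner_integral (f : T -> E) (v : E) : Prop :=
  borel_fun D f /\
  exists2 s, bochner_approx f s & bochner_simple_integral (s k) @[k --> \oo] --> v.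

Definition bochner_integral (f : T -> E) : E :=
  xget 0 [set v | has_bochner_integral f v].

End bochner.

Definition expect d (T : measurableType d) (R : realType)
    (P : {measure set T -> \bar R}) (E : normedModType R) (X : T -> E) : E :=
  bochner_integral P setT X.

Definition cross_cov d (T : measurableType d) (R : realType)
    (P : {measure set T -> \bar R}) (E F : normedModType R)
    (X : T -> E) (Y : T -> F) (y' : dual F) : E :=
  bochner_integral P setT
    (fun t => (y' (Y t - expect P Y) : R) *: (X t - expect P X)).

Section gaussian.
Context (R : realType).

(* The library's [normal_prob m 0] is not a point mass but the uniform
   distribution on [0, 1], hence the separate treatment of variance 0. *)
Definition real_gaussian_measure (mu : set R -> \bar R) : Prop :=
  exists m s : R, forall A, measurable A ->
    mu A = if s == 0 then \d_m A else normal_prob m s A.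

Definition gaussian_rv d (T : measurableType d) (P : {measure set T -> \bar R})
    (E : normedModType R) (X : T -> E) : Prop :=
  borel_fun setT X /\
  forall x' : dual E, real_gaussian_measure (pushforward P (x' \o X)).

Definition jointly_gaussian d (T : measurableType d)
    (P : {measure set T -> \bar R}) (E F : normedModType R)
    (X : T -> E) (Y : T -> F) : Prop :=
  gaussian_rv P (fun t => (X t, Y t) : (E * F)%type).

Definition gaussian_measure (E : normedModType R)
    (Q : {measure set (borel E) -> \bar R}) : Prop :=
  forall x' : dual E, real_gaussian_measure (pushforward Q x').

Definition is_normal (E : normedModType R)
    (Q : {measure set (borel E) -> \bar R}) (m : E) (K : dual E -> E) : Prop :=
  [/\ gaussian_measure Q,
      expect Q (fun x : borel E => x : E) = m &
      forall x' : dual E,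
        cross_cov Q (fun x : borel E => x : E) (fun x : borel E => x : E) x'
        = K x'].

(* Members of [L_2(P)] are represented by square integrable functions; the set
   is closed under almost everywhere equality. *)
Definition gaussian_space d (T : measurableType d) (P : {measure set T -> \bar R})
    (E : normedModType R) (X : T -> E) : set (T -> R) :=
  [set h | h \in Lfun P 2%:E /\
     forall e : R, 0 < e -> exists x' : dual E,
       ('N[P]_2%:E[EFin \o (fun t => (h t - x' (X t - expect P X))%R)] < e%:E)%E].

End gaussian.

Section pinv.
Context (R : realType) (n : nat).
Notation Rn := 'rV[R]_n.

Definition euclid_dot (u v : Rn) : R := \sum_i u 0 i * v 0 i.

Definition dual_dot (f g : dual Rn) : R :=
  \sum_i f (delta_mx 0 i) * g (delta_mx 0 i).

(* Penrose's four equations. Linearity of [B] follows from them when [A] is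
   linear, as maps that are self-adjoint for an inner product are linear. *)
Definition is_pinv (A : dual Rn -> Rn) (B : Rn -> dual Rn) : Prop :=
  [/\ forall f, A (B (A f)) = A f,
      forall v, B (A (B v)) = B v,
      forall u v, euclid_dot (A (B u)) v = euclid_dot u (A (B v)) &
      forall f g, dual_dot (B (A f)) g = dual_dot f (B (A g))].

Definition pinv (A : dual Rn -> Rn) : Rn -> dual Rn :=
  xget (fun=> dual0 Rn) [set B | is_pinv A B].

End pinv.

Section conditioning.
Context d (T : measurableType d) (R : realType) (P : probability T R).

Definition is_regular_cond_prob (E F : normedModType R)
    (X : {RV P >-> borel E}) (Y : {RV P >-> borel F})
    (k : R.-pker (borel F) ~> (borel E)) : Prop :=
  forall (B : set (borel E)) (A : set (borel F)),
    measurable B -> measurable A ->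
    P (X @^-1` B `&` Y @^-1` A) = (\int[distribution P Y]_(y in A) k y B)%E.

Definition is_cond_expect (E F : normedModType R)
    (X : T -> E) (Y : T -> F) (Z : T -> E) : Prop :=
  [/\ forall B : set (borel E), measurable B ->
        g_sigma_algebra_preimage (Y : T -> borel F) (Z @^-1` B),
      bochner_integrable P setT Z &
      forall C, g_sigma_algebra_preimage (Y : T -> borel F) C ->
        bochner_integral P C Z = bochner_integral P C X].

Definition cond_mean (E : normedModType R) n
    (X : T -> E) (Y : T -> 'rV[R]_n) (y : 'rV[R]_n) : E :=
  expect P X + cross_cov P X Y (pinv (cross_cov P Y Y) (y - expect P Y)).

Definition cond_cov (E : normedModType R) n
    (X : T -> E) (Y : T -> 'rV[R]_n) (x' : dual E) : E :=
  cross_cov P X X x' - cross_cov P X Y (pinv (cross_cov P Y Y) (cross_cov P Y X x')).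

End conditioning.

(* Main.v *)
(* Put L := cov(X,Y) (cov Y)^+ and W := X - L(Y - EY). For every functional f,
   f(W) is uncorrelated with every g(Y): the residual cov(Y,X) f minus its
   image under (cov Y)(cov Y)^+ vanishes by Cauchy-Schwarz. Joint Gaussianity then
   makes W and Y independent, so that, given Y = y, X has the law of
   W + L(y - EY), which is Gaussian with the required mean and covariance; all
   remaining claims follow by testing X = W + L(Y - EY) with functionals, which
   separate points by the Hahn-Banach theorem.

   Measures that agree on the integrals of cos(f + c) for all functionals f and
   constants c are equal: the test functions stay in the class after
   multiplication by cosines and bounded pointwise limits, and limits of
   polynomials in 1 + sin((f - a)/k) are the indicators of the half-spaces f >= a.
   For real Gaussians the cosine integrals solve a first order linear
   differential equation, by integration by parts.

   The Bochner integrals exist because |X|^2 is integrable (Fernique): a centred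
   Gaussian law Q makes Q x Q invariant under the rotation with entries 3/5 and 4/5,
   hence the tail p(t) = Q(|x| > t) satisfies (1 - p(s)) p(t) <= p(t/2)^2
   for t >= 8 s and decays geometrically along dyadic scales.

   A version of the conditional law is determined up to a null set because the
   Borel sets of E have a countable generator stable under intersection. *)

Require Import Defs.
From HB Require Import structures.
From mathcomp Require Import all_boot all_order all_algebra.
From mathcomp Require Import all_classical all_reals all_analysis.
From mathcomp Require Import measurable_realfun ring lra.

Set Implicit Arguments.
Unset Strict Implicit.
Unset Printing Implicit Defensive.

Import Order.TTheory GRing.Theory Num.Theory.
Import numFieldNormedType.Exports.

Local Open Scope classical_set_scope.
Local Open Scope ring_scope.

(** * Continuous functionals and Borel sets *)

(** Functionals are the only bridge between E and the reals. Besides separating points, a functional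
    norming a given vector turns closed balls into countable intersections of half-spaces, so that
    weakly measurable maps into a separable space are Borel. It also makes the integrals of
    approximating simple functions a Cauchy sequence, so that the Bochner integral exists in a
    complete space. From then on that integral is handled through the real integrals of its
    functionals.

    Cosines with a free phase stand in for the complex characteristic function: the phases recover
    its real and imaginary parts, and every integral stays real.

    The covariance of Y may be singular, and its pseudo-inverse is known through Penrose's equations
    alone. Linearity of L is not part of them, so each composition of a functional with L has to be
    exhibited as a continuous functional on R^n.

    The mean of X cannot be subtracted before the tail estimate, as its existence in E rests on that
    estimate. The difference of two independent copies provides the centred law instead. *)

Section duals.
Context {R : realType} {E : normedModType R}.

Lemma dual_of_bound (f : E -> R) (C : R) :
  (forall a x y, f (a *: x + y) = a * f x + f y) ->
  (forall x, `|f x| <= C * `|x|) -> exists g : dual E, forall x, g x = f x.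
Proof.
move=> flin fC.
pose F : {linear E -> R^o} :=
  HB.pack (f : E -> R^o) (GRing.isLinear.Build R E R^o *:%R (f : E -> R^o) flin).
have cF : continuous F.
  apply: bounded_linear_continuous; apply/linear_boundedP.
  apply: filterS (nbhs_pinfty_ge (num_real C)) => M CM x.
  by rewrite (le_trans (fC x))// ler_wpM2r.
by exists (Dual cF).
Qed.

Lemma dual_bound (f : dual E) : exists2 C, 0 <= C & forall x, `|f x| <= C * `|x|.
Proof.
have /linear_boundedP : bounded_near (dual_fun f) (nbhs (0 : E)).
  by apply: continuous_linear_bounded; exact: (@dual_continuous _ _ f).
move=> fb.
have [M [M0 fM]] := filter_ex (filterI (nbhs_pinfty_ge (num_real 0)) fb).
by exists M.
Qed.

Lemma dualD (f : dual E) x y : f (x + y) = f x + f y :> R. Proof. exact: raddfD. Qed.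
Lemma dualB (f : dual E) x y : f (x - y) = f x - f y :> R. Proof. exact: raddfB. Qed.
Lemma dualZ (f : dual E) a x : f (a *: x) = a * f x :> R.
Proof. by rewrite linearZ. Qed.

(** Linear relations dominated by the norm; domination forces them to be graphs of functions
    ([graph_fun]). The condition at [x0] is asked of nonempty relations only, because Zorn's lemma
    also requires the union of the empty chain to qualify. *)
Let bounded_graph (x0 : E) (G : set (E * R)) :=
  [/\ G !=set0 -> G (x0, `|x0|),
      forall a u v, G u -> G v -> G (a *: u.1 + v.1, a * u.2 + v.2) &
      forall u, G u -> u.2 <= `|u.1|].

Let graph0 x0 (G : set (E * R)) : bounded_graph x0 G -> G !=set0 -> G (0, 0).
Proof.
case=> GN Gl Gn /GN G1; have := Gl (-1) _ _ G1 G1.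
by rewrite /= scaleN1r addNr mulN1r addNr.
Qed.

Let graph_fun x0 (G : set (E * R)) : bounded_graph x0 G ->
  forall y r s, G (y, r) -> G (y, s) -> r = s.
Proof.
case=> _ Gl Gn y r s Gr Gs; apply/le_anti/andP; split; rewrite -subr_ge0.
  have := Gn _ (Gl (-1) _ _ Gs Gr); rewrite /= scaleN1r addNr normr0; lra.
have := Gn _ (Gl (-1) _ _ Gr Gs); rewrite /= scaleN1r addNr normr0; lra.
Qed.

(** The value at [z] has to lie above every v.2 - |v.1 - z| and below every |w.1 + z| - w.2. The
    triangle inequality orders the two families ([key]), and the supremum of the lower one is taken.
    Dividing by |t| reduces a multiple t z to z or -z. *)
Let graph_extend x0 (G : set (E * R)) z : bounded_graph x0 G -> G !=set0 ->
  exists a : R, bounded_graph x0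
    [set u | exists2 v, G v & exists t, u = (v.1 + t *: z, v.2 + t * a)].
Proof.
move=> bG G0; have G00 := graph0 bG G0; case: (bG) => GN Gl Gn.
have key v w : G v -> G w -> v.2 - `|v.1 - z| <= `|w.1 + z| - w.2.
  move=> Gv Gw; have := Gn _ (Gl 1 _ _ Gv Gw).
  rewrite /= scale1r mul1r => vw; have := ler_normD (v.1 - z) (w.1 + z).
  rewrite addrCA subrK (addrC w.1) => tr; lra.
pose S := [set v.2 - `|v.1 - z| | v in G].
have S0 : S !=set0 by exists (0 - `|0 - z|); exists (0, 0).
have Sub w : G w -> ubound S (`|w.1 + z| - w.2).
  by move=> Gw _ [v Gv <-]; exact: key.
exists (sup S).
have le1 v : G v -> v.2 - `|v.1 - z| <= sup S.
  move=> Gv; apply: ub_le_sup; last by exists v.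
  by exists (`|0 + z| - 0); exact: (Sub (0, 0)).
have le2 w : G w -> sup S <= `|w.1 + z| - w.2.
  by move=> Gw; apply: ge_sup => //; exact: Sub.
split.
- move=> _; exists (x0, `|x0|); first exact: GN.
  by exists 0; rewrite /= scale0r mul0r !addr0.
- move=> c _ _ [u Gu [s ->]] [v Gv [t ->]] /=.
  exists (c *: u.1 + v.1, c * u.2 + v.2); first exact: Gl.
  exists (c * s + t) => /=; congr pair; last by ring.
  by rewrite scalerDr scalerA scalerDl addrACA.
- move=> _ [v Gv [t ->]] /=.
  have [t0|t0|->] := ltgtP t 0.
  + have t1 : 0 < (- t) by lra.
    have Gv' := Gl (- t)^-1 _ _ Gv G00.
    have := le1 _ Gv'; rewrite /= !addr0 => h.
    rewrite -(ler_pM2l (_ : 0 < (- t)^-1)) ?invr_gt0//.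
    rewrite -{2}(@gtr0_norm _ (- t)^-1) ?invr_gt0// -normrZ scalerDr scalerA.
    have -> : (- t)^-1 * t = -1 by field; lra.
    rewrite scaleN1r mulrDr mulrA.
    have -> : (- t)^-1 * t = -1 by field; lra.
    lra.
  + have Gv' := Gl t^-1 _ _ Gv G00.
    have := le2 _ Gv'; rewrite /= !addr0 => h.
    rewrite -(ler_pM2l (_ : 0 < t^-1)) ?invr_gt0//.
    rewrite -{2}(@gtr0_norm _ t^-1) ?invr_gt0// -normrZ scalerDr scalerA.
    have tt : t^-1 * t = 1 by field; lra.
    rewrite tt scale1r mulrDr mulrA tt; lra.
  + by rewrite scale0r mul0r !addr0; exact: Gn.
Qed.

Lemma hahn_banach_norming (x0 : E) :
  exists f : dual E, f x0 = `|x0| :> R /\ forall y, `|f y| <= `|y|.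
Proof.
have [] := @Zorn_bigcup _ (bounded_graph x0).
  move=> F FP totF; split.
  - by case=> u [G FG Gu]; exists G => //; case: (FP _ FG) => + _ _; apply; exists u.
  - move=> a u v [G FG Gu] [H FH Hv].
    have [GH|HG] := totF _ _ FG FH.
      by exists H => //; case: (FP _ FH) => _ + _; apply => //; exact: GH.
    by exists G => //; case: (FP _ FG) => _ + _; apply => //; exact: HG.
  - by move=> u [G FG Gu]; case: (FP _ FG) => _ _; exact.
move=> G [bG maxG].
have G0 : G !=set0.
  apply: contrapT => /set0P/negP/negPn/eqP G0.
  (* The empty relation satisfies [bounded_graph], so maximality has to exclude it: the line through
     [x0] is properly larger. *)
  apply: (maxG [set u | exists t, u = (t *: x0, t * `|x0|)]).
    rewrite G0; split; first exact: sub0set.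
    by move=> /(_ (0, 0)); apply; exists 0; rewrite scale0r mul0r.
  split.
  - by move=> _; exists 1; rewrite scale1r mul1r.
  - move=> a _ _ [s ->] [t ->]; exists (a * s + t) => /=.
    by rewrite scalerDl scalerA mulrDl mulrA.
  - by move=> _ [t ->] /=; rewrite normrZ ler_wpM2r// ler_norm.
have G00 := graph0 bG G0.
have tot z : exists r, G (z, r).
  apply: contrapT => nz; have [a ba] := graph_extend z bG G0.
  apply: (maxG _ _ ba); split.
    move=> u Gu; exists u => //; exists 0.
    by rewrite scale0r mul0r !addr0; case: u {Gu}.
  move=> /(_ (z, a)) H; apply: nz; exists a; apply: H.
  by exists (0, 0) => //; exists 1; rewrite /= scale1r mul1r !add0r.
have [f Gf] := choice tot.
case: (bG) => GN Gl Gn.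
have fl a x y : f (a *: x + y) = a * f x + f y.
  by apply: (graph_fun bG (Gf _)); exact: (Gl _ _ _ (Gf x) (Gf y)).
have fN y : `|f y| <= 1 * `|y|.
  rewrite mul1r ler_norml (Gn _ (Gf y)) andbT.
  have := Gn _ (Gf (- y)); rewrite /= normrN.
  have -> : f (- y) = - f y; last by lra.
  have := fl (-1) y 0; rewrite scaleN1r addr0 => ->.
  by rewrite (graph_fun bG (Gf 0) G00) addr0 mulN1r.
have [g gf] := dual_of_bound fl fN; exists g; split.
  by rewrite gf; apply: (graph_fun bG (Gf x0)); exact: GN.
by move=> y; rewrite gf -[leRHS]mul1r.
Qed.

Lemma dual_separates (x y : E) : (forall f : dual E, f x = f y :> R) -> x = y.
Proof.
move=> xy; have [f [fxy _]] := hahn_banach_norming (x - y).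
by apply/eqP; rewrite -subr_eq0 -normr_eq0 -fxy dualB xy subrr.
Qed.

End duals.

Section borel_dual.
Context {R : realType}.

Lemma dense_sequence (T : topologicalType) (x0 : T) : separable_space T ->
  exists s : nat -> T, forall U, open U -> U !=set0 -> exists k, U (s k).
Proof.
move=> [D cD dD]; have /pfcard_geP[D0|[s]] := cD.
  have [] : setT `&` D !=set0 by apply: dD; [exists x0|exact: openT].
  by move=> x [_]; rewrite D0.
exists s => U oU U0; have [x [Ux Dx]] := dD _ U0 oU.
by have [k _ skx] := 'surj_s Dx; exists k; rewrite skx.
Qed.

(** The functionals norming a dense sequence already compute the norm as a supremum, so a closed
    ball is a countable intersection of half-spaces. *)
Lemma measurable_closed_ball_preimage d (T : measurableType d)
    (E : normedModType R) (g : T -> E) (c : E) (r : R) : separable_space E ->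
  (forall f : dual E, measurable_fun setT (fun t => f (g t) : R)) ->
  measurable [set t | `|g t - c| <= r].
Proof.
move=> sE mg; have [s ds] := dense_sequence (0 : E) sE.
have [F HF] := choice (fun k => hahn_banach_norming (s k)).
have -> : [set t | `|g t - c| <= r] =
    \bigcap_(k in setT) [set t | (F k (g t) : R) <= r + F k c].
  apply/seteqP; split => t /=.
    move=> gr k _ /=; rewrite -lerBlDr -dualB (le_trans _ gr)//.
    by rewrite (le_trans (ler_norm _))//; case: (HF k).
  move=> H; rewrite leNgt; apply/negP => gr.
  (* Replacing the vector by [s k] costs less than [e] twice, once in the norm and once in the
     functional; hence half of the gap. *)
  pose e := (`|g t - c| - r) / 2; have e0 : 0 < e by rewrite divr_gt0// subr_gt0.
  have [k] := ds _ (@ball_open _ E (g t - c) e) (ex_intro _ _ (ballxx _ e0)).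
  rewrite -ball_normE/= => sk; have [Fk1 Fk2] := HF k.
  have := H k I; rewrite /= -lerBlDr -dualB => Fr.
  have h1 : (F k (g t - c) : R) = F k (s k) + F k (g t - c - s k).
    by rewrite -dualD addrCA subrr addr0.
  have h2 := le_trans (ler_norm _) (Fk2 (- (g t - c - s k))).
  have h3 : (F k (- (g t - c - s k)) : R) = - F k (g t - c - s k) by rewrite raddfN.
  have h4 := lerB_dist (g t - c) (s k).
  rewrite h3 normrN in h2; rewrite h1 Fk1 in Fr.
  rewrite /e in sk; lra.
apply: bigcap_measurable => [|k _]; first by exists 0%N.
rewrite -[X in measurable X]setTI.
exact: measurable_fun_le.
Qed.

(** Pettis' theorem in the separable case: an open set is a countable union of closed balls around
    the points of a dense sequence. *)
Lemma measurable_fun_dual d (T : measurableType d) (E : normedModType R)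
    (g : T -> E) : separable_space E ->
  (forall f : dual E, measurable_fun setT (fun t => f (g t) : R)) ->
  measurable_fun setT (g : T -> borel E).
Proof.
move=> sE mg; apply: (@measurability _ _ T (borel E) setT g (@open E)) => //.
move=> _ [U oU <-]; rewrite setTI.
have [s ds] := dense_sequence (0 : E) sE.
have -> : g @^-1` U = \bigcup_k \bigcup_(n in [set n |
    [set x | `|x - s k| <= n.+1%:R^-1] `<=` U]) [set t | `|g t - s k| <= n.+1%:R^-1].
  apply/seteqP; split => t /=; last by move=> [k _ [n /= +]]; apply.
  move=> Ut; have /nbhs_ballP[e /= e0 eU] := open_nbhs_nbhs (conj oU Ut).
  have e2 : 0 < e / 2 by rewrite divr_gt0.
  have [n _ /(_ n (leqnn n)) nE] := near_infty_natSinv_lt (PosNum e2).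
  have n0 : (0 : R) < n.+1%:R^-1 by rewrite invr_gt0.
  have [k] := ds _ (@ball_open _ E (g t) n.+1%:R^-1) (ex_intro _ _ (ballxx _ n0)).
  rewrite -ball_normE/= => sk; exists k => //; exists n => /=; last exact: ltW.
  move=> x /= xs; apply: eU; rewrite -ball_normE /=.
  rewrite /= in nE; have := ler_normD (g t - s k) (s k - x).
  rewrite addrA subrK (distrC (s k)) => h.
  by move: (n.+1%:R^-1) sk xs nE => r sk xs nE; lra.
apply: bigcupT_measurable => k; apply: bigcup_measurable => n _.
exact: measurable_closed_ball_preimage.
Qed.

Lemma continuous_borel_real (E : normedModType R) (g : E -> R) :
  continuous g -> measurable_fun setT (g : borel E -> R).
Proof.
move=> cg; apply: (@measurability _ _ (borel E) R setT g _ (RGenOInfty.measurableE R)) => //.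
move=> _ [_ [x ->] <-]; rewrite setTI; apply: sub_sigma_algebra.
by move/continuousP : cg; apply; exact: interval_open.
Qed.

Lemma measurable_dual (E : normedModType R) (f : dual E) :
  measurable_fun setT (f : borel E -> R).
Proof. by apply: continuous_borel_real; exact: (@dual_continuous _ _ f). Qed.

Lemma measurable_norm (E : normedModType R) :
  measurable_fun setT (fun x : borel E => `|x : E|).
Proof. by apply: continuous_borel_real; exact: norm_continuous. Qed.

End borel_dual.

(** * Measures determined by cosine integrals *)

Section integrable_arithmetic.
Context d (T : measurableType d) (R : realType) (m : {measure set T -> \bar R}).
Variables (D : set T) (mD : measurable D).

Lemma integrable_add (f g : T -> R) : m.-integrable D (EFin \o f) ->
  m.-integrable D (EFin \o g) -> m.-integrable D (EFin \o (fun x => f x + g x)).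
Proof. by move=> mf mg; exact: (integrableD mD mf mg). Qed.

Lemma integrable_sub (f g : T -> R) : m.-integrable D (EFin \o f) ->
  m.-integrable D (EFin \o g) -> m.-integrable D (EFin \o (fun x => f x - g x)).
Proof. by move=> mf mg; exact: (integrableB mD mf mg). Qed.

Lemma integrable_scale (a : R) (f : T -> R) : m.-integrable D (EFin \o f) ->
  m.-integrable D (EFin \o (fun x => a * f x)).
Proof. by move=> mf; exact: (integrableZl mD a mf). Qed.

End integrable_arithmetic.

Section bounded_integrals.
Context d (T : measurableType d) (R : realType) (m : {measure set T -> \bar R}).
Hypothesis mfin : (m setT < +oo)%E.

Lemma integrable_bounded (f : T -> R) (K : R) : measurable_fun setT f ->
  (forall x, `|f x| <= K) -> m.-integrable setT (EFin \o f).
Proof.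
move=> mf fK; apply: measurable_bounded_integrable => //.
exists K; split; first exact: num_real.
by move=> y Ky x _ /=; apply: (le_trans (fK x)); exact: ltW.
Qed.

Lemma dominated_cvg_Rintegral (f_ : nat -> T -> R) (f g : T -> R) :
  (forall n, measurable_fun setT (f_ n)) ->
  m.-integrable setT (EFin \o g) ->
  (forall n x, `|f_ n x| <= g x) ->
  (forall x, f_ n x @[n --> \oo] --> f x) ->
  \int[m]_x f_ n x @[n --> \oo] --> \int[m]_x f x.
Proof.
move=> mf_ ig fK cf.
have mf : measurable_fun setT f.
  by apply: (@measurable_fun_cvg _ _ _ _ f_) => // x _; exact: cf.
have mf_' n : measurable_fun setT (EFin \o f_ n) by exact/measurable_EFinP.
have cf' : {ae m, forall x, setT x -> (EFin \o f_ n) x @[n --> \oo] --> (f x)%:E}.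
  by apply: aeW => x _; apply: cvg_EFin; [exact: nearW|exact: cf].
have fK' : {ae m, forall x n, setT x -> (`|(EFin \o f_ n) x| <= (EFin \o g) x)%E}.
  by apply: aeW => x n _; rewrite lee_fin.
have [_ _ c] := dominated_convergence measurableT mf_'
  (proj2 (measurable_EFinP _ _) mf) cf' ig fK'.
apply: fine_cvg; move: c; rewrite -(@fineK _ (\int[m]_x (f x)%:E)%E)//.
apply: integrable_fin_num => //; apply: le_integrable ig => //.
  exact/measurable_EFinP.
move=> x _; rewrite lee_fin /=.
have cn : `|f_ n x| @[n --> \oo] --> `|f x| by apply: cvg_norm; exact: cf.
rewrite -(cvg_lim _ cn)//; apply: limr_le; first by apply/cvg_ex; exists `|f x|.
by apply: nearW => n; rewrite (le_trans (fK n x))// ler_norm.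
Qed.

End bounded_integrals.

Section trigonometric_uniqueness.
Context {R : realType}.

Let mulr_expr_cvg0 (r : R) : 0 <= r < 1 -> n%:R * r ^+ n @[n --> \oo] --> 0.
Proof.
(* Splitting r = q s with both factors below 1 gives n r^n = (n q^n) s^n. The first factor is
   bounded because n q^n is at most 1 + q + ... + q^(n-1). *)
move=> /andP[r0 r1]; pose s := (1 + r) / 2; pose q := r / s.
have s0 : 0 < s by rewrite /s; lra.
have s1 : s < 1 by rewrite /s; lra.
have q0 : 0 <= q by rewrite divr_ge0// ltW.
have q1 : q < 1 by rewrite ltr_pdivrMr// mul1r /s; lra.
have nq n : n%:R * q ^+ n * (1 - q) <= 1 - q ^+ n.
  elim: n => [|n IH]; first by rewrite mul0r mul0r expr0 subrr.
  have q2 : 0 <= q ^+ n.+1 <= 1 by rewrite exprn_ge0//= exprn_ile1// ltW.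
  rewrite -natr1 exprS in q2 *.
  move: (q ^+ n) (n%:R : R) IH q2 => a b IH /andP[qa0 qa1].
  have : q * (b * a * (1 - q)) <= q * (1 - a) by rewrite ler_wpM2l.
  have : 0 <= (1 - q * a) * (1 - q) by rewrite mulr_ge0//; lra.
  nra.
have b n : `|n%:R * r ^+ n| <= (1 - q)^-1 * s ^+ n.
  rewrite ger0_norm ?mulr_ge0// ?exprn_ge0//.
  have -> : r = q * s by rewrite /q divfK// gt_eqF.
  have iq : n%:R * q ^+ n <= (1 - q)^-1.
    rewrite -(ler_pM2r (_ : 0 < 1 - q)) ?subr_gt0// mulVf ?subr_eq0 ?gt_eqF//.
    by rewrite (le_trans (nq n))// gerBl exprn_ge0.
  by rewrite exprMn mulrA ler_wpM2r// exprn_ge0// ltW.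
apply/norm_cvg0P.
apply: (@squeeze_cvgr _ _ _ _ (fun=> 0) (fun n => (1 - q)^-1 * s ^+ n)).
- by apply: nearW => n; rewrite normr_ge0 /=; exact: b.
- exact: cvg_cst.
- by rewrite exprn_geometric -(mulr0 (1 - q)^-1); apply: cvgMr;
  apply: cvg_geometric; rewrite ger0_norm// ltW.
Qed.

(* A pointwise polynomial approximation of the indicator of [1/2, 1]; the
   factor [n] in the exponent settles the limit at the threshold. *)
Let step (w : R) (n : nat) : R := 1 - (1 - w ^+ n) ^+ (n * 2 ^ n).

Let step_itv (w : R) n : 0 <= w <= 1 -> 0 <= step w n <= 1.
Proof.
move=> /andP[w0 w1]; have wn : 0 <= 1 - w ^+ n <= 1.
  by rewrite subr_ge0 exprn_ile1//= gerBl exprn_ge0.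
case/andP: wn => wn0 wn1; have := exprn_ile1 (n * 2 ^ n) wn0 wn1.
have := exprn_ge0 (n * 2 ^ n) wn0; rewrite /step; lra.
Qed.

(** Below 1/2, Bernoulli's inequality bounds [step w n] by n (2w)^n. From 1/2 on, (1 - w^n)^(2^n) is
    at most exp(-(2w)^n), hence at most exp(-1), and the further exponent n sends the power to 0. *)
Let step_cvg (w : R) : 0 <= w <= 1 -> step w n @[n --> \oo] --> (((1/2 <= w)%R : nat)%:R : R).
Proof.
move=> /andP[w0 w1]; rewrite /step.
have wn n : 0 <= 1 - w ^+ n <= 1.
  by rewrite subr_ge0 exprn_ile1//= gerBl exprn_ge0.
have [w2|w2] := leP (1/2) w; last first.
  have bern (x : R) k : 0 <= x <= 1 -> 1 - k%:R * x <= (1 - x) ^+ k.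
    move=> /andP[x0 x1]; elim: k => [|k IH]; first by rewrite mul0r subr0 expr0.
    rewrite exprS -natr1; have x1' : 0 <= 1 - x by lra.
    have := ler_wpM2l x1' IH; have : 0 <= k%:R * x * x by rewrite !mulr_ge0.
    lra.
  apply: (@squeeze_cvgr _ _ _ _ (fun=> 0) (fun n => n%:R * (2 * w) ^+ n)).
  - apply: nearW => n; rewrite (andP (step_itv n (_ : 0 <= w <= 1))).1 ?w0//=.
    have := bern (w ^+ n) (n * 2 ^ n)%N; rewrite exprn_ge0// exprn_ile1//= => /(_ isT).
    rewrite natrM natrX exprMn -mulrA; lra.
  - exact: cvg_cst.
  - by apply: mulr_expr_cvg0; apply/andP; split; lra.
rewrite -[X in _ --> X]subr0; apply: cvgB; first exact: cvg_cst.
apply: (@squeeze_cvgr _ _ _ _ (fun=> 0) (fun n => (expR (-1)) ^+ n)).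
- apply: nearW => n; have /andP[a0 a1] := wn n; rewrite exprn_ge0//=.
  have h : (1 - w ^+ n) ^+ (2 ^ n)%N <= expR (-1).
    have := expR_ge1Dx (- w ^+ n) => h.
    have h2 : (1 - w ^+ n) ^+ (2 ^ n)%N <= expR (- w ^+ n) ^+ (2 ^ n)%N.
      by apply: lerXn2r; rewrite ?nnegrE ?expR_ge0.
    apply: (le_trans h2); rewrite -expRM_natl ler_expR natrX mulrN lerN2 -exprMn.
    by rewrite exprn_ege1//; lra.
  by rewrite mulnC exprM; apply: lerXn2r; rewrite ?nnegrE ?exprn_ge0 ?expR_ge0.
- exact: cvg_cst.
- rewrite exprn_geometric; apply: cvg_geometric.
  by rewrite ger0_norm ?expR_ge0// expR_lt1; lra.
Qed.

Context d (T : measurableType d) (m1 m2 : {measure set T -> \bar R}).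
Variable V : set (T -> R).
Hypothesis m1fin : (m1 setT < +oo)%E.
Hypothesis m2fin : (m2 setT < +oo)%E.
Hypothesis V0 : V (cst 0).
Hypothesis VM : forall u, V u -> measurable_fun setT u.
Hypothesis Vlin : forall a b u v, V u -> V v -> V (fun x => a * u x + b * v x).
Hypothesis Vcos : forall u c, V u ->
  \int[m1]_x cos (u x + c) = \int[m2]_x cos (u x + c).

Let mcos u c : V u -> measurable_fun setT (fun x => cos (u x + c)).
Proof.
move=> Vu; apply: (@measurableT_comp _ _ _ _ _ _ cos).
  by apply: continuous_measurable_fun; exact: continuous_cos.
by apply: measurable_funD => //; exact: VM.
Qed.

(** Agreement is demanded against every cosine and not just for the integral of [g]. This makes the
    class stable under multiplication by cosines: a product of two cosines is a half sum of cosines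
    whose arguments are again in [V] up to a phase. *)
Let good (g : T -> R) := [/\ measurable_fun setT g,
  exists K, forall x, `|g x| <= K &
  forall u c, V u ->
    \int[m1]_x (g x * cos (u x + c)) = \int[m2]_x (g x * cos (u x + c))].

Let good_int (m : {measure set T -> \bar R}) g u c : (m setT < +oo)%E -> good g -> V u ->
  m.-integrable setT (EFin \o (fun x => g x * cos (u x + c))).
Proof.
move=> mfin [mg [K gK] _] Vu; apply: (integrable_bounded mfin (K := K)).
  by apply: measurable_funM => //; exact: mcos.
by move=> x; rewrite normrM -[leRHS]mulr1 ler_pM// cos_max.
Qed.

Let good_lin a b g h : good g -> good h -> good (fun x => a * g x + b * h x).
Proof.
move=> Gg Gh; case: (Gg) (Gh) => mg [K gK] gi [mh [L hL] hi]; split.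
- by apply: measurable_funD; apply: measurable_funM.
- exists (`|a| * K + `|b| * L) => x; rewrite (le_trans (ler_normD _ _))//.
  by rewrite !normrM lerD// ler_wpM2l.
- move=> u c Vu.
  have E (m : {measure set T -> \bar R}) : (m setT < +oo)%E ->
     \int[m]_x ((a * g x + b * h x) * cos (u x + c)) =
     a * \int[m]_x (g x * cos (u x + c)) + b * \int[m]_x (h x * cos (u x + c)).
    move=> mfin; have i1 := good_int c mfin Gg Vu; have i2 := good_int c mfin Gh Vu.
    rewrite -RintegralZl// -RintegralZl// -RintegralD//; first last.
    + exact: (integrableZl _ b i2).
    + exact: (integrableZl _ a i1).
    by apply: eq_Rintegral => x _; ring.
  by rewrite !E// gi// hi.
Qed.

Let good_cos g u c : good g -> V u -> good (fun x => g x * cos (u x + c)).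
Proof.
move=> Gg Vu; case: (Gg) => mg [K gK] gi; split.
- by apply: measurable_funM => //; exact: mcos.
- by exists K => x; rewrite normrM -[leRHS]mulr1 ler_pM// cos_max.
- move=> v e Vv.
  have Vp := Vlin 1 1 Vu Vv; have Vm := Vlin 1 (-1) Vu Vv.
  have E (m : {measure set T -> \bar R}) : (m setT < +oo)%E ->
     \int[m]_x (g x * cos (u x + c) * cos (v x + e)) =
     2^-1 * \int[m]_x (g x * cos ((1 * u x + 1 * v x) + (c + e))) +
     2^-1 * \int[m]_x (g x * cos ((1 * u x + (-1) * v x) + (c - e))).
    move=> mfin; have i1 := good_int (c + e) mfin Gg Vp.
    have i2 := good_int (c - e) mfin Gg Vm.
    rewrite -RintegralZl// -RintegralZl// -RintegralD//; first last.
    + exact: (integrableZl _ _ i2).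
    + exact: (integrableZl _ _ i1).
    apply: eq_Rintegral => x _.
    have -> : 1 * u x + 1 * v x + (c + e) = (u x + c) + (v x + e) by ring.
    have -> : 1 * u x + -1 * v x + (c - e) = (u x + c) - (v x + e) by ring.
    by move: (u x + c) (v x + e) => y z; rewrite cosD cosB; field.
  by rewrite !E// gi// gi.
Qed.

Let good_lim (g_ : nat -> T -> R) g K : (forall n, good (g_ n)) ->
  (forall n x, `|g_ n x| <= K) -> (forall x, g_ n x @[n --> \oo] --> g x) -> good g.
Proof.
move=> Gg gK cg.
have mg n : measurable_fun setT (g_ n) by case: (Gg n).
split.
- by apply: (@measurable_fun_cvg _ _ _ _ g_) => // x _; exact: cg.
- exists K => x; have cn : `|g_ n x| @[n --> \oo] --> `|g x| by apply: cvg_norm; exact: cg.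
  rewrite -(cvg_lim _ cn)//; apply: limr_le; first by apply/cvg_ex; exists `|g x|.
  by apply: nearW => n; exact: gK.
- move=> u c Vu.
  have E (m : {measure set T -> \bar R}) : (m setT < +oo)%E ->
    \int[m]_x (g_ n x * cos (u x + c)) @[n --> \oo] --> \int[m]_x (g x * cos (u x + c)).
    move=> mfin; apply: (@dominated_cvg_Rintegral _ _ _ _ _ _ (cst K)).
    + by move=> n; apply: measurable_funM => //; exact: mcos.
    + by apply: (@integrable_bounded _ _ _ _ mfin _ `|K|) => //.
    + by move=> n x; rewrite normrM -[leRHS]mulr1 ler_pM// cos_max.
    + by move=> x; apply: cvgM; [exact: cg|exact: cvg_cst].
  have E12 : (fun n => \int[m1]_x (g_ n x * cos (u x + c))) =
             (fun n => \int[m2]_x (g_ n x * cos (u x + c))).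
    by apply/funext => n; case: (Gg n) => _ _ ->.
  rewrite -(cvg_lim (@Rhausdorff R) (E m1 m1fin)) E12.
  exact: (cvg_lim (@Rhausdorff R) (E m2 m2fin)).
Qed.

(** The two limits are taken one after the other. At fixed k, [step] selects the points where sin((u
    - a)/(k + 1)) is nonnegative, a periodic family of slabs; as k grows, only the half-space
    remains near any given point. *)
Let good_halfspace g u a : good g -> V u ->
  good (fun x => g x * ((a <= u x)%R : nat)%:R).
Proof.
move=> Gg Vu; case: (Gg) => mg [K gK] gi.
pose w k x := (1 + sin ((u x - a) / k.+1%:R)) / 2.
have w01 k x : 0 <= w k x <= 1.
  have := sin_geN1 ((u x - a) / k.+1%:R); have := sin_le1 ((u x - a) / k.+1%:R).
  by rewrite /w; lra.
have Gw k h : good h -> good (fun x => h x * w k x).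
  (* The phase - pi / 2 turns the cosine into the sine; the zero function only fills the second
     place of the linear combination. *)
  move=> Gh; have Vk := Vlin k.+1%:R^-1 0 Vu V0.
  have := good_lin 2^-1 2^-1 Gh (good_cos (- (a / k.+1%:R) - pi / 2) Gh Vk).
  congr good; apply/funext => x; rewrite /w -cosBpihalf /=.
  have -> : k.+1%:R^-1 * u x + 0 * 0 + (- (a / k.+1%:R) - pi / 2) =
    (u x - a) / k.+1%:R - pi / 2 by rewrite mul0r; move: (k.+1%:R^-1) => r; ring.
  by field.
have Gwn k n h : good h -> good (fun x => h x * (w k x) ^+ n).
  move=> Gh; elim: n => [|n IH].
    by congr good : Gh; apply/funext => x; rewrite expr0 mulr1.
  by have := Gw k _ IH; congr good; apply/funext => x; rewrite exprSr mulrA.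
have Gwm k n j h : good h -> good (fun x => h x * (1 - (w k x) ^+ n) ^+ j).
  move=> Gh; elim: j => [|j IH].
    by congr good : Gh; apply/funext => x; rewrite expr0 mulr1.
  have := good_lin 1 (-1) IH (Gwn k n _ IH); congr good; apply/funext => x.
  by rewrite exprSr; ring.
have Gs k n : good (fun x => g x * step (w k x) n).
  have := good_lin 1 (-1) Gg (Gwm k n (n * 2 ^ n)%N _ Gg); congr good; apply/funext => x.
  by rewrite /step; ring.
have Gk k : good (fun x => g x * ((1/2 <= w k x)%R : nat)%:R).
  apply: (good_lim (K := K) (Gs k)) => [n x|x].
    have /andP[s0 s1] := step_itv n (w01 k x).
    by rewrite normrM -[leRHS]mulr1 ler_pM// ger0_norm.
  by apply: cvgM; [exact: cvg_cst|exact: step_cvg].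
apply: (good_lim (K := K) Gk) => [n x|x].
  by rewrite normrM -[leRHS]mulr1 ler_pM// normr_nat lern1; case: (_ <= _).
apply: cvgM; first exact: cvg_cst.
(* Once |u x - a| < n + 1 < pi (n + 1), the sine has the sign of u x - a. *)
apply: cvg_near_cst; near=> n.
have n1 : `|u x - a| < n.+1%:R.
  rewrite -truncn_le_nat; near: n; exact: nbhs_infty_ge.
congr (_%:R); congr nat_of_bool.
have npi : - 1 < (u x - a) / n.+1%:R < 1.
  by rewrite ltr_pdivlMr// ltr_pdivrMr// mul1r mulN1r -ltr_norml.
have pi1 : (1 : R) < pi by have := @pi_ge2 R; lra.
rewrite /w; case/andP: npi => npi1 npi2; have [ua|ua] := leP a (u x).
  have z0 : 0 <= (u x - a) / n.+1%:R by rewrite divr_ge0 ?subr_ge0.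
  move: (_ / n.+1%:R) z0 npi1 npi2 => z z0 npi1 npi2.
  have s0 : 0 <= sin z by apply: sin_ge0_pi; apply/andP; split; lra.
  by apply/idP; lra.
have z0 : 0 < - ((u x - a) / n.+1%:R) by rewrite -mulNr divr_gt0// opprB subr_gt0.
move: (_ / n.+1%:R) z0 npi1 npi2 => z z0 npi1 npi2.
have : 0 < sin (- z) by apply: sin_gt0_pi; apply/andP; split; lra.
by rewrite sinN => s0; apply/negbTE; rewrite -ltNge; lra.
Unshelve. all: by end_near. Qed.

(** Finite intersections of half-spaces are indexed by lists: concatenation gives stability under
    intersection, and the empty list gives the whole space. Testing against the cosine of the zero
    function, which is 1, yields the measures themselves. *)
Lemma trigonometric_uniqueness A :
  <<s [set B | exists u a, V u /\ B = [set x | a <= u x]] >> A -> m1 A = m2 A.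
Proof.
have good1 : good (cst 1).
  split; first exact: measurable_cst.
    by exists 1 => x; rewrite normr1.
  move=> u c Vu; have mul1 (m : {measure set T -> \bar R}) :
      \int[m]_x (cst 1 x * cos (u x + c)) = \int[m]_x cos (u x + c).
    by apply: eq_Rintegral => x _; rewrite mul1r.
  by rewrite !mul1; exact: Vcos.
pose G := [set B : set T | measurable B /\ good (fun x => ((x \in B) : nat)%:R)].
have GT : G setT.
  by split => //; move: good1; congr good; apply/funext => x; rewrite in_setT.
have Ghalf B u a : G B -> V u -> G (B `&` [set x | a <= u x]).
  move=> [mB GB] Vu; split.
    apply: measurableI => //; rewrite -[X in measurable X]setTI.
    by apply: measurable_fun_le => //; exact: VM.
  have := good_halfspace a GB Vu; congr good; apply/funext => x.
  by rewrite in_setI -natrM mulnb; congr (_ && _)%:R; apply/idP/idP; rewrite inE.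
pose H := [set B | exists s : seq {uv : (T -> R) * R | V uv.1},
   B = \big[setI/setT]_(i <- s) [set x | (sval i).2 <= (sval i).1 x]].
have HG : H `<=` G.
  move=> _ [s ->]; elim: s => [|[[u a] /= Vu] s IH]; first by rewrite big_nil.
  by rewrite big_cons setIC; exact: Ghalf.
have GE B : G B -> m1 B = m2 B.
  move=> [mB [_ _ /(_ (cst 0) 0 V0)]].
  have mul1 (m : {measure set T -> \bar R}) :
      \int[m]_x (((x \in B) : nat)%:R * cos (cst 0 x + 0)) =
      \int[m]_x ((x \in B) : nat)%:R.
    by apply: eq_Rintegral => x _; rewrite addr0 cos0 mulr1.
  rewrite !mul1.
  have E (m : {measure set T -> \bar R}) : (m setT < +oo)%E ->
      (\int[m]_x ((x \in B) : nat)%:R)%:E = m B.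
    move=> mfin; rewrite /Rintegral fineK; last first.
      apply: integrable_fin_num => //; apply: (integrable_bounded mfin (K := 1)).
        exact: measurable_indic.
      by move=> x; rewrite normr_nat lern1; case: (_ \in _).
    by rewrite (integral_indic _ measurableT)// setIT.
  by move=> e; rewrite -(E m1)// -(E m2)// e.
have HS B : <<s [set B | exists u a, V u /\ B = [set x | a <= u x]] >> B -> <<s H >> B.
  apply: smallest_sub; first exact: smallest_sigma_algebra.
  move=> _ [u [a [Vu ->]]]; apply: sub_sigma_algebra.
  by exists [:: exist _ (u, a) Vu]; rewrite big_seq1.
move=> /HS; apply: (g_sigma_algebra_measure_unique H _ (fun=> setT)).
- by move=> B /HG[].
- by move=> _; exists [::]; rewrite big_nil.
- by rewrite bigcup_const.
- by move=> _ _ [s ->] [t ->]; exists (s ++ t); rewrite big_cat.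
- by move=> B /HG/GE.
- by move=> _; exact: m1fin.
Qed.

End trigonometric_uniqueness.

Section cosine_transforms.
Context {R : realType}.

Lemma dual_lin (E : normedModType R) (a b : R) (f g : dual E) :
  exists h : dual E, forall x, h x = a * f x + b * g x :> R.
Proof.
have [C C0 fC] := dual_bound f; have [D D0 gD] := dual_bound g.
apply: (@dual_of_bound _ _ _ (`|a| * C + `|b| * D)) => [c x y|x].
  by rewrite !dualD !dualZ; ring.
rewrite mulrDl (le_trans (ler_normD _ _))// !normrM -!mulrA.
by rewrite lerD// ler_wpM2l.
Qed.

Lemma measurable_fun_ge d (T : measurableType d) (u : T -> R) :
  (forall a, measurable [set x | a <= u x]) -> measurable_fun setT u.
Proof.
move=> mu; apply: (measurability _ (RGenCInfty.measurableE R)) => //.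
move=> _ [_ [x ->] <-]; rewrite setTI; congr measurable : (mu x).
by apply/seteqP; split => y /=; rewrite in_itv/= andbT.
Qed.

Lemma measure_eq_cos_real (m1 m2 : {measure set (measurableTypeR R) -> \bar R}) :
  (m1 setT < +oo)%E -> (m2 setT < +oo)%E ->
  (forall t c, \int[m1]_x cos (t * x + c) = \int[m2]_x cos (t * x + c)) ->
  forall A, measurable A -> m1 A = m2 A.
Proof.
move=> m1f m2f m12 A mA.
pose V := [set u : measurableTypeR R -> R | exists t, u = fun x => t * x].
apply: (trigonometric_uniqueness (V := V)) => //.
- by exists 0; apply/funext => x; rewrite mul0r.
- by move=> _ [t ->]; exact: measurable_funM.
- move=> a b _ _ [s ->] [t ->]; exists (a * s + b * t).
  by apply/funext => x; ring.
- by move=> _ c [t ->]; exact: m12.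
- have mE : @measurable _ (measurableTypeR R) = <<s @RGenCInfty.G R >> :=
    RGenCInfty.measurableE R.
  move: mA; rewrite mE.
  apply: smallest_sub; first exact: smallest_sigma_algebra.
  move=> _ [a ->]; apply: sub_sigma_algebra; exists (fun x => 1 * x), a; split.
    by exists 1.
  by apply/seteqP; split => y /=; rewrite in_itv/= andbT mul1r.
Qed.

(** The half-spaces of f p.1 + g p.2 generate enough sets: for their sigma-algebra both projections
    are weakly measurable, hence Borel by [measurable_fun_dual], so every measurable rectangle
    belongs to it. *)
Lemma measure_eq_cos_prod (E F : normedModType R)
    (m1 m2 : {measure set (borel E * borel F) -> \bar R}) :
  separable_space E -> separable_space F ->
  (m1 setT < +oo)%E -> (m2 setT < +oo)%E ->
  (forall (f : dual E) (g : dual F) c,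
     \int[m1]_p cos (f p.1 + g p.2 + c : R) = \int[m2]_p cos (f p.1 + g p.2 + c : R)) ->
  forall A, measurable A -> m1 A = m2 A.
Proof.
move=> sE sF m1f m2f m12 A mA.
pose V := [set u : borel E * borel F -> R |
  exists (f : dual E) (g : dual F), u = fun p => f p.1 + g p.2].
have mV u : V u -> measurable_fun setT u.
  move=> [f [g ->]]; apply: measurable_funD.
    exact: (measurableT_comp (measurable_dual f)).
  exact: (measurableT_comp (measurable_dual g)).
apply: (trigonometric_uniqueness (V := V)) => //.
- by exists (dual0 E), (dual0 F); apply/funext => p; rewrite /= addr0.
- move=> a b _ _ [f [g ->]] [h [k ->]].
  have [u ufh] := dual_lin a b f h; have [v vgk] := dual_lin a b g k.
  by exists u, v; apply/funext => p; rewrite ufh vgk; ring.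
- by move=> _ c [f [g ->]]; exact: m12.
- set G := [set B | _].
  have mG (u : E * F -> R) : V u ->
      measurable_fun setT (u : g_sigma_algebraType G -> R).
    move=> Vu; apply: measurable_fun_ge => a.
    by apply: sub_sigma_algebra; exists u, a.
  have m1' : measurable_fun setT (fst : g_sigma_algebraType G -> borel E).
    apply: measurable_fun_dual => // f; apply: mG.
    by exists f, (dual0 F); apply/funext => p; rewrite addr0.
  have m2' : measurable_fun setT (snd : g_sigma_algebraType G -> borel F).
    apply: measurable_fun_dual => // f; apply: mG.
    by exists (dual0 E), f; apply/funext => p; rewrite add0r.
  move: mA; rewrite measurable_prod_measurableType.
  apply: smallest_sub; first exact: smallest_sigma_algebra.
  move=> _ [B mB [C mC <-]].
  have -> : B `*` C = (setT `&` fst @^-1` B) `&` (setT `&` snd @^-1` C).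
    by apply/seteqP; split => p /=; tauto.
  apply: (@measurableI _ (g_sigma_algebraType G)).
    exact: m1'.
  exact: m2'.
Qed.

End cosine_transforms.

(** * Real Gaussian measures *)

Section density.
Context d (T : measurableType d) (R : realType).
Variables (mu nu : {measure set T -> \bar R}) (g : T -> R).
Hypothesis mg : measurable_fun setT g.
Hypothesis g0 : forall x, 0 <= g x.
Hypothesis nuE : forall A, measurable A -> nu A = (\int[mu]_(x in A) (g x)%:E)%E.

Import HBNNSimple.

(** Both sides are monotone limits along simple functions, for which the identity is [nuE] on level
    sets. *)
Lemma ge0_integral_density (f : T -> \bar R) : measurable_fun setT f ->
  (forall x, 0 <= f x)%E ->
  (\int[nu]_x f x = \int[mu]_x (f x * (g x)%:E))%E.
Proof.
move=> mf f0; pose h := nnsfun_approx measurableT mf.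
have hf x : (EFin \o h n) x @[n --> \oo] --> f x.
  by apply: cvg_nnsfun_approx => //.
have mgE : measurable_fun setT (EFin \o g) by exact/measurable_EFinP.
have -> : (\int[nu]_x f x = lim (\int[nu]_x (EFin \o h n) x @[n --> \oo]))%E.
  rewrite -monotone_convergence//.
  - by apply: eq_integral => x _; apply/esym/cvg_lim.
  - by move=> n; exact/measurable_EFinP.
  - by move=> n x _; rewrite lee_fin.
  - by move=> x _ a b ab; rewrite lee_fin; exact/lefP/nd_nnsfun_approx.
have -> : (\int[mu]_x (f x * (g x)%:E) =
    lim (\int[mu]_x ((EFin \o h n) x * (g x)%:E) @[n --> \oo]))%E.
  rewrite -monotone_convergence//.
  - apply: eq_integral => x _; apply/esym/cvg_lim => //.
    by apply: cvgeZr => //; exact: hf.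
  - by move=> n; apply: emeasurable_funM => //; exact/measurable_EFinP.
  - by move=> n x _; rewrite mule_ge0// lee_fin.
  - move=> x _ a b ab; rewrite lee_wpmul2r ?lee_fin//.
    exact/lefP/nd_nnsfun_approx.
suff suf n : (\int[mu]_x ((EFin \o h n) x * (g x)%:E) = \int[nu]_x (EFin \o h n) x)%E.
  by under [in RHS]eq_fun do rewrite suf.
transitivity (\int[nu]_x
   (\sum_(y \in range (h n)) (y * \1_(h n @^-1` [set y]) x)%:E))%E; last first.
  by apply: eq_integral => t tE; rewrite /= fimfunE -fsumEFin.
have indich r : measurable_fun setT (fun x => (r * \1_(h n @^-1` [set r]) x)%:E).
  by apply/measurable_EFinP; exact: measurable_funM.
rewrite ge0_integral_fsum//; last by move=> r x _; exact: nnfun_muleindic_ge0.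
transitivity (\int[mu]_x (\sum_(y \in range (h n))
    (y * \1_(h n @^-1` [set y]) x)%:E * (g x)%:E))%E.
  under [RHS]eq_integral => x xE.
    rewrite -ge0_mule_fsuml => [|y]; last exact: nnfun_muleindic_ge0.
    rewrite fsumEFin // -(fimfunE _ x); over.
  by [].
rewrite ge0_integral_fsum//; last 2 first.
  - by move=> y; apply: emeasurable_funM.
  - by move=> r x _; rewrite mule_ge0 ?lee_fin// -lee_fin nnfun_muleindic_ge0.
apply: eq_fsbigr => r rhn.
under [RHS]eq_integral do rewrite EFinM.
rewrite integralZl_indic_nnsfun => //.
have r0 : 0 <= r by move: rhn; rewrite inE => -[x _ <-].
under eq_integral do rewrite EFinM -muleA.
rewrite ge0_integralZl//.
- under eq_integral do rewrite muleC.
  rewrite (eq_integral ((EFin \o g) \_ (h n @^-1` [set r]))); last first.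
    by move=> x xE; rewrite epatch_indic.
  by rewrite -integral_mkcondr setTI -nuE// integral_indic// setIT.
- by apply: emeasurable_funM => //; exact/measurable_EFinP.
- by move=> x _; rewrite mule_ge0// lee_fin.
Qed.

Lemma integrable_density (f : T -> R) : measurable_fun setT f ->
  mu.-integrable setT (EFin \o (fun x => f x * g x)) ->
  nu.-integrable setT (EFin \o f) /\
  \int[nu]_x f x = \int[mu]_x (f x * g x).
Proof.
move=> mf ifg.
have mfE : measurable_fun setT (EFin \o f) by exact/measurable_EFinP.
have inu : nu.-integrable setT (EFin \o f).
  apply/integrableP; split => //.
  rewrite ge0_integral_density//; last exact: measurableT_comp.
  case/integrableP : ifg => _; congr (_ < _)%E; apply: eq_integral => x _.
  by rewrite /= -EFinM normrM (ger0_norm (g0 x)).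
split=> //; congr fine; rewrite integralE [RHS]integralE.
have mp := measurable_funepos mfE; have mn := measurable_funeneg mfE.
rewrite !ge0_integral_density//; congr (_ - _)%E; apply: eq_integral => x _.
  by rewrite !funeposE /= EFinM maxe_pMl ?mul0e// lee_fin.
by rewrite !funenegE /= -mulNr EFinM maxe_pMl ?mul0e// lee_fin.
Qed.

End density.

Section derivatives.
Context {R : realType}.
Implicit Types f g : R -> R.

(** The rules are stated for pointwise expressions, so that the derivative of a compound formula can
    be given as one nested term. *)
Lemma is_derive_add f g (x a b : R) : is_derive x (1 : R) f a -> is_derive x (1 : R) g b ->
  is_derive x (1 : R) (fun y => f y + g y) (a + b).
Proof. by move=> ? ?; exact: is_deriveD. Qed.

Lemma is_derive_mul f g (x a b : R) : is_derive x (1 : R) f a -> is_derive x (1 : R) g b ->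
  is_derive x (1 : R) (fun y => f y * g y) (f x * b + g x * a).
Proof. by move=> ? ?; exact: is_deriveM. Qed.

Lemma is_derive_scale f (k x a : R) : is_derive x (1 : R) f a ->
  is_derive x (1 : R) (fun y => k * f y) (k * a).
Proof. by move=> df; exact: (is_deriveZ k df). Qed.

Lemma is_derive_comp f g (x a b : R) : is_derive (g x) (1 : R) f a ->
  is_derive x (1 : R) g b -> is_derive x (1 : R) (fun y => f (g y)) (a * b).
Proof. by move=> ? ?; exact: is_derive1_comp. Qed.

Lemma is_derive_affine (a b x : R) : is_derive x (1 : R) (fun y => a * y + b) a.
Proof.
have := is_derive_add (is_derive_mul (is_derive_cst a x 1) (is_derive_id x 1))
  (is_derive_cst b x 1).
by rewrite /= mulr1 mulr0 !addr0.
Qed.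

Lemma is_derive_continuous f (f' : R -> R) :
  (forall x : R, is_derive x (1 : R) f (f' x)) -> continuous f.
Proof.
move=> df x; apply: differentiable_continuous; apply/derivable1_diffP.
by case: (df x).
Qed.

End derivatives.

Section normal_stein.
Context {R : realType} (m s : R) (s0 : s != 0).
Notation mu := (@lebesgue_measure R).
Let p := normal_pdf m s.

Let s2 : 0 < s ^+ 2. Proof. by rewrite exprn_even_gt0. Qed.

Let pE x : p x = normal_peak s * expR (- (x - m) ^+ 2 / (s ^+ 2 *+ 2)).
Proof. by rewrite /p normal_pdfE. Qed.

Let p_derive (x : R) : is_derive x (1 : R) p (- (x - m) / s ^+ 2 * p x).
Proof.
have -> : p = fun y => normal_peak s *
    expR ((- (s ^+ 2 *+ 2)^-1) * ((1 * y + - m) * (1 * y + - m))).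
  apply/funext => y; rewrite pE /=; congr (_ * expR _).
  by rewrite mul1r -expr2 mulNr mulrC mulNr.
have da := is_derive_affine 1 (- m) x.
apply: is_derive_eq (is_derive_scale _ (is_derive_comp (is_derive_expR _)
  (is_derive_scale _ (is_derive_mul da da)))) _.
by field.
Qed.

(** Doubling the standard deviation changes the exponent by z = 3 y^2 / (8 s^2), where y = x - m.
    Then (1 + |y|)^2 is at most 2 + 2 y^2 = 2 + (16 s^2 / 3) z, which exp(z) absorbs; the quotient
    of peaks renormalizes. Integrability under quadratic growth thus reduces to that of a wider
    normal density. *)
Let bound_const := (2 + 16 * s ^+ 2 / 3) * (normal_peak s / normal_peak (2 * s)).

Let p_bound x : (1 + `|x - m|) ^+ 2 * p x <= bound_const * normal_pdf m (2 * s) x.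
Proof.
have s20 : 2 * s != 0 by rewrite mulf_neq0.
have k1 : 0 < normal_peak (2 * s) by exact: normal_peak_gt0.
have k0 : 0 < normal_peak s by exact: normal_peak_gt0.
rewrite pE normal_pdfE// /bound_const /normal_fun.
set y := x - m; pose z := 3 * y ^+ 2 / (8 * s ^+ 2).
have -> : - y ^+ 2 / ((2 * s) ^+ 2 *+ 2) = - y ^+ 2 / (s ^+ 2 *+ 2) + z.
  by rewrite /z; field.
rewrite expRD.
have yz : y ^+ 2 = 8 * s ^+ 2 / 3 * z by rewrite /z; field.
have z0 : 0 <= z.
  by apply: divr_ge0; apply: mulr_ge0; rewrite ?sqr_ge0.
have h1 : (1 + `|y|) ^+ 2 <= (2 + 16 * s ^+ 2 / 3) * expR z.
  have h2 : (1 + `|y|) ^+ 2 <= 2 + 2 * y ^+ 2.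
    rewrite -(real_normK (num_real y)); have := sqr_ge0 (1 - `|y|); nra.
  apply: (le_trans h2); rewrite yz; have := expR_ge1Dx z; nra.
rewrite [leLHS](_ : _ = normal_peak s * expR (- y ^+ 2 / (s ^+ 2 *+ 2)) * (1 + `|y|) ^+ 2); last by ring.
rewrite [leRHS](_ : _ = normal_peak s * expR (- y ^+ 2 / (s ^+ 2 *+ 2)) *
   ((2 + 16 * s ^+ 2 / 3) * expR z)); last by field; rewrite gt_eqF.
by rewrite ler_wpM2l// mulr_ge0// ?expR_ge0// ltW.
Qed.

Let bound_const_ge0 : 0 <= bound_const.
Proof.
rewrite /bound_const mulr_ge0// ?divr_ge0 ?normal_peak_ge0//.
have := ltW s2; lra.
Qed.

Lemma normal_pdf_integrable (f : R -> R) (K : R) : measurable_fun setT f ->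
  (forall x, `|f x| <= K * (1 + `|x - m|) ^+ 2) ->
  mu.-integrable setT (EFin \o (fun x => f x * p x)).
Proof.
move=> mf fK.
have K0 : 0 <= K by have := le_trans (normr_ge0 _) (fK m); rewrite subrr normr0 addr0 expr1n mulr1.
apply: (@le_integrable _ _ _ mu setT _ _
  (fun x => (K * bound_const)%:E * (normal_pdf m (2 * s) x)%:E)%E) => //.
- apply/measurable_EFinP; apply: measurable_funM => //.
  exact: measurable_normal_pdf.
- move=> x _; rewrite -EFinM lee_fin [leRHS]ger0_norm; last first.
    exact: mulr_ge0 (mulr_ge0 K0 bound_const_ge0) (normal_pdf_ge0 _ _ _).
  rewrite /= normrM (ger0_norm (normal_pdf_ge0 _ _ _)).
  rewrite -mulrA; apply: le_trans (ler_wpM2l K0 (p_bound x)).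
  by rewrite mulrA ler_wpM2r// normal_pdf_ge0.
- by apply: integrableZl => //; exact: integrable_normal_pdf.
Qed.

Lemma normal_integral (f : R -> R) (K : R) : measurable_fun setT f ->
  (forall x, `|f x| <= K * (1 + `|x - m|) ^+ 2) ->
  (normal_prob m s).-integrable setT (EFin \o f) /\
  \int[normal_prob m s]_x f x = \int[mu]_x (f x * p x).
Proof.
move=> mf fK; apply: integrable_density => //.
- exact: measurable_normal_pdf.
- by move=> x; exact: normal_pdf_ge0.
- exact: normal_pdf_integrable fK.
Qed.

(** Stein's identity, used with three choices of [u]: the constant 1 gives the mean, x - m the
    variance, and a sine the differential equation of the cosine integrals. The derivative of [u]
    times the density is [h], and its integrals over growing symmetric intervals are boundary terms
    that vanish. *)
Lemma normal_stein (u u' : R -> R) (K : R) :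
  (forall x : R, is_derive x (1 : R) u (u' x)) -> continuous u' ->
  (forall x, `|u x| <= K * (1 + `|x - m|)) -> (forall x, `|u' x| <= K) ->
  \int[normal_prob m s]_x ((x - m) * u x) =
  s ^+ 2 * \int[normal_prob m s]_x u' x.
Proof.
move=> du cu' uK u'K.
have K0 : 0 <= K by exact: le_trans (normr_ge0 _) (u'K m).
move: bound_const bound_const_ge0 p_bound => bc bc0 pb.
have cu := is_derive_continuous du.
have mu_ := continuous_measurable_fun cu; have mu' := continuous_measurable_fun cu'.
have y1 x : 1 <= 1 + `|x - m| by rewrite lerDl.
have y2 x : 1 + `|x - m| <= (1 + `|x - m|) ^+ 2.
  by rewrite expr2 ler_peMr// (le_trans _ (y1 x)).
have mxu : measurable_fun setT (fun x : R => (x - m) * u x).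
  by apply: measurable_funM => //; exact: measurable_funB.
have xuK x : `|(x - m) * u x| <= K * (1 + `|x - m|) ^+ 2.
  rewrite normrM (le_trans (ler_wpM2l _ (uK x)))// mulrCA ler_wpM2l//.
  by rewrite expr2 ler_wpM2r ?lerDr// (le_trans _ (y1 x)).
have u'K2 x : `|u' x| <= K * (1 + `|x - m|) ^+ 2.
  by rewrite (le_trans (u'K x))// ler_peMr// (le_trans (y1 x)).
have [i1 e1] := normal_integral mxu xuK; have i1' := normal_pdf_integrable mxu xuK.
have [i2 e2] := normal_integral mu' u'K2; have i2' := normal_pdf_integrable mu' u'K2.
rewrite e1 e2.
pose F x := u x * p x.
pose h x := u' x * p x - (s ^+ 2)^-1 * ((x - m) * u x * p x).
have dF (x : R) : is_derive x (1 : R) F (h x).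
  apply: is_derive_eq (is_derive_mul (du x) (p_derive x)) _.
  by rewrite /h; field.
have ih : mu.-integrable setT (EFin \o h).
  by apply: integrable_sub => //; exact: integrable_scale.
suff h0 : \int[mu]_x h x = 0.
  move: h0; rewrite RintegralB//; last exact: integrable_scale.
  rewrite RintegralZl// => /eqP; rewrite subr_eq0 => /eqP ->.
  by rewrite mulrA divff ?mul1r// gt_eqF.
have cp : continuous p := is_derive_continuous p_derive.
have ch : continuous h.
  move=> x; apply: cvgB; first by apply: cvgM; [exact: cu'|exact: cp].
  apply: cvgM; first exact: cvg_cst.
  apply: cvgM; last exact: cp.
  by apply: cvgM; [apply: cvgB; [exact: cvg_id|exact: cvg_cst]|exact: cu].
pose I (k : nat) := `[m - k.+1%:R, m + k.+1%:R]%classic : set R.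
have c1 : \int[mu]_x (h x * \1_(I k) x) @[k --> \oo] --> \int[mu]_x h x.
  have := @dominated_cvg_Rintegral _ _ R mu (fun k x => h x * \1_(I k) x) h
    (fun x => `|h x|) => dc; apply: dc.
  - move=> k; apply: measurable_funM.
      exact: continuous_measurable_fun.
    by apply: measurable_indic; exact: measurable_itv.
  - exact: (integrable_abse ih).
  - move=> k x; rewrite normrM ler_piMr// indicE normr_nat lern1.
    by case: (_ \in _).
  - move=> x; rewrite -[X in _ --> X]mulr1; apply: cvgM; first exact: cvg_cst.
    apply: cvg_near_cst; near=> k; rewrite indicE mem_set//= /I /= in_itv/=.
    have : `|x - m| <= k.+1%:R.
      by apply: ltW; rewrite -truncn_le_nat; near: k; exact: nbhs_infty_ge.
    by rewrite ler_norml; lra.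
have E k : \int[mu]_x (h x * \1_(I k) x) = F (m + k.+1%:R) - F (m - k.+1%:R).
  have -> : \int[mu]_x (h x * \1_(I k) x) = \int[mu]_(x in I k) h x.
    rewrite [RHS]Rintegral_mkcond; apply: eq_Rintegral => x _.
    by rewrite patchE indicE; case: (x \in I k); rewrite ?mulr1 ?mulr0.
  rewrite /Rintegral (@continuous_FTC2 _ h F)//.
  - have : (0 : R) < k.+1%:R by []. by move: (k.+1%:R) => r r0; lra.
  - exact: continuous_subspaceT.
  - have cF := is_derive_continuous dF.
    split; first by move=> x _; case: (dF x).
      by apply: cvg_at_right_filter; exact: cF.
    by apply: cvg_at_left_filter; exact: cF.
  - by move=> x _; rewrite derive1E; case: (dF x).
have c2 : F (m + k.+1%:R) - F (m - k.+1%:R) @[k --> \oo] --> (0 : R).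
  (* At distance k + 1 from [m] the wider density has exponent -(k + 1)^2 / (8 s^2), which is at
     most -(k + 1) / (8 s^2); the boundary terms are therefore bounded by a multiple of q^(k +
     1). *)
  pose q := expR (- (8 * s ^+ 2)^-1).
  have s8 : 0 < (8 * s ^+ 2)^-1 by rewrite invr_gt0 mulr_gt0.
  have Fb k x : `|x - m| = k.+1%:R ->
      `|F x| <= (K * bc * normal_peak (2 * s) * q) * q ^+ k.
    move=> xk; rewrite /F normrM (ger0_norm (normal_pdf_ge0 _ _ _)).
    apply: (@le_trans _ _ (K * ((1 + `|x - m|) ^+ 2 * p x))).
      rewrite mulrA ler_wpM2r ?normal_pdf_ge0//.
      by rewrite (le_trans (uK x))// ler_wpM2l.
    apply: (le_trans (ler_wpM2l K0 (pb x))).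
    rewrite -!mulrA ler_wpM2l// ler_wpM2l// normal_pdfE ?mulf_neq0//.
    rewrite ler_wpM2l ?normal_peak_ge0// /normal_fun -exprS /q -expRM_natl ler_expR.
    rewrite -(real_normK (num_real (x - m))) xk.
    have -> : - k.+1%:R ^+ 2 / ((2 * s) ^+ 2 *+ 2) = - (k.+1%:R ^+ 2 * (8 * s ^+ 2)^-1).
      by field.
    by rewrite mulrN lerN2 ler_wpM2r// ?(ltW s8)// expr2 ler_peMr// ler1n.
  have Fz (x_ : nat -> R) : (forall k, `|x_ k - m| = k.+1%:R) -> F (x_ k) @[k --> \oo] --> 0.
    move=> xk; apply/norm_cvg0P.
    apply: (@squeeze_cvgr _ _ _ _ (fun=> 0)
      (fun k => (K * bc * normal_peak (2 * s) * q) * q ^+ k)).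
    - by apply: nearW => k; rewrite normr_ge0 /=; apply: Fb.
    - exact: cvg_cst.
    - rewrite exprn_geometric -(mulr0 (K * bc * normal_peak (2 * s) * q)).
      apply: cvgMr; apply: cvg_geometric.
      by rewrite ger0_norm ?expR_ge0// expR_lt1; lra.
  rewrite -(subr0 0); apply: cvgB; apply: Fz => k.
    by rewrite addrAC subrr add0r normr_nat.
  by rewrite addrAC subrr add0r normrN normr_nat.
rewrite -(cvg_lim (@Rhausdorff R) c1).
by under eq_fun do rewrite E; exact: cvg_lim c2.
Unshelve. all: by end_near. Qed.

End normal_stein.

(** The image measure as a relation between set functions, so that it applies equally to a
    distribution, to a measure obtained from [law_exists] and to a kernel at a fixed point. *)
Definition law d1 d2 (T : measurableType d1) (U : measurableType d2) (R : realType)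
  (P : set T -> \bar R) (g : T -> U) (nu : set U -> \bar R) :=
  forall A, measurable A -> nu A = P (g @^-1` A).

Section law.
Context d1 d2 (T : measurableType d1) (U : measurableType d2) (R : realType).

Lemma law_exists (P : probability T R) (g : T -> U) : measurable_fun setT g ->
  exists nu : probability U R, law P g nu.
Proof.
move=> mg; pose G : {RV P >-> U} := HB.pack g (isMeasurableFun.Build _ _ _ _ _ mg).
by exists (distribution P G) => A mA.
Qed.

Variables (P : {measure set T -> \bar R}) (g : T -> U) (nu : {measure set U -> \bar R}).
Hypotheses (mg : measurable_fun setT g) (gnu : law P g nu).

Lemma law_ge0_integral (f : U -> \bar R) : measurable_fun setT f ->
  (forall x, 0 <= f x)%E -> (\int[nu]_x f x = \int[P]_x f (g x))%E.
Proof.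
move=> mf f0; have <- := @ge0_integral_pushforward _ _ _ _ _ g mg P setT f measurableT mf (fun x _ => f0 x).
by apply: eq_measure_integral => A mA _; exact: gnu.
Qed.

Lemma law_Rintegral (f : U -> R) : measurable_fun setT f ->
  P.-integrable setT (EFin \o (fun x => f (g x))) ->
  nu.-integrable setT (EFin \o f) /\ \int[nu]_x f x = \int[P]_x f (g x).
Proof.
move=> mf iP; have mfE : measurable_fun setT (EFin \o f) by exact/measurable_EFinP.
split.
  apply/integrableP; split => //; rewrite law_ge0_integral//.
    by case/integrableP : iP.
  exact: measurableT_comp.
rewrite /Rintegral; congr fine.
have <- := @integral_pushforward _ _ _ _ _ g mg P setT (EFin \o f) mfE iP measurableT.
by apply: eq_measure_integral => A mA _; exact: gnu.
Qed.

Lemma law_integrable (f : U -> R) : measurable_fun setT f ->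
  nu.-integrable setT (EFin \o f) ->
  P.-integrable setT (EFin \o (fun x => f (g x))) /\ \int[nu]_x f x = \int[P]_x f (g x).
Proof.
move=> mf inu; suff iP : P.-integrable setT (EFin \o (fun x => f (g x))).
  by split => //; case: (law_Rintegral mf iP).
have mfE : measurable_fun setT (EFin \o f) by exact/measurable_EFinP.
apply/integrableP; split; first exact: (measurableT_comp mfE mg).
case/integrableP : inu => _; rewrite law_ge0_integral//.
exact: measurableT_comp.
Qed.

Lemma law_cos (u : U -> R) c : (P setT < +oo)%E -> measurable_fun setT u ->
  \int[nu]_x cos (u x + c) = \int[P]_x cos (u (g x) + c).
Proof.
move=> Pf mu; have mc : measurable_fun setT (fun x => cos (u x + c)).
  apply: (@measurableT_comp _ _ _ _ _ _ (@cos R)).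
    by apply: continuous_measurable_fun; exact: continuous_cos.
  exact: measurable_funD.
have iP : P.-integrable setT (EFin \o (fun x => cos (u (g x) + c))).
  apply: (integrable_bounded Pf (K := 1)); first exact: (measurableT_comp mc mg).
  by move=> x; exact: cos_max.
by case: (law_Rintegral mc iP).
Qed.

End law.

Section gaussian_transform.
Context {R : realType}.

(** The integrating factor exp(a t^2 / 2) makes the product with [phi] constant. *)
Lemma expR_ode (phi : R -> R) (a : R) :
  (forall t : R, is_derive t (1 : R) phi (- (a * t * phi t))) ->
  forall t, phi t = expR (- (t ^+ 2 * a / 2)) * phi 0.
Proof.
move=> dphi t.
have dq (x : R) : is_derive x (1 : R) (fun y => expR (a / 2 * (y * y)))
    (a * x * expR (a / 2 * (x * x))).
  apply: is_derive_eq (is_derive_comp (is_derive_expR _) (is_derive_scale (a / 2)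
    (is_derive_mul (is_derive_id x 1) (is_derive_id x 1)))) _.
  by field.
have := @is_derive_0_is_cst _ (fun y => expR (a / 2 * (y * y)) * phi y) t 0.
have d0 (x : R) : is_derive x (1 : R) (fun y => expR (a / 2 * (y * y)) * phi y) 0.
  by apply: is_derive_eq (is_derive_mul (dq x) (dphi x)) _; ring.
move=> /(_ d0); rewrite mulr0 mulr0 expR0 mul1r => <-.
rewrite mulrA -expRD (_ : _ + _ = 0) ?expR0 ?mul1r//.
by field.
Qed.

(** The characteristic function of a Gaussian law in real form: c = 0 gives its real part and c = -
    pi / 2 its imaginary part. *)
Definition cos_gaussian (nu : {measure set (measurableTypeR R) -> \bar R}) (m v : R) := forall t c,
  \int[nu]_x cos (t * x + c) = expR (- (t ^+ 2 * v / 2)) * cos (t * m + c).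

Definition gaussian_moments (nu : {measure set (measurableTypeR R) -> \bar R}) (m v : R) :=
  [/\ 0 <= v, nu.-integrable setT (EFin \o (fun x => x ^+ 2)),
      \int[nu]_x x = m, \int[nu]_x (x - m) ^+ 2 = v & cos_gaussian nu m v].

Lemma normal_gaussian_moments (m s : R) : s != 0 ->
  gaussian_moments (normal_prob m s) m (s ^+ 2).
Proof.
move=> s0; set N := normal_prob m s.
have N1 : N setT = 1%E by exact: probability_setT.
have Nf : (N setT < +oo)%E by rewrite N1 ltry.
have iX2 : N.-integrable setT (EFin \o (fun x => x ^+ 2)).
  have [|x|//] := @normal_integral _ m s s0 (fun x => x ^+ 2) (2 * (1 + m ^+ 2)).
    exact: measurable_funX.
  rewrite ger0_norm ?sqr_ge0//.
  have h : x ^+ 2 <= 2 * (x - m) ^+ 2 + 2 * m ^+ 2 by have := sqr_ge0 (x - 2 * m); nra.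
  have a0 := normr_ge0 (x - m); have a1 := real_normK (num_real (x - m)).
  rewrite (le_trans h)// -a1; move: `|x - m| a0 => a a0; have := sqr_ge0 m; nra.
have poly2 (f : R -> R) (K : R) : measurable_fun setT f -> (forall x, `|f x| <= K * (1 + `|x - m|)^+2) ->
    N.-integrable setT (EFin \o f).
  by move=> mf fK; case: (normal_integral s0 mf fK).
have iX : N.-integrable setT (EFin \o (fun x => x - m)).
  apply: (poly2 _ 1) => [|x]; first exact: measurable_funB.
  by rewrite mul1r; have := normr_ge0 (x - m); nra.
have ic (c : R) : N.-integrable setT (EFin \o cst c).
  exact: (integrable_bounded Nf (K := `|c|)).
have N1' : fine (N setT) = 1 by rewrite N1.
have mean0 : \int[N]_x (x - m) = 0.
  transitivity (\int[N]_x ((x - m) * cst 1 x)).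
    by apply: eq_Rintegral => x _; rewrite mulr1.
  rewrite (@normal_stein _ m s s0 (cst 1) (cst 0) 1); first last.
  - by move=> x; rewrite normr0.
  - by move=> x; rewrite normr1 mul1r lerDl.
  - by move=> x; exact: cst_continuous.
  by rewrite Rintegral_cst// mul0r mulr0.
split => //.
- exact: sqr_ge0.
- transitivity (\int[N]_x ((x - m) + cst m x)).
    by apply: eq_Rintegral => x _; rewrite subrK.
  by rewrite RintegralD// mean0 add0r Rintegral_cst// N1' mulr1.
- transitivity (\int[N]_x ((x - m) * (1 * x + - m))).
    by apply: eq_Rintegral => x _; rewrite mul1r expr2.
  rewrite (@normal_stein _ m s s0 (fun x => 1 * x + - m) (cst 1) 1
    (is_derive_affine 1 (- m))); first last.
  - by move=> x; rewrite normr1.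
  - by move=> x; rewrite !mul1r lerDr.
  - by move=> x; exact: cst_continuous.
  by rewrite Rintegral_cst// N1' !mulr1.
move=> t0 c0.
(* With the phase frozen at this value, the centred family [f] returns the wanted integrand at t =
   [t0], while its derivative in t contains no mean term and leads to a homogeneous equation. *)
pose c := t0 * m + c0.
pose f t x := cos (t * (x - m) + c).
have dcos (a b y : R) : is_derive y (1 : R) (fun y => cos (a * y + b)) (- (a * sin (a * y + b))).
  apply: is_derive_eq (is_derive_comp (is_derive_cos _) (is_derive_affine a b y)) _.
  by ring.
have dsin (a b y : R) : is_derive y (1 : R) (fun y => sin (a * y + b)) (a * cos (a * y + b)).
  apply: is_derive_eq (is_derive_comp (is_derive_sin _) (is_derive_affine a b y)) _.
  by ring.
have mf t : measurable_fun setT (f t).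
  apply: continuous_measurable_fun.
  have -> : f t = fun x => cos (t * x + (c - t * m)).
    by apply/funext => x; rewrite /f; congr cos; ring.
  exact: is_derive_continuous (dcos _ _).
have intf t : N.-integrable setT (EFin \o f t).
  by apply: (integrable_bounded Nf (K := 1) (mf t)) => x; exact: cos_max.
have df t x : is_derive t (1 : R) (f ^~ x) (- ((x - m) * sin (t * (x - m) + c))).
  have -> : f ^~ x = fun t => cos ((x - m) * t + c).
    by apply/funext => y; rewrite /f mulrC.
  by rewrite (mulrC t); exact: dcos.
have d1f t x : partial1of2 f t x = - ((x - m) * sin (t * (x - m) + c)).
  by rewrite partial1of2E; case: (df t x).
have dphi (t : R) : is_derive t (1 : R) (fun t => \int[N]_x f t x)
    (- (s ^+ 2 * t * \int[N]_x f t x)).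
  have It : `]t - 1, t + 1[%classic t by rewrite /= in_itv/=; apply/andP; split; lra.
  have intG : N.-integrable setT (EFin \o (fun x => `|x - m|)) by exact: (integrable_abse iX).
  have Gub x y : `]t - 1, t + 1[%classic x -> setT y -> `|partial1of2 f x y| <= `|y - m|.
    by move=> _ _; rewrite d1f normrN normrM ler_piMr// sin_max.
  have df1 (x y : R) : `]t - 1, t + 1[%classic x -> setT y -> derivable (f ^~ y) x 1.
    by move=> _ _; case: (df x y).
  have D1 := @derivable_under_integral R _ _ N f setT measurableT t _ _ It
    (fun x _ => intf x) df1 _ (fun y => normr_ge0 _) intG Gub.
  have D2 := @differentiation_under_integral R _ _ N f setT measurableT t _ _ It
    (fun x _ => intf x) df1 _ (fun y => normr_ge0 _) intG Gub.
  apply: DeriveDef; first exact: D1.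
  rewrite -derive1E D2.
  transitivity (\int[N]_x (- 1 * ((x - m) * sin (t * (x - m) + c)))).
    by apply: eq_Rintegral => x _; rewrite d1f mulN1r.
  have msin : measurable_fun setT (fun x : R => sin (t * (x - m) + c)).
    apply: continuous_measurable_fun.
    have -> : (fun x : R => sin (t * (x - m) + c)) = fun x => sin (t * x + (c - t * m)).
      by apply/funext => x; congr sin; ring.
    exact: is_derive_continuous (dsin _ _).
  rewrite RintegralZl//; last first.
    apply: (poly2 _ 1) => [|x]; first by apply: measurable_funM => //; exact: measurable_funB.
    rewrite normrM mul1r (le_trans (ler_piMr _ (sin_max _)))//.
    by have := normr_ge0 (x - m); nra.
  have dS (x : R) : is_derive x (1 : R) (fun x : R => sin (t * (x - m) + c)) (t * f t x).
    have -> : (fun x : R => sin (t * (x - m) + c)) = fun x => sin (t * x + (c - t * m)).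
      by apply/funext => y; congr sin; ring.
    rewrite /f (_ : t * (x - m) + c = t * x + (c - t * m)); last by ring.
    exact: dsin.
  rewrite (@normal_stein _ m s s0 _ _ (1 + `|t|) dS); first last.
  - by move=> x; rewrite normrM (le_trans (ler_piMr _ (cos_max _)))// lerDr.
  - move=> x; rewrite (le_trans (sin_max _))//.
    by have := normr_ge0 (x - m); have := normr_ge0 t; nra.
  - move=> x; apply: cvgM; first exact: cvg_cst.
    have -> : f t = fun x => cos (t * x + (c - t * m)).
      by apply/funext => y; rewrite /f; congr cos; ring.
    exact: (is_derive_continuous (dcos _ _)).
  by rewrite RintegralZl//; ring.
have := expR_ode dphi t0; rewrite /f.
have -> : \int[N]_x cos (0 * (x - m) + c) = cos c.
  transitivity (\int[N]_x cst (cos c) x); last by rewrite Rintegral_cst// N1' mulr1.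
  by apply: eq_Rintegral => x _; rewrite mul0r add0r.
move=> <-; apply: eq_Rintegral => x _; congr cos; rewrite /c; ring.
Qed.

Lemma dirac_gaussian_moments (m : R) : gaussian_moments (@dirac _ (measurableTypeR R) m R) m 0.
Proof.
have D (f : measurableTypeR R -> R) : measurable_fun setT f ->
    \int[@dirac _ (measurableTypeR R) m R]_x f x = f m.
  move=> mf; rewrite /Rintegral integral_dirac//; last exact/measurable_EFinP.
  by rewrite diracT mul1e.
split=> //.
- apply/integrableP; split; first by apply/measurable_EFinP; exact: measurable_funX.
  rewrite integral_dirac// ?diracT ?mul1e ?ltry//.
  by apply: measurableT_comp => //; apply/measurable_EFinP; exact: measurable_funX.
- exact: D.
- by rewrite D ?subrr ?expr0n//; apply: measurable_funX; exact: measurable_funB.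
- move=> t c; rewrite D; first by rewrite mulr0 mul0r oppr0 expR0 mul1r.
  apply: (@measurableT_comp _ _ _ _ _ _ (@cos R)).
    by apply: continuous_measurable_fun; exact: continuous_cos.
  by apply: measurable_funD => //; exact: measurable_funM.
Qed.

Lemma real_gaussian_moments (nu : {measure set (measurableTypeR R) -> \bar R}) :
  real_gaussian_measure nu -> exists m v, gaussian_moments nu m v.
Proof.
move=> [m [s nuE]].
have [s0|s0] := eqVneq s 0.
  exists m, 0; case: (dirac_gaussian_moments m) => v0 i e1 e2 e3.
  have nuD A : measurable A -> A `<=` setT -> nu A = \d_m A.
    by move=> mA _; rewrite nuE// s0 eqxx.
  split => //.
  - case/integrableP : i => mi i; apply/integrableP; split => //.
    by rewrite (eq_measure_integral (@dirac _ (measurableTypeR R) m R) nuD).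
  - by rewrite -[RHS]e1 /Rintegral (eq_measure_integral (@dirac _ (measurableTypeR R) m R) nuD).
  - by rewrite -[RHS]e2 /Rintegral (eq_measure_integral (@dirac _ (measurableTypeR R) m R) nuD).
  - by move=> t c; rewrite -e3 /Rintegral (eq_measure_integral (@dirac _ (measurableTypeR R) m R) nuD).
exists m, (s ^+ 2); case: (normal_gaussian_moments m s0) => v0 i e1 e2 e3.
have nuD A : measurable A -> A `<=` setT -> nu A = normal_prob m s A.
  by move=> mA _; rewrite nuE// (negbTE s0).
split => //.
- case/integrableP : i => mi i; apply/integrableP; split => //.
  by rewrite (eq_measure_integral (normal_prob m s) nuD).
- by rewrite -[RHS]e1 /Rintegral (eq_measure_integral (normal_prob m s) nuD).
- by rewrite -[RHS]e2 /Rintegral (eq_measure_integral (normal_prob m s) nuD).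
- by move=> t c; rewrite -e3 /Rintegral (eq_measure_integral (normal_prob m s) nuD).
Qed.

Lemma real_gaussian_cos (nu : {measure set (measurableTypeR R) -> \bar R}) (m v : R) :
  (nu setT < +oo)%E -> 0 <= v -> cos_gaussian nu m v -> real_gaussian_measure nu.
Proof.
move=> nuf v0 nucos; exists m, (Num.sqrt v) => A mA.
have [s0|s0] := eqVneq (Num.sqrt v) 0.
  have v00 : v = 0 by rewrite -(sqr_sqrtr v0) s0 expr0n.
  apply: (@measure_eq_cos_real _ nu (@dirac _ (measurableTypeR R) m R)) => //.
    by rewrite /= diracT ltry.
  move=> t c; rewrite nucos v00; case: (dirac_gaussian_moments m) => _ _ _ _ ->.
  by [].
apply: (@measure_eq_cos_real _ nu (normal_prob m (Num.sqrt v))) => //.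
  by rewrite [X in (X < _)%E]probability_setT ltry.
move=> t c; rewrite nucos.
by case: (normal_gaussian_moments m s0) => _ _ _ _ ->; rewrite sqr_sqrtr.
Qed.

End gaussian_transform.

(** * Bochner integrals on finite measure spaces *)

Section bochner_integral.
Context d (T : measurableType d) (R : realType) (E : normedModType R).
Variables (mu : {measure set T -> \bar R}) (D : set T).
Hypotheses (sE : separable_space E) (mufin : (mu setT < +oo)%E) (mD : measurable D).

Lemma measurable_set1_borel (x : E) : measurable ([set x] : set (borel E)).
Proof.
rewrite -(setCK [set x]); apply: measurableC; apply: sub_sigma_algebra.
by apply: closed_openC; exact: accessible_closed_set1 (hausdorff_accessible (@norm_hausdorff _ _)) x.
Qed.

Lemma measurable_fun_norm (f : T -> E) : borel_fun setT f ->
  measurable_fun setT (fun t => `|f t|).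
Proof. by move=> mf; exact: (measurableT_comp (@measurable_norm R E) mf). Qed.

Lemma measurable_fun_dual_comp (g : dual E) (f : T -> E) : borel_fun setT f ->
  measurable_fun setT (fun t => g (f t) : R).
Proof. by move=> mf; exact: (measurableT_comp (measurable_dual g) mf). Qed.

Lemma borel_fun_lin (a b : R) (f g : T -> E) : borel_fun setT f -> borel_fun setT g ->
  borel_fun setT (fun t => a *: f t + b *: g t).
Proof.
move=> mf mg; apply: measurable_fun_dual => // h.
have -> : (fun t => h (a *: f t + b *: g t) : R) = fun t => a * h (f t) + b * h (g t).
  by apply/funext => t; rewrite dualD !dualZ.
by apply: measurable_funD; apply: measurable_funM => //; exact: measurable_fun_dual_comp.
Qed.

Lemma borel_funB (f g : T -> E) : borel_fun setT f -> borel_fun setT g ->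
  borel_fun setT (fun t => f t - g t).
Proof.
move=> mf mg; have := borel_fun_lin 1 (-1) mf mg; congr (borel_fun _ _).
by apply/funext => t; rewrite scale1r scaleN1r.
Qed.

Lemma integrable_dual_comp (g : dual E) (f : T -> E) : borel_fun setT f ->
  mu.-integrable setT (EFin \o (fun t => `|f t|)) ->
  mu.-integrable setT (EFin \o (fun t => g (f t) : R)).
Proof.
move=> mf fi; have [C C0 gC] := dual_bound g.
apply: (le_integrable _ _ _ (integrable_scale measurableT C fi)) => //.
  by apply/measurable_EFinP; exact: measurable_fun_dual_comp.
by move=> t _; rewrite lee_fin (le_trans (gC _))// ler_norm.
Qed.

Let Rintegral_sum I (r : seq I) (h : I -> T -> R) :
  (forall i, mu.-integrable D (EFin \o h i)) ->
  mu.-integrable D (EFin \o (fun t => \sum_(i <- r) h i t)) /\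
  \int[mu]_(t in D) (\sum_(i <- r) h i t) = \sum_(i <- r) \int[mu]_(t in D) h i t.
Proof.
move=> ih; elim: r => [|i r [IH1 IH2]].
  rewrite big_nil; split; last first.
    by under eq_Rintegral do rewrite big_nil; rewrite Rintegral_cst// mul0r.
  by under eq_fun do rewrite big_nil; exact: integrable0.
have -> : (fun t => \sum_(j <- i :: r) h j t) = fun t => h i t + \sum_(j <- r) h j t.
  by apply/funext => t; rewrite big_cons.
split; first exact: integrable_add.
by rewrite big_cons RintegralD// IH2.
Qed.

Lemma bochner_simple_bounded (s : T -> E) : finite_set (range s) ->
  exists K, forall t, `|s t| <= K.
Proof.
move=> fs; exists (\sum_(x <- finmap.enum_fset (fset_set (range s))) `|x|) => t.
have st : s t \in finmap.enum_fset (fset_set (range s)) by rewrite in_fset_set//; apply: mem_set; exists t.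
by rewrite (big_rem _ st)/= lerDl sumr_ge0.
Qed.

Lemma bochner_simple_norm_integrable (s : T -> E) : bochner_simple mu D s ->
  mu.-integrable setT (EFin \o (fun t => `|s t|)).
Proof.
move=> [ms fs _]; have [K sK] := bochner_simple_bounded fs.
apply: (integrable_bounded mufin (K := K)); first exact: measurable_fun_norm.
by move=> t; rewrite normr_id.
Qed.

Lemma dual_bochner_simple_integral (s : T -> E) (g : dual E) :
  bochner_simple mu D s ->
  g (bochner_simple_integral mu D s) = \int[mu]_(t in D) g (s t) :> R.
Proof.
move=> ss; have [ms fs _] := ss.
have mDs x : measurable (s @^-1` [set x]).
  by rewrite -[X in measurable X]setTI; apply: ms => //; exact: measurable_set1_borel.
rewrite /bochner_simple_integral fsbig_finite//= raddf_sum.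
pose h x t : R := g x * \1_(s @^-1` [set x]) t.
have ih x : mu.-integrable D (EFin \o h x).
  apply: (integrableS measurableT) => //.
  apply: (integrable_bounded mufin (K := `|g x|)).
    by apply: measurable_funM => //; exact: measurable_indic.
  by move=> t; rewrite normrM ler_piMr// indicE normr_nat lern1; case: (_ \in _).
transitivity (\int[mu]_(t in D) \sum_(x <- finmap.enum_fset (fset_set (range s))) h x t); last first.
  apply: eq_Rintegral => t _; rewrite (bigD1_seq (s t)) ?finmap.fset_uniq//=; last first.
    by rewrite in_fset_set//; apply: mem_set; exists t.
  rewrite /h indicE mem_set//= mulr1 big1 ?addr0// => x xt.
  by rewrite indicE memNset ?mulr0//= => /eqP; rewrite eq_sym (negbTE xt).
rewrite (Rintegral_sum _ ih).2; apply: eq_bigr => x _.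
transitivity (fine (mu (D `&` s @^-1` [set x])) * g x); first exact: dualZ.
have i1 : mu.-integrable D (EFin \o \1_(s @^-1` [set x])).
  apply: (integrableS measurableT) => //; apply: (integrable_bounded mufin (K := 1)).
    exact: measurable_indic.
  by move=> t; rewrite indicE normr_nat lern1; case: (_ \in _).
by rewrite /h RintegralZl// mulrC /Rintegral integral_indic// setIC.
Qed.

(** The image under a functional does not depend on the approximating sequence, so the value
    selected by [bochner_integral] is determined. *)
Lemma dual_has_bochner_integral (f : T -> E) (v : E) (g : dual E) :
  borel_fun setT f -> mu.-integrable setT (EFin \o (fun t => `|f t|)) ->
  has_bochner_integral mu D f v -> g v = \int[mu]_(t in D) g (f t) :> R.
Proof.
move=> mf fi [_ [s [ss s0] sv]]; have [C C0 gC] := dual_bound g.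
have gf : mu.-integrable D (EFin \o (fun t => g (f t) : R)).
  by apply: (integrableS measurableT) => //; exact: integrable_dual_comp.
have mfs k : borel_fun setT (fun t => f t - s k t).
  by apply: borel_funB => //; case: (ss k).
have ifs k : mu.-integrable D (EFin \o (fun t => `|f t - s k t|)).
  apply: (integrableS measurableT) => //.
  apply: (le_integrable _ _ _ (integrable_add measurableT fi
    (bochner_simple_norm_integrable (ss k)))) => //.
    by apply/measurable_EFinP; exact: measurable_fun_norm.
  move=> t _; rewrite lee_fin normr_id ger0_norm ?addr_ge0//.
  by rewrite (le_trans (ler_normB _ _)).
have gs k : mu.-integrable D (EFin \o (fun t => g (s k t) : R)).
  apply: (integrableS measurableT) => //; apply: integrable_dual_comp.
    by case: (ss k).
  exact: bochner_simple_norm_integrable.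
have s0' : C * \int[mu]_(t in D) `|f t - s k t| @[k --> \oo] --> (0 : R).
  rewrite -(mulr0 C); apply: cvgMr; apply: fine_cvg; exact: s0.
have c1 : (g (bochner_simple_integral mu D (s k)) : R) @[k --> \oo] -->
    \int[mu]_(t in D) g (f t).
  apply/subr_cvg0/norm_cvg0P.
  apply: (@squeeze_cvgr _ _ _ _ (fun=> 0) (fun k => C * \int[mu]_(t in D) `|f t - s k t|)) => //.
    apply: nearW => k; rewrite normr_ge0 /= dual_bochner_simple_integral//.
    rewrite -RintegralB// (le_trans (le_normr_Rintegral _ _))//.
      exact: integrable_sub.
    rewrite -RintegralZl//; apply: le_Rintegral => //.
    + exact: (integrable_abse (integrable_sub mD (gs k) gf)).
    + exact: integrable_scale.
    + by move=> t _; rewrite distrC -dualB.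
  exact: cvg_cst.
have c2 : (g (bochner_simple_integral mu D (s k)) : R) @[k --> \oo] --> (g v : R).
  by apply: (cvg_comp _ _ sv); exact: (@dual_continuous _ _ g).
by rewrite -(cvg_lim (@Rhausdorff R) c1) -(cvg_lim (@Rhausdorff R) c2).
Qed.

Lemma bochner_approx_exists (f : T -> E) : borel_fun setT f ->
  mu.-integrable setT (EFin \o (fun t => `|f t|)) ->
  exists s, bochner_approx mu D f s.
Proof.
move=> mf fi; have [e de] := dense_sequence (0 : E) sE.
(* [s k t] is a point nearest to [f t] among 0 and the first k terms of the dense sequence. Starting
   from 0 keeps the error below the norm of [f t], which is the domination needed for the limit. *)
pose s := fix s k t := if k is k'.+1 then
  if `|f t - e k'| < `|f t - s k' t| then e k' else s k' t else 0.
have mfe c : measurable_fun setT (fun t => `|f t - c|).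
  by apply: measurable_fun_norm; apply: borel_funB => //; exact: measurable_cst.
have ms k : borel_fun setT (s k).
  elim: k => [|k IH]; first exact: measurable_cst.
  apply: measurable_fun_ifT => //.
  apply: measurable_fun_ltr => //.
  by apply: measurable_fun_norm; exact: borel_funB.
have fs k : finite_set (range (s k)).
  elim: k => [|k IH].
    by apply: (sub_finite_set _ (finite_set1 0)) => _ [t _ <-].
  apply: (@sub_finite_set _ _ (range (s k) `|` [set e k])).
    by move=> _ [t _ <-] /=; case: ifP => _; [right|left; exists t].
  by rewrite finite_setU; split.
have sdec k t : `|f t - s k.+1 t| <= `|f t - s k t|.
  by rewrite /=; case: ltP => // /ltW.
have sf k t : `|f t - s k t| <= `|f t|.
  by elim: k => [|k IH]; [rewrite /= subr0|rewrite (le_trans (sdec k t))].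
have se k j t : (j < k)%N -> `|f t - s k t| <= `|f t - e j|.
  elim: k => // k IH; rewrite ltnS leq_eqVlt => /predU1P[->|/IH].
    by rewrite /=; case: ltP => // /ltW.
  exact: le_trans.
have sc t : `|f t - s k t| @[k --> \oo] --> (0 : R).
  apply/cvgrPdist_lt => r r0.
  have [j] := de _ (@ball_open _ E (f t) r) (ex_intro _ _ (ballxx _ r0)).
  rewrite -ball_normE/= => fj; near=> k.
  rewrite sub0r normrN normr_id; apply: le_lt_trans fj; apply: se.
  by near: k; exact: nbhs_infty_gt.
exists s; split.
  move=> k; split => // x _; apply: le_lt_trans mufin.
  have mDx : measurable (D `&` s k @^-1` [set x]).
    apply: measurableI => //; rewrite -[X in measurable X]setTI.
    by apply: ms => //; exact: measurable_set1_borel.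
  by apply: le_measure => //; exact: mem_set.
have mfs k : measurable_fun setT (fun t => `|f t - s k t|).
  by apply: measurable_fun_norm; exact: borel_funB.
have := @dominated_cvg_Rintegral _ _ R mu (fun k t => `|f t - s k t|) (cst 0) (fun t => `|f t|) mfs fi.
have -> : \int[mu]_x cst 0 x = 0 :> R by rewrite Rintegral_cst// mul0r.
move=> dc; have {}dc : \int[mu]_t `|f t - s k t| @[k --> \oo] --> (0 : R).
  by apply: dc => // k t; rewrite normr_id.
have ifs k : mu.-integrable setT (EFin \o (fun t => `|f t - s k t|)).
  apply: (le_integrable _ _ _ fi) => //; first exact/measurable_EFinP.
  by move=> t _; rewrite lee_fin !normr_id.
apply: (@squeeze_cvge _ _ _ _ (cst 0%E) _ (fun k => (\int[mu]_t `|f t - s k t|)%:E)).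
- apply: nearW => k; rewrite integral_ge0//= /Rintegral fineK.
    by apply: ge0_subset_integral => //; exact/measurable_EFinP.
  exact: (integrable_fin_num measurableT (ifs k)).
- exact: cvg_cst.
- by apply: cvg_EFin => //; exact: nearW.
Unshelve. all: by end_near. Qed.

End bochner_integral.

Section bochner_integral_complete.
Context d (T : measurableType d) (R : realType) (E : completeNormedModType R).
Variables (mu : {measure set T -> \bar R}).
Hypotheses (sE : separable_space E) (mufin : (mu setT < +oo)%E).

(** The interface to Bochner integrals for the rest of the proof. Assumptions are made on the whole
    space while the integral is over [D], as conditional expectations require. *)
Lemma bochner_integralP (D : set T) (f : T -> E) : measurable D -> borel_fun setT f ->
  mu.-integrable setT (EFin \o (fun t => `|f t|)) ->
  bochner_integrable mu D f /\
  forall g : dual E, g (bochner_integral mu D f) = \int[mu]_(t in D) g (f t) :> R.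
Proof.
move=> mD mf fi; have [s sa] := bochner_approx_exists sE mufin mD mf fi.
have mfD : borel_fun D f by exact: measurable_funTS.
split; first by split => //; exists s.
suff [v hv] : exists v, has_bochner_integral mu D f v.
  move=> g; apply: dual_has_bochner_integral => //.
  exact: (xgetI 0 hv).
case: (sa) => ss s0.
pose I k := bochner_simple_integral mu D (s k).
pose e k := \int[mu]_(t in D) `|f t - s k t|.
have ifs k : mu.-integrable D (EFin \o (fun t => `|f t - s k t|)).
  apply: (integrableS measurableT) => //.
  apply: (le_integrable _ _ _ (integrable_add measurableT fi
    (bochner_simple_norm_integrable mufin (ss k)))) => //.
    apply/measurable_EFinP; apply: measurable_fun_norm; apply: borel_funB => //.
    by case: (ss k).
  move=> t _; rewrite lee_fin normr_id ger0_norm ?addr_ge0//.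
  by rewrite (le_trans (ler_normB _ _)).
have gs k (g : dual E) : mu.-integrable D (EFin \o (fun t => g (s k t) : R)).
  apply: (integrableS measurableT) => //; apply: integrable_dual_comp => //.
    by case: (ss k).
  exact: bochner_simple_norm_integrable.
have IB k l : `|I k - I l| <= e k + e l.
  (* A functional norming the difference reduces the Cauchy estimate to real integrals, and does so
     without linearity of the integral on vector valued simple functions. *)
  have [g [gn gb]] := hahn_banach_norming (I k - I l).
  rewrite -gn dualB !dual_bochner_simple_integral// -RintegralB//.
  rewrite (le_trans (ler_norm _))// (le_trans (le_normr_Rintegral _ _))//.
    exact: integrable_sub.
  rewrite -RintegralD//; apply: le_Rintegral => //.
  - exact: (integrable_abse (integrable_sub mD (gs k g) (gs l g))).
  - exact: integrable_add.
  - move=> t _; rewrite -dualB (le_trans (gb _))//.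
    rewrite (distrC (f t)) -[X in `|X|](subrKA (f t)).
    exact: ler_normD.
have e0 : e k @[k --> \oo] --> (0 : R) by apply: fine_cvg; exact: s0.
have Ic : cvg (I k @[k --> \oo]).
  apply: cauchy_cvg; apply/cauchy_exP => r r0.
  have r2 : 0 < r / 2 by rewrite divr_gt0.
  have /cvgrPdist_lt/(_ _ r2)[n _ ne] := e0.
  have er k : (n <= k)%N -> e k < r / 2.
    by move=> /ne /=; rewrite sub0r normrN; apply: le_lt_trans; exact: ler_norm.
  exists (I n); exists n => // k /= nk; rewrite -ball_normE/=.
  have := IB n k; have := er n (leqnn n); have := er k nk; lra.
by case/cvg_ex : Ic => v Iv; exists v; split => //; exists s.
Qed.

End bochner_integral_complete.

(** * Covariances and Gaussian random variables *)

Section covariance.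
Context d (T : measurableType d) (R : realType) (mu : {measure set T -> \bar R}).
Hypothesis mufin : (mu setT < +oo)%E.

Definition sq_integrable (u : T -> R) :=
  measurable_fun setT u /\ mu.-integrable setT (EFin \o (fun t => u t ^+ 2)).

Lemma sq_integrable_integrable u : sq_integrable u -> mu.-integrable setT (EFin \o u).
Proof.
move=> [um u2]; have i1 : mu.-integrable setT (EFin \o cst (1 : R)).
  by apply: (integrable_bounded mufin (K := 1)) => // x; rewrite normr1.
apply: (le_integrable _ _ _ (integrable_add measurableT i1 u2)) => //.
  exact/measurable_EFinP.
move=> x _; rewrite lee_fin [leRHS]ger0_norm ?addr_ge0 ?sqr_ge0//.
rewrite /= -(real_normK (num_real (u x))).
by have := normr_ge0 (u x); have := sqr_ge0 (`|u x| - 1); nra.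
Qed.

Lemma sq_integrable_mul u v : sq_integrable u -> sq_integrable v ->
  mu.-integrable setT (EFin \o (fun t => u t * v t)).
Proof.
move=> [um u2] [vm v2]; apply: (le_integrable _ _ _ (integrable_add measurableT u2 v2)) => //.
  by apply/measurable_EFinP; exact: measurable_funM.
move=> x _; rewrite lee_fin [leRHS]ger0_norm ?addr_ge0 ?sqr_ge0//= ler_norml.
have := sqr_ge0 (u x - v x); have := sqr_ge0 (u x + v x).
by move=> h1 h2; apply/andP; split; nra.
Qed.

Lemma sq_integrable_cst (c : R) : sq_integrable (cst c).
Proof.
split; first exact: measurable_cst.
by apply: (integrable_bounded mufin (K := `|c ^+ 2|)) => //; exact: measurable_funX.
Qed.

Lemma sq_integrable_lin a b u v : sq_integrable u -> sq_integrable v ->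
  sq_integrable (fun t => a * u t + b * v t).
Proof.
move=> su sv; case: (su) (sv) => um u2 [vm v2]; split.
  by apply: measurable_funD; exact: measurable_funM.
have -> : (fun t => (a * u t + b * v t) ^+ 2) = fun t =>
    (a ^+ 2 * u t ^+ 2 + b ^+ 2 * v t ^+ 2) + (2 * a * b) * (u t * v t).
  by apply/funext => t; ring.
apply: integrable_add => //; last by apply: integrable_scale => //; exact: sq_integrable_mul.
by apply: integrable_add => //; exact: integrable_scale.
Qed.

Lemma sq_integrable_shift u c : sq_integrable u -> sq_integrable (fun t => u t + c).
Proof.
move=> su; have := sq_integrable_lin 1 1 su (sq_integrable_cst c); congr sq_integrable.
by apply/funext => t; rewrite !mul1r.
Qed.

Definition rcov (u v : T -> R) :=
  \int[mu]_t ((u t - \int[mu]_s u s) * (v t - \int[mu]_s v s)).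

Lemma rcovC u v : rcov u v = rcov v u.
Proof. by apply: eq_Rintegral => t _; rewrite mulrC. Qed.

Lemma Rintegral_lin a b u v : mu.-integrable setT (EFin \o u) -> mu.-integrable setT (EFin \o v) ->
  \int[mu]_t (a * u t + b * v t) = a * \int[mu]_t u t + b * \int[mu]_t v t.
Proof.
by move=> iu iv; rewrite RintegralD// ?RintegralZl//; exact: integrable_scale.
Qed.

Lemma rcov_linl a b u v w : sq_integrable u -> sq_integrable v -> sq_integrable w ->
  rcov (fun t => a * u t + b * v t) w = a * rcov u w + b * rcov v w.
Proof.
move=> su sv sw; rewrite /rcov Rintegral_lin; try exact: sq_integrable_integrable.
have sc (z : T -> R) : sq_integrable z -> sq_integrable (fun t => z t - \int[mu]_s z s).
  by move=> sz; exact: sq_integrable_shift.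
have <- := Rintegral_lin a b (sq_integrable_mul (sc _ su) (sc _ sw))
  (sq_integrable_mul (sc _ sv) (sc _ sw)).
by apply: eq_Rintegral => t _; ring.
Qed.

Lemma rcov_linr a b u v w : sq_integrable u -> sq_integrable v -> sq_integrable w ->
  rcov w (fun t => a * u t + b * v t) = a * rcov w u + b * rcov w v.
Proof. by move=> su sv sw; rewrite (rcovC w u) (rcovC w v) rcovC (rcov_linl a b su sv sw). Qed.

Lemma rcov_ge0 u : 0 <= rcov u u.
Proof. by apply: Rintegral_ge0 => t _; rewrite -expr2 sqr_ge0. Qed.

Lemma rcov_eq0 u v : sq_integrable u -> sq_integrable v -> rcov u u = 0 -> rcov v u = 0.
Proof.
move=> su sv u0; apply/eqP/negP => /negP vu0.
(* If the covariance were nonzero, the variance of v + t u would be rcov v v + 2 t rcov v u; this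
   [t] makes it equal to -1. *)
pose t := - (rcov v v + 1) / (2 * rcov v u).
have := rcov_ge0 (fun x => 1 * v x + t * u x).
have sl := sq_integrable_lin 1 t sv su.
rewrite rcov_linl// !rcov_linr// u0 (rcovC u v).
rewrite /t {t sl}; move: (rcov v v) (rcov v u) vu0 => a b b0.
set e := (X in 0 <= X); suff -> : e = -1 by rewrite oppr_ge0 ler10.
by rewrite /e; field.
Qed.

Lemma rcov_sum n (a : 'I_n -> R) (u : 'I_n -> T -> R) w :
  (forall i, sq_integrable (u i)) -> sq_integrable w ->
  rcov (fun t => \sum_i a i * u i t) w = \sum_i a i * rcov (u i) w.
Proof.
move=> su sw.
suff [] : sq_integrable (fun t => \sum_i a i * u i t) /\
  rcov (fun t => \sum_i a i * u i t) w = \sum_i a i * rcov (u i) w by [].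
suff H (r : seq 'I_n) : sq_integrable (fun t => \sum_(i <- r) a i * u i t) /\
    rcov (fun t => \sum_(i <- r) a i * u i t) w = \sum_(i <- r) a i * rcov (u i) w by exact: H.
elim: r => [|i r [IH1 IH2]].
  rewrite big_nil; under eq_fun do rewrite big_nil.
  split; first exact: sq_integrable_cst.
  transitivity (\int[mu]_t (cst 0 t : R)); last by rewrite Rintegral_cst// mul0r.
  apply: eq_Rintegral => t _; rewrite (_ : \int[mu]_s 0 = 0) ?subrr ?mul0r//.
  by rewrite (Rintegral_cst mu measurableT 0) mul0r.
have -> : (fun t => \sum_(j <- i :: r) a j * u j t) =
    fun t => a i * u i t + 1 * \sum_(j <- r) a j * u j t.
  by apply/funext => t; rewrite big_cons mul1r.
split; first exact: sq_integrable_lin.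
by rewrite big_cons rcov_linl// IH2 mul1r.
Qed.

End covariance.

Lemma probability_lty d (T : measurableType d) (R : realType) (P : probability T R) :
  (P setT < +oo)%E.
Proof. by rewrite probability_setT ltry. Qed.

Section gaussian_random_variables.
Context d (T : measurableType d) (R : realType) (P : probability T R).

Let Pfin := probability_lty P.

Lemma gaussian_moments_rv (u : T -> R) : measurable_fun setT u ->
  real_gaussian_measure (pushforward P u) ->
  let m := \int[P]_x u x in let v := \int[P]_x (u x - m) ^+ 2 in
  [/\ 0 <= v, P.-integrable setT (EFin \o (fun x => u x ^+ 2)) &
      forall t c, \int[P]_x cos (t * u x + c) = expR (- (t ^+ 2 * v / 2)) * cos (t * m + c)].
Proof.
move=> mu gu /=.
have mu' : measurable_fun setT (u : T -> measurableTypeR R) by exact: mu.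
have [nu nul] := @law_exists _ _ _ (measurableTypeR R) R P u mu'.
have gnu : real_gaussian_measure nu.
  by move: gu => [m [s gu]]; exists m, s => A mA; rewrite nul// -gu.
have [m [v [v0 i2 em ev ec]]] := real_gaussian_moments gnu.
have [iP2 _] := law_integrable mu' nul (measurable_funX _ (@measurable_id _ _ _)) i2.
have iP := sq_integrable_integrable Pfin (conj mu iP2).
have [_ eP] := @law_Rintegral _ _ _ (measurableTypeR R) R _ _ _ mu' nul id (@measurable_id _ _ _) iP.
have muE : \int[P]_x u x = m by rewrite -eP.
have ic (c : R) : P.-integrable setT (EFin \o cst c).
  by apply: (integrable_bounded Pfin (K := `|c|)) => //.
have vE : \int[P]_x (u x - m) ^+ 2 = v.
  rewrite -ev; apply/esym.
  have i3 : P.-integrable setT (EFin \o (fun x => (u x - m) ^+ 2)).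
    have -> : (fun x => (u x - m) ^+ 2) = fun x => (u x ^+ 2 - (2 * m) * u x) + m ^+ 2.
      by apply/funext => x; ring.
    apply: integrable_add => //; last exact: ic.
    by apply: integrable_sub => //; exact: integrable_scale.
  have m3 : measurable_fun setT (fun x : measurableTypeR R => (x - m) ^+ 2).
    by apply: measurable_funX; exact: measurable_funB.
  by have [_ ->] := law_Rintegral mu' nul m3 i3.
rewrite muE vE; split=> // t c; rewrite -ec.
have mt : measurable_fun setT (fun x : measurableTypeR R => t * x) by exact: measurable_funM.
by rewrite (law_cos mu' nul c Pfin mt).
Qed.

Lemma gaussian_rv_cos (u : T -> R) m v : measurable_fun setT u -> 0 <= v ->
  (forall t c, \int[P]_x cos (t * u x + c) = expR (- (t ^+ 2 * v / 2)) * cos (t * m + c)) ->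
  real_gaussian_measure (pushforward P u).
Proof.
move=> mu v0 cu.
have mu' : measurable_fun setT (u : T -> measurableTypeR R) by exact: mu.
have [nu nul] := @law_exists _ _ _ (measurableTypeR R) R P u mu'.
have nuf : (nu setT < +oo)%E by apply: fin_num_fun_lty; exact: fin_num_measure.
have cnu : cos_gaussian nu m v.
  move=> t c; have mt : measurable_fun setT (fun x : measurableTypeR R => t * x).
    exact: measurable_funM.
  by rewrite (law_cos mu' nul c Pfin mt) cu.
have [m' [s e]] := real_gaussian_cos nuf v0 cnu.
by exists m', s => A mA; rewrite -e//; exact/esym/nul.
Qed.

End gaussian_random_variables.

Section product_probability.
Context d1 d2 (T1 : measurableType d1) (T2 : measurableType d2) (R : realType).
Variables (P1 : probability T1 R) (P2 : probability T2 R).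

Lemma product_Rintegral (f : T1 * T2 -> R) :
  (P1 \x P2)%E.-integrable setT (EFin \o f) ->
  \int[(P1 \x P2)%E]_z f z = fine (\int[P1]_x \int[P2]_y (f (x, y))%:E)%E.
Proof. by move=> fi; rewrite /Rintegral -integral12_prod_meas1. Qed.

(** A free phase makes Fubini's theorem sufficient: the inner integral treats u x + c as the phase,
    and the result is again a cosine in u x. *)
Lemma product_cos (u : T1 -> R) (v : T2 -> R) (a b m n : R) :
  measurable_fun setT u -> measurable_fun setT v ->
  (forall c, \int[P1]_x cos (u x + c) = a * cos (m + c)) ->
  (forall c, \int[P2]_y cos (v y + c) = b * cos (n + c)) ->
  forall c, \int[(P1 \x P2)%E]_z cos (u z.1 + v z.2 + c) = a * b * cos (m + n + c).
Proof.
move=> mu mv cu cv c.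
have mc (d0 : measure_display) (T : measurableType d0) (w : T -> R) e : measurable_fun setT w ->
    measurable_fun setT (fun x => cos (w x + e)).
  move=> mw; apply: (@measurableT_comp _ _ _ _ _ _ (@cos R)).
    by apply: continuous_measurable_fun; exact: continuous_cos.
  exact: measurable_funD.
have ic (d0 : measure_display) (T : measurableType d0) (w : T -> R) e (P : probability T R) :
    measurable_fun setT w -> P.-integrable setT (EFin \o (fun x => cos (w x + e))).
  by move=> mw; apply: (integrable_bounded (probability_lty P) (mc _ _ _ _ mw)) => x; exact: cos_max.
have muv : measurable_fun setT (fun z : T1 * T2 => u z.1 + v z.2).
  by apply: measurable_funD; [exact: (measurableT_comp mu)|exact: (measurableT_comp mv)].
rewrite product_Rintegral; last exact: ic.
have e1 x : (\int[P2]_y (cos (u x + v y + c))%:E = (b * cos (u x + (n + c)))%:E)%E.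
  have := cv (u x + c); rewrite /Rintegral => e.
  rewrite (_ : u x + (n + c) = n + (u x + c)); last by ring.
  rewrite -e fineK.
    by apply: eq_integral => y _; congr (cos _)%:E; ring.
  by apply: integrable_fin_num => //; exact: ic.
under eq_integral do rewrite e1.
have := @RintegralZl _ _ _ P1 setT (fun x => cos (u x + (n + c))) b measurableT (ic _ _ _ _ _ mu).
rewrite cu {1}/Rintegral => ->.
by rewrite addrA; ring.
Qed.

End product_probability.

(** * Integrability of the squared norm *)

Section fernique.
Context {R : realType} {E : normedModType R}.
Hypothesis sE : separable_space E.

Lemma measurable_norm_le (t : R) : measurable ([set x : E | `|x| <= t] : set (borel E)).
Proof.
rewrite -[X in measurable X]setTI.
by apply: measurable_fun_le => //; exact: measurable_norm.
Qed.

Lemma measurable_norm_gt (t : R) : measurable ([set x : E | t < `|x|] : set (borel E)).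
Proof.
rewrite (_ : [set x : E | t < `|x|] = ~` [set x : E | `|x| <= t]).
  by apply: measurableC; exact: measurable_norm_le.
by apply/seteqP; split => x /=; rewrite ltNge => /negP.
Qed.

Lemma measurable_prod_lin (a b : R) :
  measurable_fun setT (fun p : borel E * borel E => a *: (p.1 : E) + b *: (p.2 : E) : borel E).
Proof.
apply: measurable_fun_dual => // f.
have -> : (fun p : borel E * borel E => f (a *: (p.1 : E) + b *: (p.2 : E)) : R) =
    fun p => a * f p.1 + b * f p.2.
  by apply/funext => p; rewrite dualD !dualZ.
apply: measurable_funD; apply: measurable_funM => //.
  exact: (measurableT_comp (measurable_dual f)).
exact: (measurableT_comp (measurable_dual f)).
Qed.

Variable Q : probability (borel E) R.

Let p t := fine (Q [set x : E | t < `|x|]).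

Let pE t : (p t)%:E = Q [set x : E | t < `|x|].
Proof. by rewrite fineK// fin_num_measure//; exact: measurable_norm_gt. Qed.

Let p_itv t : 0 <= p t <= 1.
Proof. by rewrite -!lee_fin pE measure_ge0/=; apply: probability_le1; exact: measurable_norm_gt. Qed.

Let p_nincr s t : s <= t -> p t <= p s.
Proof.
move=> st; rewrite -lee_fin !pE; apply: le_measure; try by apply: mem_set; exact: measurable_norm_gt.
by move=> x /=; exact: le_lt_trans.
Qed.

Let p_cvg0 : p n%:R @[n --> \oo] --> (0 : R).
Proof.
have pI t : p t = \int[Q]_x \1_[set x : E | t < `|x|] x.
  rewrite /Rintegral integral_indic//; last exact: measurable_norm_gt.
  by rewrite setIT.
have := @dominated_cvg_Rintegral _ _ R Q (fun n x => \1_[set x : E | n%:R < `|x|] x) (cst 0) (cst 1).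
rewrite Rintegral_cst// mul0r; under eq_fun do rewrite -pI; apply.
- by move=> n; apply: measurable_indic; exact: measurable_norm_gt.
- by apply: (integrable_bounded (probability_lty Q) (K := 1)) => // x; rewrite normr1.
- by move=> n x; rewrite indicE normr_nat lern1; case: (_ \in _).
- move=> x; apply: cvg_near_cst; near=> n.
  rewrite indicE memNset//= => /ltW; apply/negP; rewrite -ltNge.
  by near: n; exact: nbhs_infty_gtr.
Unshelve. all: by end_near. Qed.

(* The law of (x, y) under Q x Q is invariant under the rational rotation with
   matrix [[3/5, 4/5], [4/5, -3/5]]. *)
Variable q : dual E -> R.
Hypothesis Qcos : forall (f : dual E) c, \int[Q]_x cos (f x + c : R) = expR (- (q f / 2)) * cos c.
Hypothesis qrot : forall f g h k : dual E,
  (forall x, h x = 3 / 5 * f x + 4 / 5 * g x :> R) ->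
  (forall x, k x = 4 / 5 * f x - 3 / 5 * g x :> R) -> q h + q k = q f + q g.

Let QQ := (Q \x Q)%E.

Let rot (z : borel E * borel E) : borel E * borel E :=
  ((3 / 5 : R) *: (z.1 : E) + (4 / 5 : R) *: (z.2 : E),
   (4 / 5 : R) *: (z.1 : E) + (- (3 / 5) : R) *: (z.2 : E)).

Let mrot : measurable_fun setT rot.
Proof. by apply/measurable_fun_pairP; split; exact: measurable_prod_lin. Qed.

Let rot_inv A : measurable A -> QQ (rot @^-1` A) = QQ A.
Proof.
move=> mA; have [nu nul] := law_exists QQ mrot.
transitivity (nu A); first exact/esym/nul.
apply: (measure_eq_cos_prod sE sE) => //.
- exact: probability_lty.
- exact: probability_lty.
move=> f g c.
have mfg (u v : dual E) : measurable_fun setT (fun z : borel E * borel E => u z.1 + v z.2 : R).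
  apply: measurable_funD.
    exact: (measurableT_comp (measurable_dual u)).
  exact: (measurableT_comp (measurable_dual v)).
have Qc (u : dual E) c' : \int[Q]_x cos (u x + c' : R) = expR (- (q u / 2)) * cos (0 + c').
  by rewrite Qcos add0r.
rewrite (law_cos mrot nul c (probability_lty QQ) (mfg f g)).
have [h hE] := dual_lin (3 / 5) (4 / 5) f g.
have [k kE] := dual_lin (4 / 5) (- (3 / 5)) f g.
transitivity (\int[QQ]_z cos (h z.1 + k z.2 + c : R)).
  apply: eq_Rintegral => z _; congr (cos (_ + _)).
  by rewrite /rot /= !dualD !dualZ hE kE; ring.
rewrite !(product_cos (measurable_dual _) (measurable_dual _) (Qc _) (Qc _)) -!expRD.
congr (expR _ * _).
have := qrot hE (fun x => etrans (kE x) _); rewrite -!opprD -!mulrDl => -> //.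
by move=> x; rewrite mulNr.
Qed.

(** The left side is the probability that the rotated pair has first norm at most [s] and second
    norm above [t]. Both original vectors then have norm above t / 2. *)
Let p_rec s t : 0 <= s -> 8 * s <= t -> (1 - p s) * p t <= p (t / 2) ^+ 2.
Proof.
move=> s0 st.
have ms := measurable_norm_le s; have mt := measurable_norm_gt t.
have mt2 := measurable_norm_gt (t / 2).
have e1 : (1 - p s)%:E = Q [set x : E | `|x| <= s].
  rewrite EFinB pE -(probability_setC _ (measurable_norm_gt s)).
  by congr (Q _); apply/seteqP; split => x /=; rewrite leNgt => /negP.
rewrite -lee_fin EFinM e1 pE expr2 EFinM !pE.
rewrite -(product_measure1E Q Q mt2 mt2) -(product_measure1E Q Q ms mt).
have := rot_inv (measurableX ms mt); rewrite /QQ => <-.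
apply: le_measure.
- apply: mem_set; rewrite -[X in measurable X]setTI; apply: mrot => //.
  exact: measurableX.
- by apply: mem_set; exact: measurableX.
move=> [x y] /= []; set u := (X in `|X| <= s); set v := (X in t < `|X|) => us vt.
(* The matrix of [rot] is its own inverse, so the same coefficients express (x, y) through (u,
   v). *)
have xE : x = (3 / 5 : R) *: u + (4 / 5 : R) *: v :> E.
  rewrite /u /v !scalerDr !scalerA addrACA -!scalerDl.
  by rewrite [X in X *: x](_ : _ = 1) ?[X in X *: y](_ : _ = 0) ?scale1r ?scale0r ?addr0//; field.
have yE : y = (4 / 5 : R) *: u + (- (3 / 5) : R) *: v :> E.
  rewrite /u /v !scalerDr !scalerA addrACA -!scalerDl.
  by rewrite [X in X *: x](_ : _ = 0) ?[X in X *: y](_ : _ = 1) ?scale1r ?scale0r ?add0r//; field.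
have nx : 4 / 5 * `|v| - 3 / 5 * `|u| <= `|x : E|.
  have := lerB_normD ((4 / 5 : R) *: v) ((3 / 5 : R) *: u).
  by rewrite (addrC (_ *: v)) -xE !normrZ !ger0_norm.
(* This is the tighter of the two bounds and the source of the constant 8: 3/5 t - 4/5 s is at least
   t / 2 exactly when t is at least 8 s. *)
have ny : 3 / 5 * `|v| - 4 / 5 * `|u| <= `|y : E|.
  have := lerB_normD ((- (3 / 5) : R) *: v) ((4 / 5 : R) *: u).
  by rewrite (addrC (_ *: v)) -yE !normrZ normrN !ger0_norm.
move: (u) (v) us vt nx ny => u' v' us vt nx ny.
split; lra.
Qed.

(** Passing from one dyadic scale to the next multiplies the squared norm by 4 and the tail by at
    most 1/8, so the contributions of the scales form a series of ratio 1/2. *)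
Lemma norm_sqr_integrable_centered :
  Q.-integrable setT (EFin \o (fun x : borel E => `|x : E| ^+ 2)).
Proof.
have cvg_small (e : R) : 0 < e -> exists n : nat, p n%:R < e.
  move=> e0; have /cvgrPdist_lt/(_ _ e0)[n _ /(_ n (leqnn n))] := p_cvg0.
  by rewrite /= sub0r normrN => /(le_lt_trans (ler_norm _)); exists n.
have [n nE] := cvg_small (1 / 2) ltac:(lra).
have [j jE] := cvg_small (1 / 16) ltac:(lra).
(* For t at least [r], the point n serves as [s] in [p_rec] with 1 - p n > 1/2, and t / 2 is at
   least j, where the tail is below 1/16. Hence p t is at most 2 p(t/2)^2, and so at most p(t/2) /
   8. *)
pose r : R := 1 + 8 * n%:R + 2 * j%:R.
have n0 : (0 : R) <= n%:R by [].
have j0 : (0 : R) <= j%:R by [].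
have r1 : 1 <= r by rewrite /r; lra.
have rec t : r <= t -> p t <= p (t / 2) / 8.
  move=> rt; have := p_rec n0 (_ : 8 * n%:R <= t); rewrite /r in rt.
  have jt : j%:R <= t / 2 by lra.
  have := p_nincr jt; have /andP[] := p_itv (t / 2); have /andP[] := p_itv t.
  move=> h1 h2 h3 h4 h5 h6; have {}h6 := h6 ltac:(lra); nra.
have pk k : p (2 ^+ k * r) <= (8^-1) ^+ k.
  elim: k => [|k IH]; first by rewrite !expr0 mul1r; case/andP: (p_itv r).
  have k1 : (1 : R) <= 2 ^+ k.+1 by rewrite exprn_ege1//; lra.
  have rk : r <= 2 ^+ k.+1 * r by rewrite ler_peMl// (le_trans _ r1).
  rewrite (le_trans (rec _ rk))// exprS mulrAC mulrAC (_ : 2 * 2 ^+ k * r / 2 = 2 ^+ k * r).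
    by rewrite [leRHS]exprS mulrC ler_wpM2l// invr_ge0.
  by field.
pose F k (x : borel E) : R := Num.min `|x : E| (2 ^+ k * r) ^+ 2.
have r0 : 0 <= r by rewrite (le_trans _ r1).
have rk0 k : 0 <= 2 ^+ k * r by rewrite mulr_ge0// exprn_ge0.
have F0 k x : 0 <= F k x by rewrite sqr_ge0.
have ndF a b x : (a <= b)%N -> F a x <= F b x.
  move=> ab; rewrite /F lerXn2r ?nnegrE ?le_min ?normr_ge0 ?rk0//.
  rewrite !ge_min lexx /= orbC ler_wpM2r//.
  by rewrite ler_weXn2l//; lra.
have mF k : measurable_fun setT (F k).
  apply: measurable_funX; apply: measurable_minr => //.
  exact: measurable_norm.
have Fb k x : `|F k x| <= (2 ^+ k * r) ^+ 2.
  rewrite ger0_norm// lerXn2r ?nnegrE ?rk0//; last by rewrite ge_min lexx orbT.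
  by rewrite le_min normr_ge0 rk0.
have iF k : Q.-integrable setT (EFin \o F k).
  exact: (integrable_bounded (probability_lty Q) (mF k) (Fb k)).
have i1 t : Q.-integrable setT (EFin \o \1_[set x : E | t < `|x|]).
  apply: (integrable_bounded (probability_lty Q) (K := 1)).
    by apply: measurable_indic; exact: measurable_norm_gt.
  by move=> x; rewrite indicE normr_nat lern1; case: (_ \in _).
have Fs k x : F k.+1 x <= F k x + 4 ^+ k.+1 * r ^+ 2 * \1_[set x : E | 2 ^+ k * r < `|x|] x.
  rewrite indicE /F; have [xk|xk] := leP `|x : E| (2 ^+ k * r).
    rewrite memNset /= ?mulr0 ?addr0; last by rewrite ltNge xk.
    rewrite min_l// (le_trans xk)// exprS -mulrA ler_peMl//; lra.
  rewrite mem_set//= mulr1 -[leLHS]add0r lerD ?sqr_ge0//.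
  have -> : 4 ^+ k.+1 * r ^+ 2 = (2 ^+ k.+1 * r) ^+ 2.
    by rewrite exprMn -exprM mulnC exprM (_ : 2 ^+ 2 = 4 :> R)//; ring.
  by rewrite -[leLHS]ger0_norm; [exact: Fb|exact: F0].
have ic : Q.-integrable setT (EFin \o cst (r ^+ 2)).
  by apply: (integrable_bounded (probability_lty Q) (K := `|r ^+ 2|)).
(* The k-th increment has integral at most 4^(k+1) r^2 8^(-k) = 4 r^2 2^(-k), and these terms add up
   to the stated bound. *)
have intF k : \int[Q]_x F k x <= r ^+ 2 + 8 * r ^+ 2 * (1 - (2^-1) ^+ k).
  elim: k => [|k IH].
    rewrite expr0 subrr mulr0 addr0.
    have := le_Rintegral measurableT (iF 0%N) ic.
    rewrite Rintegral_cst// [X in fine X]probability_setT mulr1; apply => x _.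
    by have := Fb 0%N x; rewrite ger0_norm// expr0 mul1r.
  have := le_Rintegral measurableT (iF k.+1) (integrable_add measurableT (iF k)
    (integrable_scale measurableT (4 ^+ k.+1 * r ^+ 2) (i1 (2 ^+ k * r)))) (fun x _ => Fs k x).
  rewrite RintegralD//; last exact: integrable_scale.
  rewrite RintegralZl//.
  have -> : \int[Q]_x \1_[set x : E | 2 ^+ k * r < `|x|] x = p (2 ^+ k * r).
    by rewrite /Rintegral integral_indic ?setIT//; exact: measurable_norm_gt.
  move=> h; rewrite (le_trans h)// (le_trans (lerD IH (ler_wpM2l _ (pk k))))//.
    by rewrite mulr_ge0 ?sqr_ge0// exprn_ge0.
  have -> : 4 ^+ k.+1 * r ^+ 2 * 8^-1 ^+ k = 4 * r ^+ 2 * (2^-1) ^+ k :> R.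
    by rewrite exprS (_ : 2^-1 = 4 * 8^-1 :> R) ?exprMn; [ring|field].
  by rewrite [2^-1 ^+ k.+1]exprS; move: (2^-1 ^+ k) => z; lra.
apply/integrableP; split.
  by apply/measurable_EFinP; apply: measurable_funX; exact: measurable_norm.
have -> : (\int[Q]_x `|(EFin \o (fun x : borel E => (`|x : E| ^+ 2)%R)) x| =
    lim (\int[Q]_x (F k x)%:E @[k --> \oo]))%E.
  rewrite -monotone_convergence//.
  - apply: eq_integral => x _; apply/esym/cvg_lim => //=.
    rewrite ger0_norm ?sqr_ge0//; apply: cvg_near_cst; near=> k.
    rewrite /F min_l//.
    have xk : `|x : E| <= k%:R by near: k; exact: nbhs_infty_ger.
    rewrite (le_trans xk)// (le_trans _ (ler_wpM2l (exprn_ge0 _ _) r1))// mulr1.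
    by rewrite -natrX ler_nat ltnW// ltn_expl.
  - by move=> k; exact/measurable_EFinP.
  - by move=> k x _; rewrite lee_fin.
  - by move=> x _ a b ab; rewrite lee_fin; exact: ndF.
apply: (@le_lt_trans _ _ (9 * r ^+ 2)%:E); last exact: ltry.
apply: lime_le.
  apply: ereal_nondecreasing_is_cvgn => a b ab; apply: ge0_le_integral => //.
  - by move=> x _; rewrite lee_fin.
  - exact/measurable_EFinP.
  - exact/measurable_EFinP.
  - by move=> x _; rewrite lee_fin; exact: ndF.
apply: nearW => k; rewrite -[leLHS]fineK; last exact: (integrable_fin_num measurableT (iF k)).
rewrite lee_fin (le_trans (intF k))//.
have : 0 <= (2^-1 : R) ^+ k by rewrite exprn_ge0// invr_ge0.
have := sqr_ge0 r; nra.
Unshelve. all: by end_near. Qed.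

End fernique.

Section gaussian_norm.
Context d (T : measurableType d) (R : realType) (P : probability T R).
Context (E : normedModType R) (X : T -> E).
Hypotheses (sE : separable_space E) (gX : gaussian_rv P X).

Let mX : measurable_fun setT (X : T -> borel E). Proof. by case: gX. Qed.

Let mfX (f : dual E) : measurable_fun setT (fun t => f (X t) : R).
Proof. exact: (measurableT_comp (measurable_dual f) mX). Qed.

Let m (f : dual E) := \int[P]_t (f (X t) : R).
Let v (f : dual E) := \int[P]_t ((f (X t) : R) - m f) ^+ 2.

Let gm (f : dual E) : [/\ 0 <= v f, P.-integrable setT (EFin \o (fun t => (f (X t) : R) ^+ 2)) &
  forall t c, \int[P]_x cos (t * (f (X x) : R) + c) = expR (- (t ^+ 2 * v f / 2)) * cos (t * m f + c)].
Proof. by apply: (gaussian_moments_rv (mfX f)); case: gX => _; exact. Qed.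

Let ifX (f : dual E) : P.-integrable setT (EFin \o (fun t => f (X t) : R)).
Proof.
apply: (sq_integrable_integrable (probability_lty P)).
by split; [exact: mfX|case: (gm f)].
Qed.

Let if2 (f : dual E) : P.-integrable setT (EFin \o (fun t => ((f (X t) : R) - m f) ^+ 2)).
Proof.
have -> : (fun t => ((f (X t) : R) - m f) ^+ 2) =
    fun t => ((f (X t) : R) ^+ 2 - (2 * m f) * f (X t)) + m f ^+ 2.
  by apply/funext => t; ring.
apply: integrable_add => //.
  by apply: integrable_sub => //; [case: (gm f)|exact: integrable_scale].
by apply: (integrable_bounded (probability_lty P) (K := `|m f ^+ 2|)).
Qed.

(** The squares of 3/5 and 4/5 add up to 1 and the mixed terms cancel, already under the
    integral. *)
Let vrot (f g h k : dual E) :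
  (forall x, h x = 3 / 5 * f x + 4 / 5 * g x :> R) ->
  (forall x, k x = 4 / 5 * f x - 3 / 5 * g x :> R) -> v h + v k = v f + v g.
Proof.
move=> hE kE.
have mh : m h = 3 / 5 * m f + 4 / 5 * m g.
  rewrite /m -!RintegralZl// -RintegralD//; try exact: integrable_scale.
  by apply: eq_Rintegral => t _; rewrite hE.
have mk : m k = 4 / 5 * m f - 3 / 5 * m g.
  rewrite /m -!RintegralZl// -RintegralB//; try exact: integrable_scale.
  by apply: eq_Rintegral => t _; rewrite kE.
rewrite /v -(RintegralD measurableT (if2 h) (if2 k)) -(RintegralD measurableT (if2 f) (if2 g)).
apply: eq_Rintegral => t _; rewrite hE kE mh mk.
by move: (m f) (m g) (f (X t) : R) (g (X t) : R) => a b x y; field.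
Qed.

(** Symmetrization: the difference of two independent copies is centred, with doubled variances, so
    the preceding estimate applies to its law [Q']. *)
Lemma gaussian_norm_sqr_integrable : P.-integrable setT (EFin \o (fun t => `|X t| ^+ 2)).
Proof.
have [Q lQ] := law_exists P mX.
have mnorm2 : measurable_fun setT (fun x : borel E => `|x : E| ^+ 2).
  by apply: measurable_funX; exact: measurable_norm.
pose dif (z : borel E * borel E) : borel E := (1 : R) *: (z.1 : E) + (-1 : R) *: (z.2 : E).
have mdif : measurable_fun setT dif by exact: measurable_prod_lin.
have Qc (f : dual E) t c : \int[Q]_x cos (t * (f x : R) + c) =
    expR (- (t ^+ 2 * v f / 2)) * cos (t * m f + c).
  have [_ _ <-] := gm f.
  have mt : measurable_fun setT (fun x : borel E => t * (f x : R)).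
    by apply: measurable_funM => //; exact: measurable_dual.
  by rewrite (law_cos mX lQ c (probability_lty P) mt).
have [Q' lQ'] := law_exists (Q \x Q)%E mdif.
have Q'cos (f : dual E) c : \int[Q']_x cos (f x + c : R) = expR (- ((2 * v f) / 2)) * cos c.
  rewrite (law_cos mdif lQ' c (probability_lty _) (measurable_dual f)).
  have mt (t : R) : measurable_fun setT (fun x : borel E => t * (f x : R)).
    by apply: measurable_funM => //; exact: measurable_dual.
  have := product_cos (mt 1) (mt (-1)) (Qc f 1) (Qc f (-1)) c.
  have -> : 1 * m f + -1 * m f + c = c by ring.
  rewrite -expRD (_ : - (1 ^+ 2 * v f / 2) + - ((-1) ^+ 2 * v f / 2) = - ((2 * v f) / 2)); last by field.
  move=> <-; apply: eq_Rintegral => z _; congr (cos (_ + _)).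
  by rewrite /dif dualD !dualZ.
have qrot (f g h k : dual E) :
    (forall x, h x = 3 / 5 * f x + 4 / 5 * g x :> R) ->
    (forall x, k x = 4 / 5 * f x - 3 / 5 * g x :> R) -> 2 * v h + 2 * v k = 2 * v f + 2 * v g.
  by move=> hE kE; rewrite -(mulrDr 2 (v h)) -(mulrDr 2 (v f)) (vrot hE kE).
have iQ' := norm_sqr_integrable_centered sE Q'cos qrot.
have [iQQ _] := law_integrable mdif lQ' mnorm2 iQ'.
(* By Fubini the squared distance to almost every point is integrable. One such point is enough,
   since |y|^2 is at most 2 |x0|^2 + 2 |x0 - y|^2. *)
have [x0 ix0] : exists x0 : borel E, Q.-integrable setT
    (fun y : borel E => (EFin \o (fun z => `|dif z : E| ^+ 2)) (x0, y)).
  have Q0 : (0 < Q setT)%E by rewrite probability_setT lte01.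
  exact: (@filter_ex _ _ (ae_properfilter_algebraOfSetsType Q0) _ (ae_integrable1 iQQ)).
have ix1 : Q.-integrable setT (EFin \o (fun y : borel E => `|(x0 : E) - (y : E)| ^+ 2)).
  by move: ix0; congr (_.-integrable _ _); apply/funext => y /=;
    rewrite /dif /= scale1r scaleN1r.
have iQ : Q.-integrable setT (EFin \o (fun x : borel E => `|x : E| ^+ 2)).
  have ic : Q.-integrable setT (EFin \o cst (2 * `|x0 : E| ^+ 2)).
    by apply: (integrable_bounded (probability_lty Q) (K := `|2 * `|x0 : E| ^+ 2|)).
  apply: (le_integrable _ _ _ (integrable_add measurableT ic (integrable_scale measurableT 2 ix1))) => //.
    exact/measurable_EFinP.
  move=> y _; rewrite lee_fin ger0_norm ?sqr_ge0//= ger0_norm; last first.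
    by rewrite addr_ge0// mulr_ge0// sqr_ge0.
  have := ler_normB (x0 : E) ((x0 : E) - (y : E)); rewrite opprB addrC subrK.
  move: `|x0 : E| `|(x0 : E) - (y : E)| `|y : E| (normr_ge0 (y : E)) => a b c c0 abc.
  have := sqr_ge0 (a - b); nra.
by have [] := law_integrable mX lQ mnorm2 iQ.
Qed.

End gaussian_norm.

(** * Pseudo-inverses *)

Section moore_penrose.
Context {R : realFieldType}.

Lemma gram_unitmx m n (M : 'M[R]_(m, n)) : row_free M -> M *m M^T \in unitmx.
Proof.
move=> fM; rewrite -row_free_unit; apply: inj_row_free => v vM.
have : v *m M *m (v *m M)^T = 0 by rewrite trmx_mul !mulmxA -(mulmxA v) vM mul0mx.
move=> vM0; apply: (row_free_inj fM); rewrite mul0mx.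
move: (v *m M) vM0 => w /matrixP/(_ 0 0); rewrite !mxE => /eqP.
rewrite psumr_eq0 => [/allP h|i _]; last by rewrite mxE -expr2 sqr_ge0.
apply/rowP => i; have := h i.
by rewrite mem_index_enum /= !mxE mulf_eq0 orbb => /(_ isT)/eqP.
Qed.

(* With S = C *m U a full rank factorization,
   S^+ = U^T (U U^T)^-1 (C^T C)^-1 C^T. *)
Lemma moore_penrose_exists m n (S : 'M[R]_(m, n)) : exists B : 'M[R]_(n, m),
  [/\ S *m B *m S = S, B *m S *m B = B, (S *m B)^T = S *m B & (B *m S)^T = B *m S].
Proof.
have [k [C [U [-> uU uC]]]] : exists k (C : 'M[R]_(m, k)) (U : 'M[R]_(k, n)),
    [/\ S = C *m U, U *m U^T \in unitmx & C^T *m C \in unitmx].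
  exists (\rank S), (col_base S), (row_base S); split.
  - by rewrite mulmx_base.
  - by apply: gram_unitmx; exact: row_base_free.
  - rewrite -{2}(trmxK (col_base S)); apply: gram_unitmx.
    by rewrite /row_free mxrank_tr; exact: col_base_full.
pose V := invmx (U *m U^T); pose D := invmx (C^T *m C).
have VU : U *m U^T *m V = 1%:M by rewrite mulmxV.
have DC : D *m (C^T *m C) = 1%:M by rewrite mulVmx.
have SB : C *m U *m (U^T *m V *m (D *m C^T)) = C *m D *m C^T.
  by rewrite !mulmxA -(mulmxA C U) -(mulmxA C (U *m _)) VU mulmx1.
have BS : U^T *m V *m (D *m C^T) *m (C *m U) = U^T *m V *m U.
  by rewrite !mulmxA -(mulmxA _ C^T C) -(mulmxA _ D) DC mulmx1.
exists (U^T *m V *m (D *m C^T)); split.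
- by rewrite SB !mulmxA -(mulmxA _ C^T C) -(mulmxA C D) DC mulmx1.
- by rewrite BS !mulmxA -(mulmxA _ U U^T) -(mulmxA _ (U *m U^T)) VU mulmx1.
- by rewrite SB !trmx_mul trmx_inv trmx_mul !trmxK mulmxA.
- by rewrite BS !trmx_mul trmx_inv trmx_mul !trmxK mulmxA.
Qed.

End moore_penrose.

Section row_space.
Context {R : realType} (n : nat).
Notation Rn := 'rV[R]_n.

Lemma normr_coord (v : Rn) i : `|v 0 i| <= `|v|.
Proof.
rewrite [leRHS]/Num.norm /= mx_normrE.
exact: (@le_bigmax _ _ _ 0 (fun ij : 'I_1 * 'I_n => `|v ij.1 ij.2|) (0, i)).
Qed.

Lemma dual_of_row (w : Rn) : exists f : dual Rn, forall v, f v = euclid_dot w v :> R.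
Proof.
apply: (@dual_of_bound _ _ _ (\sum_i `|w 0 i|)) => [a x y|x].
  rewrite /euclid_dot mulr_sumr -big_split; apply: eq_bigr => i _ /=.
  by rewrite !mxE; ring.
rewrite /euclid_dot mulr_suml (le_trans (ler_norm_sum _ _ _))//.
by apply: ler_sum => i _; rewrite normrM ler_wpM2l// normr_coord.
Qed.

Definition dual_row (f : dual Rn) : Rn := \row_i (f (delta_mx 0 i) : R).

Lemma dualE (f : dual Rn) v : f v = euclid_dot (dual_row f) v :> R.
Proof.
rewrite {1}[v]row_sum_delta raddf_sum; apply: eq_bigr => i _.
by rewrite mxE mulrC; exact: dualZ.
Qed.

Lemma euclid_dotE (u v : Rn) : euclid_dot u v = (u *m v^T) 0 0.
Proof. by rewrite mxE; apply: eq_bigr => i _; rewrite mxE. Qed.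

Lemma euclid_dot_delta (v : Rn) i : euclid_dot v (delta_mx 0 i) = v 0 i.
Proof.
rewrite /euclid_dot (bigD1 i)//= mxE !eqxx mulr1 big1 ?addr0// => j ji.
by rewrite mxE eqxx (negbTE ji) mulr0.
Qed.

Lemma euclid_dot_eq0 (v : Rn) : euclid_dot v v = 0 -> v = 0.
Proof.
move=> /eqP; rewrite psumr_eq0 => [/allP h|i _]; last by rewrite -expr2 sqr_ge0.
apply/rowP => i; have := h i; rewrite mem_index_enum mulf_eq0 orbb mxE.
by move=> /(_ isT)/eqP.
Qed.

Lemma is_pinv_pinv (A : dual Rn -> Rn) (S : 'M[R]_n) :
  (forall f, A f = dual_row f *m S) -> is_pinv A (Defs.pinv A).
Proof.
move=> AS; have [B [SBS BSB SBt BSt]] := moore_penrose_exists S.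
have [D DE] := choice dual_of_row.
have rD w : dual_row (D w) = w.
  by apply/rowP => i; rewrite mxE DE euclid_dot_delta.
suff : is_pinv A (fun v => D (v *m B)) by move=> h; exact: (xgetI _ h).
have dd f g : dual_dot f g = euclid_dot (dual_row f) (dual_row g).
  by apply: eq_bigr => i _; rewrite !mxE.
split.
- by move=> f; rewrite !AS rD -!mulmxA (mulmxA S) SBS.
- by move=> v; rewrite AS rD -!mulmxA (mulmxA B) BSB.
(* Rows are multiplied from the right, so A after B is the matrix B S: the third equation uses the
   symmetry of B S, the fourth that of S B. *)
- move=> u v; rewrite !AS !rD !euclid_dotE -(mulmxA v) trmx_mul BSt.
  by rewrite !mulmxA.
- move=> f g; rewrite !dd !rD !AS !euclid_dotE -(mulmxA (dual_row g)) trmx_mul SBt.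
  by rewrite !mulmxA.
Qed.

Lemma separable_row : separable_space Rn.
Proof.
exists (range (map_mx ratr : 'rV[rat]_n -> Rn)).
  by apply: (sub_countable (card_image_le _ _)); exact: countableP.
move=> U [x Ux] oU; have /nbhs_ballP[e /= e0 eU] := open_nbhs_nbhs (conj oU Ux).
have q i : exists q : rat, x 0 i < ratr q < x 0 i + e.
  have xe : x 0 i < x 0 i + e by rewrite ltrDl.
  by have [q] := rat_in_itvoo xe; rewrite in_itv/=; exists q.
have [r rE] := choice q.
exists (map_mx ratr (\row_i r i)); split; last by exists (\row_i r i).
apply: eU; split => // i j; rewrite !mxE ord1; have /andP[h1 h2] := rE j.
by rewrite -ball_normE /= ltr_norml; apply/andP; split; lra.
Qed.

End row_space.

(* Completeness of matrix spaces is registered over R^o only, and not found over R. *)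
HB.instance Definition _ (R : realType) m n := Complete.copy 'M[R]_(m, n) 'M[R^o]_(m, n).

(** * Vector covariances tested by functionals *)

Section covariance_shift.
Context d (T : measurableType d) (R : realType) (P : probability T R).

Lemma Rintegral_shift (u : T -> R) c : P.-integrable setT (EFin \o u) ->
  \int[P]_t (u t + c) = \int[P]_t u t + c.
Proof.
move=> iu; rewrite RintegralD//.
  by rewrite Rintegral_cst// [X in fine X]probability_setT mulr1.
by apply: (integrable_bounded (probability_lty P) (K := `|c|)).
Qed.

Lemma rcov_shift (u v : T -> R) a b : P.-integrable setT (EFin \o u) ->
  P.-integrable setT (EFin \o v) ->
  rcov P (fun t => u t + a) (fun t => v t + b) = rcov P u v.
Proof.
move=> iu iv; rewrite /rcov !Rintegral_shift//.
by apply: eq_Rintegral => t _; ring.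
Qed.

End covariance_shift.

Section bochner_covariance.
Context d (T : measurableType d) (R : realType) (mu : {measure set T -> \bar R}).
Hypothesis mufin : (mu setT < +oo)%E.

Definition norm_sq_integrable (E : normedModType R) (X : T -> E) :=
  borel_fun setT X /\ sq_integrable mu (fun t => `|X t|).

Lemma norm_sq_integrable_dual (E : normedModType R) (X : T -> E) (f : dual E) :
  norm_sq_integrable X -> sq_integrable mu (fun t => f (X t) : R).
Proof.
move=> [mX [_ X2]]; have mf := measurable_fun_dual_comp f mX; split => //.
have [C C0 fC] := dual_bound f.
apply: (le_integrable _ _ _ (integrable_scale measurableT (C ^+ 2) X2)) => //.
  by apply/measurable_EFinP; exact: measurable_funX.
move=> t _; rewrite lee_fin [leLHS]ger0_norm ?sqr_ge0// [leRHS]ger0_norm; last first.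
  by rewrite mulr_ge0// sqr_ge0.
rewrite -exprMn -(real_normK (num_real (f _))).
by rewrite lerXn2r ?nnegrE ?mulr_ge0.
Qed.

Context (E : completeNormedModType R) (X : T -> E).
Hypotheses (sE : separable_space E) (iX : norm_sq_integrable X).

Lemma dual_expect (f : dual E) : f (expect mu X) = \int[mu]_t f (X t) :> R.
Proof.
case: iX => mX sX.
by have [_ ->] := bochner_integralP sE mufin measurableT mX (sq_integrable_integrable mufin sX).
Qed.

End bochner_covariance.

Section bochner_cross_cov.
Context d (T : measurableType d) (R : realType) (mu : {measure set T -> \bar R}).
Hypothesis mufin : (mu setT < +oo)%E.
Context (E F : completeNormedModType R) (X : T -> E) (Y : T -> F).
Hypotheses (sE : separable_space E) (sF : separable_space F).
Hypotheses (iX : norm_sq_integrable mu X) (iY : norm_sq_integrable mu Y).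

(** Together with [dual_separates], this reduces identities between covariance operators to
    identities between real covariances. *)
Lemma dual_cross_cov (f : dual E) (g : dual F) :
  f (cross_cov mu X Y g) = rcov mu (fun t => g (Y t) : R) (fun t => f (X t) : R) :> R.
Proof.
case: (iX) (iY) => mX sX [mY sY].
have sgY := sq_integrable_shift mufin (- \int[mu]_t (g (Y t) : R)) (norm_sq_integrable_dual g iY).
have gE t : g (Y t - expect mu Y) = (g (Y t) : R) - \int[mu]_t (g (Y t) : R) :> R.
  by rewrite dualB (dual_expect mufin sF iY).
have mXc : borel_fun setT (fun t => X t - expect mu X).
  by apply: borel_funB => //; exact: measurable_cst.
have sXc : sq_integrable mu (fun t => `|X t - expect mu X|).
  split; first exact: measurable_fun_norm.
  case: sX => _ sX2; have [_ sc] := sq_integrable_cst mufin `|expect mu X|.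
  apply: (le_integrable _ _ _ (integrable_add measurableT
    (integrable_scale measurableT 2 sX2) (integrable_scale measurableT 2 sc))) => //.
    by apply/measurable_EFinP; apply: measurable_funX; exact: measurable_fun_norm.
  move=> t _; rewrite lee_fin [leLHS]ger0_norm ?sqr_ge0// [leRHS]ger0_norm; last first.
    by rewrite addr_ge0// mulr_ge0// sqr_ge0.
  have := ler_normB (X t) (expect mu X); rewrite /=.
  move: `|X t| `|expect mu X| `|X t - expect mu X| (normr_ge0 (X t - expect mu X)) => a b c c0 cab.
  have := sqr_ge0 (a - b); nra.
pose h t := (g (Y t - expect mu Y) : R) *: (X t - expect mu X).
have mh : borel_fun setT h.
  apply: measurable_fun_dual => // k.
  have -> : (fun t => k (h t) : R) =
      fun t => ((g (Y t) : R) - \int[mu]_t (g (Y t) : R)) * k (X t - expect mu X).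
    by apply/funext => t; rewrite /h dualZ gE.
  apply: measurable_funM; first by case: sgY.
  exact: measurable_fun_dual_comp.
have ih : mu.-integrable setT (EFin \o (fun t => `|h t|)).
  have -> : (fun t => `|h t|) =
      fun t => `|((g (Y t) : R) - \int[mu]_t (g (Y t) : R)) * `|X t - expect mu X| |.
    by apply/funext => t; rewrite /h normrZ normrM normr_id gE.
  exact: (integrable_abse (sq_integrable_mul sgY sXc)).
have [_ e] := bochner_integralP sE mufin measurableT mh ih.
rewrite /cross_cov e; apply: eq_Rintegral => t _.
by rewrite /h dualZ gE dualB (dual_expect mufin sE iX).
Qed.

End bochner_cross_cov.

Lemma gaussian_norm_sq_integrable d (T : measurableType d) (R : realType) (P : probability T R)
  (E : normedModType R) (X : T -> E) : separable_space E -> gaussian_rv P X ->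
  norm_sq_integrable P X.
Proof.
move=> sE gX; have [mX _] := gX; split => //; split; first exact: measurable_fun_norm.
exact: gaussian_norm_sqr_integrable.
Qed.

(** * Regression and conditioning *)

Lemma dual_pair (R : realType) (E F : normedModType R) (f : dual E) (g : dual F) :
  exists h : dual (E * F)%type, forall p, h p = f p.1 + g p.2 :> R.
Proof.
have [C C0 fC] := dual_bound f; have [D D0 gD] := dual_bound g.
apply: (@dual_of_bound _ _ _ (C + D)) => [a p q|p].
  by rewrite /= !dualD !dualZ mulrDr addrACA.
rewrite (le_trans (ler_normD _ _))// mulrDl lerD//.
  by rewrite (le_trans (fC _))// ler_wpM2l// prod_normE le_max lexx.
by rewrite (le_trans (gD _))// ler_wpM2l// prod_normE le_max lexx orbT.
Qed.

Section pinv_symmetric.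
Context (R : realType) (n : nat).
Notation Rn := 'rV[R]_n.
Variables (A : dual Rn -> Rn) (B : Rn -> dual Rn).
Hypotheses (Asym : forall f g : dual Rn, f (A g) = g (A f) :> R) (AB : is_pinv A B).

(* u - A B u is orthogonal to the range of A, so as a functional it annihilates
   its own image under A, hence also u. *)
Lemma pinv_range (u : Rn) :
  (forall g : dual Rn, g (A g) = 0 :> R -> g u = 0 :> R) -> A (B u) = u.
Proof.
move=> Au; case: AB => ABA _ ABself _.
have [g gE] := dual_of_row (u - A (B u)).
have dotC (v w : Rn) : euclid_dot v w = euclid_dot w v.
  by apply: eq_bigr => i _; rewrite mulrC.
have dotB (v w z : Rn) : euclid_dot (v - w) z = euclid_dot v z - euclid_dot w z.
  by rewrite /euclid_dot -sumrB; apply: eq_bigr => i _; rewrite !mxE mulrBl.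
have gA h : g (A h) = 0 :> R by rewrite gE dotB ABself ABA subrr.
have gu : g u = 0 :> R by apply: Au; exact: gA.
have : euclid_dot (u - A (B u)) (u - A (B u)) = 0.
  by rewrite -gE dualB gu gA subrr.
by move=> /euclid_dot_eq0/eqP; rewrite subr_eq0 => /eqP.
Qed.

Lemma pinv_dual (u : Rn) : A (B u) = u ->
  exists2 l : dual Rn, (forall v, l v = B v u :> R) & A l = u.
Proof.
move=> ABu; case: AB => ABA _ ABself _.
have [l lE] := dual_of_row (A (B (dual_row (B u)))).
have lB v : l v = B v u :> R by rewrite lE ABself -[in RHS]ABu Asym dualE.
exists l => //; apply: dual_separates => g.
by rewrite Asym lB -[in LHS]ABu Asym ABA Asym ABu.
Qed.

End pinv_symmetric.

Section joint_gaussian.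
Context d (Omega : measurableType d) (R : realType) (P : probability Omega R).
Context (E F : normedModType R) (X : Omega -> E) (Y : Omega -> F).
Hypotheses (mX : borel_fun setT X) (mY : borel_fun setT Y).
Hypothesis gXY : jointly_gaussian P X Y.

Lemma joint_gaussian_dual (f : dual E) (g : dual F) :
  real_gaussian_measure (pushforward P (fun t => f (X t) + g (Y t) : R)).
Proof.
have [h hE] := dual_pair f g; case: gXY => _ /(_ h); congr real_gaussian_measure.
by congr (pushforward P _); apply/funext => t /=; rewrite hE.
Qed.

Lemma joint_gaussian_fst : gaussian_rv P X.
Proof.
split => // f; have := joint_gaussian_dual f (dual0 F); congr real_gaussian_measure.
by congr (pushforward P _); apply/funext => t /=; rewrite addr0.
Qed.

Lemma joint_gaussian_snd : gaussian_rv P Y.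
Proof.
split => // g; have := joint_gaussian_dual (dual0 E) g; congr real_gaussian_measure.
by congr (pushforward P _); apply/funext => t /=; rewrite add0r.
Qed.

End joint_gaussian.

(* The means and covariance operators are abstracted into variables, to keep
   conversion from unfolding the integrals behind them. *)
Section conditioning.
Context d (Omega : measurableType d) (R : realType) (P : probability Omega R).
Context (E : normedModType R) (n : nat).
Notation Rn := 'rV[R]_n.
Context (X : Omega -> E) (Y : Omega -> Rn).
Hypotheses (sE : separable_space E) (mX : borel_fun setT X) (mY : borel_fun setT Y).
Hypothesis gXY : jointly_gaussian P X Y.
Variables (EX : E) (EY : Rn) (A : dual Rn -> Rn) (B : Rn -> dual Rn).
Variables (cXY : dual Rn -> E) (cYX : dual E -> Rn).
Hypothesis mean_X : forall f : dual E, \int[P]_t f (X t) = f EX :> R.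
Hypothesis mean_Y : forall g : dual Rn, \int[P]_t g (Y t) = g EY :> R.
Hypothesis AE : forall f g : dual Rn,
  f (A g) = rcov P (fun t => g (Y t) : R) (fun t => f (Y t) : R) :> R.
Hypothesis cXYE : forall (f : dual E) (g : dual Rn),
  f (cXY g) = rcov P (fun t => g (Y t) : R) (fun t => f (X t) : R) :> R.
Hypothesis cYXE : forall (f : dual E) (g : dual Rn),
  g (cYX f) = rcov P (fun t => f (X t) : R) (fun t => g (Y t) : R) :> R.
Hypothesis BE : B = Defs.pinv A.

Let Pf := probability_lty P.
Let gX : gaussian_rv P X := joint_gaussian_fst mX gXY.
Let gY : gaussian_rv P Y := joint_gaussian_snd mY gXY.
Let iX : norm_sq_integrable P X := gaussian_norm_sq_integrable sE gX.
Let iY : norm_sq_integrable P Y := gaussian_norm_sq_integrable (separable_row n) gY.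

Let fX (f : dual E) t : R := f (X t).
Let fY (g : dual Rn) t : R := g (Y t).

Let sX f : sq_integrable P (fX f). Proof. exact: norm_sq_integrable_dual. Qed.
Let sY g : sq_integrable P (fY g). Proof. exact: norm_sq_integrable_dual. Qed.
Let intX f : P.-integrable setT (EFin \o fX f). Proof. exact: (sq_integrable_integrable Pf (sX f)). Qed.
Let intY g : P.-integrable setT (EFin \o fY g). Proof. exact: (sq_integrable_integrable Pf (sY g)). Qed.

Let Asym (f g : dual Rn) : f (A g) = g (A f) :> R.
Proof. by rewrite !AE rcovC. Qed.

Let AB : is_pinv A B.
Proof.
have [D DE] := choice (@dual_of_row R n).
pose e i := D (delta_mx 0 i).
have eE i v : e i v = v 0 i :> R.
  rewrite DE -[RHS]euclid_dot_delta; apply: eq_bigr => j _.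
  by rewrite mulrC.
rewrite BE; apply: (@is_pinv_pinv _ _ _ (\matrix_(i, j) rcov P (fY (e i)) (fY (e j)))) => f.
apply/rowP => j; rewrite -eE AE mxE -/(fY _) -/(fY _).
have -> : fY f = fun t => \sum_i dual_row f 0 i * fY (e i) t.
  by apply/funext => t; rewrite /fY dualE; apply: eq_bigr => i _; rewrite eE.
rewrite rcov_sum//; apply: eq_bigr => i _; congr (_ * _).
by rewrite mxE.
Qed.

Let AB_cYX (f : dual E) : A (B (cYX f)) = cYX f.
Proof.
apply: (pinv_range AB) => g; rewrite AE cYXE => gg.
exact: (rcov_eq0 Pf (sY g) (sX f) gg).
Qed.

Definition regression (v : Rn) : E := cXY (B v).
Notation L := regression.

Let LE (f : dual E) v : f (L v) = B v (cYX f) :> R.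
Proof. by rewrite cXYE cYXE rcovC. Qed.

(** The functional l is the composition of f with L, and A l = cov(Y,X) f is the normal equation of
    the regression of f(X) on Y. *)
Let ell_exists (f : dual E) :
  exists l : dual Rn, (forall v, l v = f (L v) :> R) /\ A l = cYX f.
Proof.
have [l lB Al] := pinv_dual Asym AB (AB_cYX f).
by exists l; split => // v; rewrite LE lB.
Qed.

Let ell (f : dual E) : dual Rn := projT1 (cid (ell_exists f)).

Let ellE f v : ell f v = f (L v) :> R.
Proof. by rewrite /ell; case: cid => l []. Qed.

Let A_ell f : A (ell f) = cYX f.
Proof. by rewrite /ell; case: cid => l []. Qed.

Lemma measurable_regression : measurable_fun setT (L : borel Rn -> borel E).
Proof.
apply: measurable_fun_dual => // f.
have -> : (fun v : borel Rn => f (L v) : R) = fun v => ell f v.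
  by apply/funext => v; rewrite ellE.
exact: measurable_dual.
Qed.

(** The mean of X is left in the residual, so that X = W + L(Y - EY) holds without a further
    constant. *)
Definition residual t : E := X t - L (Y t - EY).
Notation W := residual.

Let WE (f : dual E) t : f (W t) = (1 * fX f t + (-1) * fY (ell f) t) + ell f EY :> R.
Proof. by rewrite /W dualB -ellE dualB /fX /fY; ring. Qed.

Let fW (f : dual E) t : R := f (W t).

Let sW f : sq_integrable P (fW f).
Proof.
have -> : fW f = fun t => (1 * fX f t + (-1) * fY (ell f) t) + ell f EY.
  by apply/funext => t; rewrite /fW WE.
by apply: sq_integrable_shift => //; exact: sq_integrable_lin.
Qed.

Let mean_W f : \int[P]_t fW f t = f EX :> R.
Proof.
transitivity (\int[P]_t ((1 * fX f t + (-1) * fY (ell f) t) + ell f EY)).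
  by apply: eq_Rintegral => t _; rewrite /fW WE.
rewrite Rintegral_shift; last first.
  exact: (sq_integrable_integrable Pf (sq_integrable_lin 1 (-1) (sX f) (sY _))).
by rewrite Rintegral_lin// mean_X mean_Y; ring.
Qed.

Let rcov_WE f v : sq_integrable P v ->
  rcov P (fW f) v = rcov P (fX f) v - rcov P (fY (ell f)) v.
Proof.
move=> sv; rewrite -[LHS](rcov_shift (- ell f EY) 0); try exact: sq_integrable_integrable.
have -> : (fun t => fW f t + - ell f EY) = fun t => 1 * fX f t + (-1) * fY (ell f) t.
  by apply/funext => t; rewrite /fW WE; ring.
have -> : (fun t => v t + 0) = v by apply/funext => t; rewrite addr0.
by rewrite rcov_linl// mul1r mulN1r.
Qed.

(** Orthogonality of the residual, which is the normal equation [A_ell]. *)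
Let rcov_WY f g : rcov P (fW f) (fY g) = 0.
Proof. by rewrite rcov_WE// -(AE g (ell f)) A_ell cYXE subrr. Qed.

Let rcov_WW f g : rcov P (fW f) (fW g) = rcov P (fX f) (fX g) - g (L (cYX f)).
Proof.
rewrite (rcov_WE f (sW g)) (rcovC P (fY _)) rcov_WY subr0 rcovC (rcov_WE g (sX f)).
by rewrite (rcovC P (fX g)) (rcovC P (fY _)) -(cYXE f (ell g)) ellE.
Qed.

Lemma measurable_residual : borel_fun setT W.
Proof. by apply: measurable_fun_dual => // f; case: (sW f). Qed.

Lemma gaussian_shift (u : Omega -> R) c : measurable_fun setT u ->
  real_gaussian_measure (pushforward P u) ->
  real_gaussian_measure (pushforward P (fun t => u t + c)).
Proof.
move=> mu /(gaussian_moments_rv mu)[v0 _ ucos].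
apply: (gaussian_rv_cos (m := \int[P]_x u x + c) _ v0).
  exact: measurable_funD.
move=> t e; rewrite (_ : t * (\int[P]_x u x + c) + e = t * \int[P]_x u x + (t * c + e)); last first.
  by rewrite mulrDr addrA.
rewrite -ucos; apply: eq_Rintegral => x _.
by rewrite mulrDr addrA.
Qed.

Let gaussian_WY f g : real_gaussian_measure (pushforward P (fun t => fW f t + fY g t)).
Proof.
(* Up to a constant, f(W) + g(Y) equals f(X) + h(Y) with h = g - [ell f], which is Gaussian by joint
   Gaussianity. *)
have [h hE] := dual_lin 1 (-1) g (ell f).
have := gaussian_shift (ell f EY) _ (joint_gaussian_dual gXY f h).
have -> : (fun t => ((f (X t) : R) + h (Y t)) + ell f EY) = fun t => fW f t + fY g t.
  by apply/funext => t; rewrite /fW WE hE /fX /fY; ring.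
by apply; apply: measurable_funD; [case: (sX f)|case: (sY h)].
Qed.

Lemma gaussian_residual : gaussian_rv P W.
Proof.
split; first exact: measurable_residual.
move=> f; have := gaussian_WY f (dual0 Rn); congr real_gaussian_measure.
by congr (pushforward P _); apply/funext => t /=; rewrite /fY /= addr0.
Qed.

(** By [rcov_WY] the variance of f(W) + g(Y) is the sum of the two variances, so its cosine
    integrals factor exactly as those of the product measure. *)
Lemma independent_residual (nuW : probability (borel E) R) (nuY : probability (borel Rn) R) :
  law P (W : Omega -> borel E) nuW -> law P (Y : Omega -> borel Rn) nuY ->
  forall M : set (borel E * borel Rn), measurable M ->
    P ((fun t => (W t, Y t)) @^-1` M) = (nuW \x nuY)%E M.
Proof.
move=> lW lY M mM; have mW := measurable_residual.
have mWY : measurable_fun setT (fun t => (W t, Y t) : borel E * borel Rn).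
  by apply/measurable_fun_pairP; split.
have [nu nul] := law_exists P mWY.
transitivity (nu M); first exact/esym/nul.
apply: (measure_eq_cos_prod sE (separable_row n)) => //; try exact: probability_lty.
move=> f g c.
have mfg : measurable_fun setT (fun z : borel E * borel Rn => (f z.1 : R) + g z.2).
  apply: measurable_funD.
    exact: (measurableT_comp (measurable_dual f)).
  exact: (measurableT_comp (measurable_dual g)).
rewrite (law_cos mWY nul c Pf mfg) /=.
have cosE (u : Omega -> R) c' : measurable_fun setT u -> real_gaussian_measure (pushforward P u) ->
    \int[P]_t cos (u t + c') = expR (- (rcov P u u / 2)) * cos (\int[P]_t u t + c').
  move=> mu gu; have [_ _ /(_ 1 c')] := gaussian_moments_rv mu gu.
  have -> : \int[P]_x (u x - \int[P]_x u x) ^+ 2 = rcov P u u.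
    by apply: eq_Rintegral => t _; rewrite expr2.
  by rewrite expr1n !mul1r => <-; apply: eq_Rintegral => t _; rewrite mul1r.
have cW c' : \int[nuW]_x cos ((f x : R) + c') =
    expR (- (rcov P (fW f) (fW f) / 2)) * cos (\int[P]_t fW f t + c').
  rewrite (law_cos mW lW c' Pf (measurable_dual f)) -cosE//; first by case: (sW f).
  by case: gaussian_residual => _; exact.
have cY c' : \int[nuY]_x cos ((g x : R) + c') =
    expR (- (rcov P (fY g) (fY g) / 2)) * cos (\int[P]_t fY g t + c').
  rewrite (law_cos mY lY c' Pf (measurable_dual g)) -cosE//; first by case: (sY g).
  by case: gY => _; exact.
rewrite (product_cos (measurable_dual f) (measurable_dual g) cW cY).
have mWYf : measurable_fun setT (fun t => fW f t + fY g t).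
  by apply: measurable_funD; [case: (sW f)|case: (sY g)].
have sWY := sq_integrable_lin 1 1 (sW f) (sY g).
have eWY : (fun t => 1 * fW f t + 1 * fY g t) = (fun t => fW f t + fY g t).
  by apply/funext => t; rewrite !mul1r.
have vE := rcov_linl Pf 1 1 (sW f) (sY g) sWY.
rewrite (rcov_linr Pf 1 1 (sW f) (sY g) (sW f)) in vE.
rewrite (rcov_linr Pf 1 1 (sW f) (sY g) (sY g)) in vE.
rewrite (rcovC P (fY g) (fW f)) rcov_WY !mul1r addr0 add0r eWY in vE.
have mE := Rintegral_lin 1 1 (sq_integrable_integrable Pf (sW f)) (intY g).
rewrite !mul1r in mE.
have := cosE _ c mWYf (gaussian_WY f g).
rewrite vE -eWY mE mulrDl opprD expRD => <-.
by apply: eq_Rintegral => t _; rewrite /= ?mul1r.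
Qed.

Definition conditional_mean t : E := EX + L (Y t - EY).
Notation Z := conditional_mean.

Let ZE (f : dual E) t : f (Z t) = fY (ell f) t + (f EX - ell f EY) :> R.
Proof. by rewrite /Z dualD -ellE dualB /fY addrCA. Qed.

Let measurable_fZ (f : dual E) : measurable_fun setT (fun t => f (Z t) : R).
Proof.
have -> : (fun t => f (Z t) : R) = fun t => fY (ell f) t + (f EX - ell f EY).
  by apply/funext => t; rewrite ZE.
by apply: measurable_funD => //; case: (sY (ell f)).
Qed.

Lemma gaussian_conditional_mean : gaussian_rv P Z.
Proof.
split; first exact: measurable_fun_dual.
move=> f; have [msY _] := sY (ell f); have [_ /(_ (ell f))] := gY.
move=> /(gaussian_shift (f EX - ell f EY) msY); congr real_gaussian_measure.
by congr (pushforward P _); apply/funext => t /=; rewrite ZE.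
Qed.

Lemma mean_conditional_mean (f : dual E) : \int[P]_t f (Z t) = f EX :> R.
Proof.
transitivity (\int[P]_t (fY (ell f) t + (f EX - ell f EY))).
  by apply: eq_Rintegral => t _; rewrite ZE.
by rewrite Rintegral_shift// mean_Y addrC subrK.
Qed.

Lemma rcov_conditional_mean (f g : dual E) :
  rcov P (fun t => f (Z t) : R) (fun t => g (Z t) : R) = g (L (cYX f)).
Proof.
have e (h : dual E) : (fun t => h (Z t) : R) = fun t => fY (ell h) t + (h EX - ell h EY).
  by apply/funext => t; rewrite ZE.
by rewrite !e rcov_shift// -(AE (ell g) (ell f)) A_ell ellE.
Qed.

Lemma conditional_mean_dual (f : dual E) :
  exists l : dual Rn, forall t, f (Z t - EX) = l (Y t - EY) :> R.
Proof. by exists (ell f) => t; rewrite /Z addrAC subrr add0r ellE. Qed.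

Lemma mean_residual (f : dual E) : \int[P]_t f (W t) = f EX :> R.
Proof. exact: mean_W. Qed.

Lemma rcov_residual (f g : dual E) :
  rcov P (fun t => f (W t) : R) (fun t => g (W t) : R) =
  rcov P (fun t => f (X t) : R) (fun t => g (X t) : R) - g (L (cYX f)).
Proof. exact: rcov_WW. Qed.

End conditioning.

(** * Independence and disintegration *)

Lemma borel_countably_generated (R : realType) (E : normedModType R) :
  separable_space E -> exists D : nat -> set E,
    (forall i, open (D i)) /\ @measurable _ (borel E) = <<s range D >>.
Proof.
move=> sE; have [s ds] := dense_sequence (0 : E) sE.
(* Balls of radius 1/(n + 1) around a dense sequence, numbered by codes of pairs; a number that
   codes no pair repeats the ball of the pair (0, 0). *)
pose D i : set E := let ab := odflt (0%N, 0%N) (unpickle i) in ball (s ab.1) ab.2.+1%:R^-1.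
have oD i : open (D i) by apply: ball_open; rewrite invr_gt0.
exists D; split => //; apply/seteqP; split; apply: smallest_sub.
- exact: smallest_sigma_algebra.
- move=> U oU.
  have -> : U = \bigcup_(i in [set i | D i `<=` U]) D i.
    apply/seteqP; split => x; last by move=> [i /= DU /DU].
    move=> Ux; have /nbhs_ballP[e /= e0 eU] := open_nbhs_nbhs (conj oU Ux).
    have e2 : 0 < e / 2 by rewrite divr_gt0.
    have [n _ /(_ n (leqnn n)) /= nE] := near_infty_natSinv_lt (PosNum e2).
    have n0 : (0 : R) < n.+1%:R^-1 by rewrite invr_gt0.
    have [k] := ds _ (@ball_open _ E x n.+1%:R^-1) (ex_intro _ _ (ballxx _ n0)).
    have DE : D (pickle (k, n)) = ball (s k) n.+1%:R^-1 by rewrite /D pickleK.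
    rewrite -ball_normE/= => sk; exists (pickle (k, n)); rewrite /= DE.
      move=> y; rewrite -ball_normE /= => ky; apply: eU; rewrite -ball_normE /=.
      have := ler_normD (x - s k) (s k - y); rewrite addrA subrK => h.
      by move: (n.+1%:R^-1) sk ky nE => r sk ky nE; lra.
    by rewrite -ball_normE /= distrC.
  apply: (@bigcup_measurable _ (g_sigma_algebraType (range D))) => i _.
  by apply: sub_sigma_algebra; exists i.
- exact: smallest_sigma_algebra.
- by move=> _ [i _ <-]; apply: sub_sigma_algebra; exact: oD.
Qed.

Section disintegration.
Context d (Omega : measurableType d) (R : realType) (P : probability Omega R).
Context (E F : normedModType R) (sE : separable_space E).
Context (X : {RV P >-> borel E}) (Y : {RV P >-> borel F}) (W : Omega -> E) (g : F -> E).
Hypotheses (mW : borel_fun setT W) (mg : measurable_fun setT (g : borel F -> borel E)).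
Hypothesis XE : forall t, X t = W t + g (Y t) :> E.
Hypothesis indep : forall nuW : probability (borel E) R,
  law P (W : Omega -> borel E) nuW ->
  forall M : set (borel E * borel F), measurable M ->
    P ((fun t => (W t, Y t)) @^-1` M) = (nuW \x distribution P Y)%E M.

Let nuY : probability (borel F) R := distribution P Y.

(** Under the product law the integral is P(Y in B) times the integral of h(W). With h a centred
    functional, this is the averaging property of the conditional expectation. *)
Lemma independent_integral0 (h : borel E -> R) (B : set (borel F)) :
  measurable_fun setT h -> P.-integrable setT (EFin \o (fun t => h (W t))) ->
  \int[P]_t h (W t) = 0 -> measurable B ->
  \int[P]_(t in Y @^-1` B) h (W t) = 0.
Proof.
move=> mh hi h0 mB; have [nuW lW] := law_exists P mW.
have mWY : measurable_fun setT (fun t => (W t, Y t) : borel E * borel F).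
  by apply/measurable_fun_pairP; split => //; exact: measurable_funP.
have lWY : law P (fun t => (W t, Y t) : borel E * borel F) (nuW \x nuY)%E.
  by move=> M mM; exact/esym/(indep lW).
pose k (z : borel E * borel F) : R := h z.1 * \1_B z.2.
have mk : measurable_fun setT k.
  apply: measurable_funM; first exact: (measurableT_comp mh).
  have mi : measurable_fun setT (\1_B : borel F -> R) by exact: measurable_indic.
  exact: (measurableT_comp mi).
have ik : P.-integrable setT (EFin \o (fun t => k (W t, Y t))).
  apply: (le_integrable _ _ _ hi) => //.
    by apply/measurable_EFinP; exact: (measurableT_comp mk mWY).
  move=> t _; rewrite lee_fin normrM ler_piMr// indicE normr_nat lern1.
  by case: (_ \in _).
have -> : \int[P]_(t in Y @^-1` B) h (W t) = \int[P]_t k (W t, Y t).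
  rewrite Rintegral_mkcond; apply: eq_Rintegral => t _.
  rewrite patchE /k indicE /= (_ : (t \in Y @^-1` B) = (Y t \in B)).
    by case: (_ \in B); rewrite ?mulr1 ?mulr0.
  by apply/idP/idP => /set_mem H; apply: mem_set.
have [ikn <-] := law_Rintegral mWY lWY mk ik.
rewrite product_Rintegral//.
have [inu eh] := law_Rintegral mW lW mh hi.
have e1 x : (\int[nuY]_y (k (x, y))%:E = (fine (nuY B) * h x)%:E)%E.
  rewrite /k /=; under eq_integral do rewrite EFinM.
  rewrite integralZl//; last first.
    apply: (integrable_bounded (probability_lty nuY) (K := 1)).
      exact: measurable_indic.
    by move=> t; rewrite indicE normr_nat lern1; case: (_ \in _).
  rewrite integral_indic// setIT mulrC EFinM fineK//.
  exact: fin_num_measure.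
under eq_integral do rewrite e1.
have := RintegralZl (fine (nuY B)) measurableT inu.
by rewrite /Rintegral => ->; move: eh h0; rewrite /Rintegral => -> ->; rewrite mulr0.
Qed.

Variable k : R.-pker (borel F) ~> (borel E).
Hypothesis kP : is_regular_cond_prob X Y k.

Lemma regular_cond_prob_unique : exists N : set (borel F),
  [/\ measurable N, nuY N = 0%E &
    forall y, ~ N y -> forall B : set (borel E), measurable B ->
      k y B = P ((fun t => W t + g y) @^-1` B)].
Proof.
have [nuW lW] := law_exists P mW.
pose S (z : borel E * borel F) : borel E := (z.1 : E) + g z.2.
have mS : measurable_fun setT S.
  apply: measurable_fun_dual => // f.
  have -> : (fun z => f (S z) : R) = fun z => (f z.1 : R) + f (g z.2).
    by apply/funext => z; rewrite /S dualD.
  apply: measurable_funD; first exact: (measurableT_comp (measurable_dual f)).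
  exact: (measurableT_comp (measurableT_comp (measurable_dual f) mg)).
(* The law of W + g y, written as the measure of a section so that its measurability in y is an
   instance of Tonelli's theorem. *)
pose k0 y B := nuW (ysection (S @^-1` B) y).
have mSB B : measurable B -> measurable (S @^-1` B).
  by move=> mB; rewrite -[X in measurable X]setTI; exact: mS.
have k0E y B : measurable B -> k0 y B = P ((fun t => W t + g y) @^-1` B).
  move=> mB; rewrite /k0 lW; last exact: measurable_ysection (mSB _ mB).
  by congr (P _); apply/seteqP; split => t; rewrite /= /ysection /= inE.
have mk0 B : measurable B -> measurable_fun setT (k0 ^~ B).
  by move=> mB; exact: measurable_fun_ysection (mSB _ mB).
have kae B : measurable B -> ae_eq nuY setT (k ^~ B) (k0 ^~ B).
  move=> mB; apply: integral_ae_eq => //.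
  - apply/integrableP; split; first exact: measurable_kernel.
    apply: (@le_lt_trans _ _ (\int[nuY]_x (cst 1%E x))%E); last first.
      by rewrite integral_cst// mul1e [X in (X < _)%E]probability_setT ltry.
    apply: ge0_le_integral => //.
      by apply: measurableT_comp => //; exact: measurable_kernel.
    move=> y _; rewrite gee0_abs//= -(@prob_kernel _ _ _ _ _ k y).
    by apply: le_measure => //; exact: mem_set.
  - exact: mk0.
  (* For fixed B, both versions have the same integral over every A: independence turns the joint
     probability into the product measure of [M], and Tonelli integrates its sections. *)
  - move=> A _ mA; rewrite -(kP mB mA).
    pose M := S @^-1` B `&` snd @^-1` A.
    have mM : measurable M.
      apply: measurableI; first exact: mSB.
      by rewrite -[X in measurable X]setTI; exact: measurable_snd.
    transitivity ((nuW \x nuY)%E M).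
      rewrite -(indep lW mM); congr (P _).
      by apply/seteqP; split => t; rewrite /M /S /= XE.
    pose f1 (z : borel E * borel F) : \bar R := (\1_M z)%:E.
    have mf1 : measurable_fun setT f1.
      by apply/measurable_EFinP; exact: measurable_indic.
    have f10 z : (0 <= f1 z)%E by rewrite lee_fin.
    have := @fubini_tonelli2 _ _ _ _ R nuW nuY f1 mf1 f10.
    rewrite /f1 integral_indic// setIT => ->.
    rewrite [RHS]integral_mkcond; apply: eq_integral => y _.
    rewrite /fubini_G /f1 patchE.
    have [yA|yA] := boolP (y \in A).
      rewrite /k0 -(setIT (ysection _ _)) -integral_indic//; last exact: measurable_ysection (mSB _ mB).
      apply: eq_integral => w _; rewrite !indicE; congr (_%:R%:E); congr nat_of_bool.
      apply/idP/idP => /set_mem.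
        by move=> [SB _]; apply: mem_set; rewrite /ysection /= inE.
      by rewrite /ysection /= inE => SB; apply: mem_set; split => //; exact: set_mem.
    rewrite integral0_eq// => w _; rewrite indicE memNset//= => -[_].
    by move/mem_set; apply/negP.
have [D [oD DE]] := borel_countably_generated sE.
(* Finite intersections of the generators, numbered by codes of lists: countably many, so that one
   null set serves them all, and stable under intersection. The default list gives the whole
   space. *)
pose C n : set (borel E) := \big[setI/setT]_(i <- odflt [::] (unpickle n)) D i.
have mD i : measurable (D i : set (borel E)) by apply: sub_sigma_algebra; exact: oD.
have mC n : measurable (C n) by apply: bigsetI_measurable => i _; exact: mD.
have [N [mN N0 NC]] := ae_foralln (fun n => kae _ (mC n)).
exists N; split => // y Ny B mB.
have kC n : k y (C n) = k0 y (C n).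
  by apply: contrapT => ne; apply: Ny; apply: NC => /= /(_ n I).
have my : measurable_fun setT ((fun t => W t + g y) : Omega -> borel E).
  apply: measurable_fun_dual => // f.
  have -> : (fun t => f (W t + g y) : R) = fun t => (f (W t) : R) + f (g y).
    by apply/funext => t; rewrite dualD.
  by apply: measurable_funD => //; exact: (measurableT_comp (measurable_dual f) mW).
have [nu nuE] := law_exists P my.
transitivity (nu B); last exact: nuE.
have CE s : C (pickle s) = \big[setI/setT]_(i <- s) D i by rewrite /C pickleK.
apply: (measure_unique (range C) (fun=> setT)) => //.
- apply/seteqP; split; last first.
    apply: smallest_sub; first exact: sigma_algebra_measurable.
    by move=> _ [n _ <-]; exact: mC.
  rewrite DE; apply: smallest_sub; first exact: smallest_sigma_algebra.
  move=> _ [i _ <-]; apply: sub_sigma_algebra; exists (pickle [:: i]) => //.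
  by rewrite CE big_seq1.
- move=> _ _ [m _ <-] [n _ <-].
  exists (pickle (odflt [::] (unpickle m) ++ odflt [::] (unpickle n) : seq nat)) => //.
  by rewrite CE big_cat.
- by move=> _; exists (pickle ([::] : seq nat)) => //; rewrite CE big_nil.
- by rewrite bigcup_const.
- by move=> _ [n _ <-]; rewrite kC k0E//; exact/esym/nuE.
- by move=> _; rewrite prob_kernel ltry.
Qed.

End disintegration.

(** * Normal conditional laws and the conditional expectation *)

(** Means and covariances under [Q] are transported to [P] along [V], where functionals determine
    them. [Q] enters only as a finite measure related to [V] by [law], which suits a kernel at a
    fixed point. *)
Lemma gaussian_law_is_normal d (Omega : measurableType d) (R : realType) (P : probability Omega R)
    (E : completeNormedModType R) (V : Omega -> E) (Q : {measure set (borel E) -> \bar R})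
    (m : E) (K : dual E -> E) :
  separable_space E -> gaussian_rv P V -> (Q setT < +oo)%E -> law P (V : Omega -> borel E) Q ->
  (forall f : dual E, f m = \int[P]_t f (V t) :> R) ->
  (forall f g : dual E, f (K g) = rcov P (fun t => g (V t) : R) (fun t => f (V t) : R) :> R) ->
  is_normal Q m K.
Proof.
move=> sE gV Qf lQ mE KE; have iV := gaussian_norm_sq_integrable sE gV.
have Pf := probability_lty P; have [mV [_ V2]] := iV.
have mnorm2 : measurable_fun setT (fun x : borel E => `|x : E| ^+ 2).
  by apply: measurable_funX; exact: measurable_norm.
have iQ : norm_sq_integrable Q (fun x : borel E => x : E).
  split; first exact: measurable_id.
  split; first exact: measurable_norm.
  by case: (law_Rintegral mV lQ mnorm2 V2).
have sV (f : dual E) : sq_integrable P (fun t => f (V t) : R) by exact: (norm_sq_integrable_dual f iV).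
have meanQ (f : dual E) : \int[Q]_x (f x : R) = \int[P]_t f (V t).
  case: (law_Rintegral mV lQ (measurable_dual f)) => //.
  exact: sq_integrable_integrable.
split.
- move=> f; case: gV => _ /(_ f) [a [s h]]; exists a, s => B mB.
  rewrite -h// /pushforward lQ//.
  by rewrite -[_ @^-1` _]setTI; exact: (measurable_dual f).
- by apply: dual_separates => f; rewrite (dual_expect Qf sE iQ) meanQ mE.
- move=> g; apply: dual_separates => f.
  rewrite (dual_cross_cov Qf sE sE iQ iQ) KE /rcov !meanQ.
  have mu (h : dual E) : measurable_fun setT (fun x : borel E => (h x : R) - \int[P]_t h (V t)).
    by apply: measurable_funB => //; exact: measurable_dual.
  case: (law_Rintegral mV lQ (measurable_funM (mu g) (mu f))) => //.
  by apply: sq_integrable_mul => //; exact: sq_integrable_shift.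
Qed.

Section gaussian_conditioning.
Context d (Omega : measurableType d) (R : realType) (P : probability Omega R).
Context (E : completeNormedModType R) (n : nat).
Notation Rn := 'rV[R]_n.
Context (X : {RV P >-> borel E}) (Y : {RV P >-> borel Rn}).
Hypotheses (sE : separable_space E)
  (gXY : jointly_gaussian P (X : Omega -> E) (Y : Omega -> Rn)).
Variables (EX : E) (EY : Rn) (A : dual Rn -> Rn) (B : Rn -> dual Rn).
Variables (cXY : dual Rn -> E) (cYX : dual E -> Rn) (cXX : dual E -> E).
Hypothesis mean_X : forall f : dual E, \int[P]_t f (X t) = f EX :> R.
Hypothesis mean_Y : forall g : dual Rn, \int[P]_t g (Y t) = g EY :> R.
Hypothesis AE : forall f g : dual Rn,
  f (A g) = rcov P (fun t => g (Y t) : R) (fun t => f (Y t) : R) :> R.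
Hypothesis cXYE : forall (f : dual E) (g : dual Rn),
  f (cXY g) = rcov P (fun t => g (Y t) : R) (fun t => f (X t) : R) :> R.
Hypothesis cYXE : forall (f : dual E) (g : dual Rn),
  g (cYX f) = rcov P (fun t => f (X t) : R) (fun t => g (Y t) : R) :> R.
Hypothesis cXXE : forall f g : dual E,
  f (cXX g) = rcov P (fun t => g (X t) : R) (fun t => f (X t) : R) :> R.
Hypothesis BE : B = Defs.pinv A.

Let mX : borel_fun setT (X : Omega -> E) := measurable_funPT X.
Let mY : borel_fun setT (Y : Omega -> Rn) := measurable_funPT Y.
Let L := regression B cXY.
Let W := residual X Y EY B cXY.
Let m (y : Rn) : E := EX + L (y - EY).
Let C (f : dual E) : E := cXX f - L (cYX f).
Let Z := conditional_mean Y EX EY B cXY.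

Let mL : measurable_fun setT (L : borel Rn -> borel E).
Proof. exact: (measurable_regression sE mX mY gXY AE cXYE cYXE BE). Qed.

Let mW : borel_fun setT W.
Proof. exact: (measurable_residual sE mX mY gXY EY AE cXYE cYXE BE). Qed.

Let gW : gaussian_rv P W.
Proof. exact: (gaussian_residual sE mX mY gXY EY AE cXYE cYXE BE). Qed.

Let gZ : gaussian_rv P Z.
Proof. exact: (gaussian_conditional_mean sE mX mY gXY EX EY AE cXYE cYXE BE). Qed.

Let mean_W (f : dual E) : \int[P]_t f (W t) = f EX :> R.
Proof. exact: (mean_residual sE mX mY gXY mean_X mean_Y AE cXYE cYXE BE). Qed.

Let rcov_W (f g : dual E) : f (C g) = rcov P (fun t => g (W t) : R) (fun t => f (W t) : R) :> R.
Proof. by rewrite (rcov_residual sE mX mY gXY EY AE cXYE cYXE BE) /C dualB cXXE. Qed.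

Let g (y : borel Rn) : borel E := L (y - EY).

Let mg : measurable_fun setT (g : borel Rn -> borel E).
Proof.
apply: (measurableT_comp mL).
by apply: (borel_funB (separable_row n)); [exact: measurable_id|exact: measurable_cst].
Qed.

Let mm : measurable_fun setT (m : borel Rn -> borel E).
Proof.
apply: measurable_fun_dual => // f.
have -> : (fun y : borel Rn => f (m y) : R) = fun y => f EX + f (g y).
  by apply/funext => y; rewrite /m dualD.
by apply: measurable_funD => //; exact: (measurable_fun_dual_comp f mg).
Qed.

Let XE t : X t = W t + g (Y t) :> E.
Proof. by rewrite /W /residual subrK. Qed.

Let indep (nuW : probability (borel E) R) : law P (W : Omega -> borel E) nuW ->
  forall M : set (borel E * borel Rn), measurable M ->
    P ((fun t => (W t, Y t)) @^-1` M) = (nuW \x distribution P Y)%E M.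
Proof.
move=> lW; apply: (independent_residual sE mX mY gXY AE cXYE cYXE BE lW).
by move=> ? _.
Qed.

Lemma conditional_law (k : R.-pker (borel Rn) ~> (borel E)) :
  is_regular_cond_prob X Y k ->
  exists N : set (borel Rn),
    [/\ measurable N, distribution P Y N = 0%E &
        forall y : Rn, ~ N y -> is_normal (k y) (m y) C].
Proof.
move=> kP; have [N [mN N0 kN]] := regular_cond_prob_unique sE mW mg XE indep kP.
exists N; split => // y Ny.
have iW (f : dual E) : P.-integrable setT (EFin \o (fun t => f (W t) : R)).
  apply: (sq_integrable_integrable (probability_lty P)).
  exact: (norm_sq_integrable_dual f (gaussian_norm_sq_integrable sE gW)).
have VE (f : dual E) : (fun t => f (W t + g y) : R) = fun t => (f (W t) : R) + f (g y).
  by apply/funext => t; rewrite dualD.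
apply: (@gaussian_law_is_normal _ _ _ P _ (fun t => W t + g y) (k y) (m y) C sE).
- split.
    apply: measurable_fun_dual => // f; rewrite VE.
    by apply: measurable_funD => //; exact: measurable_fun_dual_comp.
  move=> f; have := gaussian_shift (f (g y)) (measurable_fun_dual_comp f mW) (gW.2 f).
  by rewrite -VE.
- by rewrite [ltLHS]prob_kernel ltry.
- by move=> D mD; exact: kN.
- by move=> f; rewrite VE Rintegral_shift// mean_W /m dualD.
- by move=> f h; rewrite !VE rcov_shift.
Qed.

(** Z is a Borel function of Y, and X - Z = W - EX is centred and independent of Y, so its
    functionals integrate to 0 over every event of sigma(Y). *)
Lemma conditional_mean_cond_expect : is_cond_expect P (X : Omega -> E) (Y : Omega -> Rn) Z.
Proof.
have Pf := probability_lty P.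
have [mZ sZ] := gaussian_norm_sq_integrable sE gZ.
have [_ sX] := gaussian_norm_sq_integrable sE (joint_gaussian_fst mX gXY).
have iZ := sq_integrable_integrable Pf sZ.
have iX := sq_integrable_integrable Pf sX.
split.
- move=> D mD; exists (m @^-1` D); last by rewrite setTI.
  by rewrite -[_ @^-1` _]setTI; exact: mm.
- by have [] := bochner_integralP sE Pf measurableT mZ iZ.
- move=> _ [D mD <-]; rewrite setTI.
  have mYD : measurable (Y @^-1` D) by rewrite -[_ @^-1` _]setTI; exact: mY.
  have [_ eZ] := bochner_integralP sE Pf mYD mZ iZ.
  have [_ eX] := bochner_integralP sE Pf mYD mX iX.
  apply: dual_separates => f; rewrite eZ eX; apply/esym/eqP; rewrite -subr_eq0.
  have sq U : norm_sq_integrable P U -> P.-integrable setT (EFin \o (fun t => f (U t) : R)).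
    by move=> iU; exact: (sq_integrable_integrable Pf (norm_sq_integrable_dual f iU)).
  have iXD : P.-integrable (Y @^-1` D) (EFin \o (fun t => f (X t) : R)).
    by apply: (integrableS measurableT) => //; exact: sq.
  have iZD : P.-integrable (Y @^-1` D) (EFin \o (fun t => f (Z t) : R)).
    by apply: (integrableS measurableT) => //; exact: sq.
  have iW := sq _ (gaussian_norm_sq_integrable sE gW).
  rewrite -RintegralB//; apply/eqP.
  have ih : P.-integrable setT (EFin \o (fun t => (f (W t) : R) - f EX)).
    exact: (sq_integrable_integrable Pf (sq_integrable_shift Pf (- f EX)
      (norm_sq_integrable_dual f (gaussian_norm_sq_integrable sE gW)))).
  have mh : measurable_fun setT (fun w : borel E => (f w : R) - f EX).
    by apply: measurable_funB => //; exact: measurable_dual.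
  rewrite -(independent_integral0 mW indep mh ih _ mD).
    by apply: eq_Rintegral => t _; rewrite XE /Z /conditional_mean !dualD opprD addrACA subrr addr0.
  by rewrite (@Rintegral_shift _ _ _ _ _ (- f EX)) // mean_W subrr.
Qed.

Lemma conditional_mean_moments :
  expect P Z = EX /\ forall f, cross_cov P Z Z f = regression B cXY (cYX f).
Proof.
have Pf := probability_lty P.
have iZ := gaussian_norm_sq_integrable sE gZ.
split; first by apply: dual_separates => f; rewrite (dual_expect Pf sE iZ)
  (mean_conditional_mean sE mX mY gXY EX mean_Y AE cXYE cYXE BE).
move=> f; apply: dual_separates => h; rewrite (dual_cross_cov Pf sE sE iZ iZ).
by rewrite (rcov_conditional_mean sE mX mY gXY EX EY AE cXYE cYXE BE).
Qed.

(** A functional of Z - EZ is pointwise a functional of Y - EY, so the same approximants serve with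
    the same error. *)
Lemma conditional_mean_gaussian_space :
  expect P Z = EX -> expect P (Y : Omega -> Rn) = EY ->
  gaussian_space P Z `<=` gaussian_space P (Y : Omega -> Rn).
Proof.
move=> eZ eY h [hL hE]; split => // e /hE [f].
have [l lE] := conditional_mean_dual sE mX mY gXY EX EY AE cXYE cYXE BE f.
move=> fe; exists l; rewrite eY; move: fe; rewrite eZ.
congr (Lnorm _ _ _ < _)%E.
by apply/funext => t /=; rewrite lE.
Qed.

End gaussian_conditioning.
Theorem theorem3p1 (R : realType) (d : measure_display) (Omega : measurableType d)
    (P : probability Omega R) (E : completeNormedModType R) (n : nat)
    (X : {RV P >-> borel E}) (Y : {RV P >-> borel 'rV[R]_n}) :
  separable_space E ->
  jointly_gaussian P (X : Omega -> E) (Y : Omega -> 'rV[R]_n) ->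
  let mu_XY : 'rV[R]_n -> E := cond_mean P (X : Omega -> E) (Y : Omega -> 'rV[R]_n) in
  let C_XY : dual E -> E := cond_cov P (X : Omega -> E) (Y : Omega -> 'rV[R]_n) in
  let Z : Omega -> E := mu_XY \o (Y : Omega -> 'rV[R]_n) in
  (forall k : R.-pker (borel 'rV[R]_n) ~> (borel E),
     is_regular_cond_prob X Y k ->
     exists N : set (borel 'rV[R]_n),
       [/\ measurable N, distribution P Y N = 0%E &
           forall y : 'rV[R]_n, ~ N y -> is_normal (k y) (mu_XY y) C_XY]) /\
  [/\ is_cond_expect P (X : Omega -> E) (Y : Omega -> 'rV[R]_n) Z,
      gaussian_rv P Z,
      expect P Z = expect P (X : Omega -> E),
      forall x' : dual E,
        cross_cov P Z Z x' = cross_cov P (X : Omega -> E) (X : Omega -> E) x' - C_XY x' &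
      gaussian_space P Z `<=` gaussian_space P (Y : Omega -> 'rV[R]_n)].
Proof.
move=> sE gXY mu_XY C_XY Z.
have mX : borel_fun setT (X : Omega -> E) := measurable_funPT X.
have mY : borel_fun setT (Y : Omega -> 'rV[R]_n) := measurable_funPT Y.
have sF := @separable_row R n.
have iX := gaussian_norm_sq_integrable sE (joint_gaussian_fst mX gXY).
have iY := gaussian_norm_sq_integrable sF (joint_gaussian_snd mY gXY).
have Pf := probability_lty P.
(* These facts instantiate the abstract means and operators by [expect] and [cross_cov]. *)
have mean_X f := esym (dual_expect Pf sE iX f).
have mean_Y f := esym (dual_expect Pf sF iY f).
have AE := dual_cross_cov Pf sF sF iY iY.
have cXYE := dual_cross_cov Pf sE sF iX iY.
have cYXE f g := dual_cross_cov Pf sF sE iY iX g f.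
have cXXE := dual_cross_cov Pf sE sE iX iX.
have BE := erefl (Defs.pinv (cross_cov P (Y : Omega -> 'rV[R]_n) (Y : Omega -> 'rV[R]_n))).
have [EZ CZ] := conditional_mean_moments sE gXY (expect P (X : Omega -> E)) mean_Y AE cXYE cYXE BE.
split; first exact: (conditional_law sE gXY mean_X mean_Y AE cXYE cYXE cXXE BE).
split.
- exact: (conditional_mean_cond_expect sE gXY mean_X mean_Y AE cXYE cYXE BE).
- exact: (gaussian_conditional_mean sE mX mY gXY _ _ AE cXYE cYXE BE).
- exact: EZ.
- by move=> x'; rewrite [LHS]CZ /C_XY /cond_cov opprB addrC subrK.
- exact: (conditional_mean_gaussian_space sE gXY AE cXYE cYXE BE EZ).
Qed.
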